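(* Let $e = (\mathrm{id}, [0])$ denote the identity element in $K^s$. The curvature tensor $R$ on $K^s$ satisfies $$\langle R(u, v)v, u\rangle_{e} = \|u\|_{e}^2\|v\|_{e}^2 - \langle u, v\rangle_{e}^2 + 3\omega(u,v)^2,$$ where $u = (u_1, [u_2])$ and $v = (v_1, [v_2])$ are elements in $T_{e}K^s$. In particular, the sectional curvature $$\mathrm{sec}(u,v) = \frac{\langle R(u, v)v, u\rangle_{e}}{\|u\|_e^2\|v\|_e^2 - \langle u, v\rangle_e^2}$$ satisfies $$1 \leq \mathrm{sec}(u,v) \leq 4, \qquad u,v \in T_{e}K^s,$$ and $\mathrm{sec}(u,v) = 4$ if and only if $Ju$ is a multiple of $v$.
   Context: $S^1=\mathbb{R}/\mathbb{Z}$ is the circle of length one and $S^1_{4\pi}=\mathbb{R}/4\pi\mathbb{Z}$. Subscript $x$ denotes the derivative in $x$. Throughout, $s>5/2$. The manifold $K^s$. $H_0^s(S^1;\mathbb{R}) = \{u\in H^s(S^1;\mathbb{R}) : u(0)=0\}$. $\mathrm{Diff}_0^s(S^1)$ is the space of orientation-preserving diffeomorphisms $\varphi$ of $S^1$ of Sobolev class $H^s$ with $\varphi(0)=0$, identified with the open subset $\{\mathrm{id}+h : h\in H^s(S^1;\mathbb{R}),\ h_x>-1,\ h(0)=0\}$ of $\mathrm{id}+H_0^s(S^1;\mathbb{R})$. $H^{s-1}(S^1;S^1_{4\pi})/S^1_{4\pi}$ is the set of $H^{s-1}$ maps $\alpha:S^1\to S^1_{4\pi}$ modulo addition of a constant phase,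 with classes $[\alpha]$; it is a Banach manifold modeled on $H^{s-1}(S^1;\mathbb{R})/\mathbb{R}$ (functions modulo constants). $K^s$ is the semidirect product of $\mathrm{Diff}_0^s(S^1)$ and $H^{s-1}(S^1;S^1_{4\pi})/S^1_{4\pi}$, i.e. the product Banach manifold with multiplication $(\varphi,[\alpha])(\psi,[\beta])=(\varphi\circ\psi,[\beta+\alpha\circ\psi])$. $T_{(\varphi,[\alpha])}K^s\simeq H_0^s(S^1;\mathbb{R})\times(H^{s-1}(S^1;\mathbb{R})/\mathbb{R})$. With $\pi(U_2)=U_2-\int_{S^1}U_2\varphi_x\,dx$ at $(\varphi,[\alpha])$, the (weak, right-invariant) metric is $$\langle(U_1,[U_2]),(V_1,[V_2])\rangle_{(\varphi,[\alpha])}=\frac14\int_{S^1}\left(\frac{U_{1x}V_{1x}}{\varphi_x}+\pi(U_2)\pi(V_2)\varphi_x\right)dx,$$ and $\|\cdot\|_e$ is the associated norm at $e$. The metric connection is $\nabla_XY=DY\cdot X-\Gamma_{(\varphi,[\alpha])}(Y,X)$ (in local charts), where, for $u=(u_1,[u_2])$, $v=(v_1,[v_2])\in T_eK^s$ and $\pi(f)=f-\int_{S^1}f\,dx$, $$\Gamma_e(u,v)=-\frac12\begin{pmatrix}A^{-1}\partial_x(u_{1x}v_{1x}+\pi(u_2)\pi(v_2))\\ [u_{1x}\pi(v_2)+v_{1x}\pi(u_2)]\end{pmatrix},\qquad \Gamma_{(\varphi,[\alpha])}(u\circ\varphi,v\circ\varphi)=\Gamma_e(u,v)\circ\varphi,$$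 with $A=-\partial_x^2$ and $(A^{-1}f)(x)=-\int_0^x\int_0^yf(z)\,dz\,dy+x\int_{S^1}\int_0^yf(z)\,dz\,dy$ when $\int_{S^1}f\,dx=0$. The curvature tensor is that of $\nabla$; in a chart, $R_m(U,V)W=D_1\Gamma_m(W,U)V-D_1\Gamma_m(W,V)U+\Gamma_m(\Gamma_m(W,V),U)-\Gamma_m(\Gamma_m(W,U),V)$, where $D_1$ denotes differentiation with respect to the base point $m$. At $e$, the complex structure $J$ and the symplectic form $\omega$ on $K^s$ are given by $$J(u_1,[u_2])=\left(-\int_0^x\pi(u_2)\,dy,\ [u_{1x}]\right),\qquad \omega((u_1,[u_2]),(v_1,[v_2]))=\frac14\int_{S^1}(u_{2x}v_1-v_{2x}u_1)\,dx.$$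
   Formalization: The claims on sec are for linearly independent u, v; ''sec(u,v) = 4 iff Ju is a multiple of v'' is proved for orthogonal u, v (it fails for v = u + Ju), and for all independent u, v it is corrected to: sec(u,v) = 4 iff Ju lies in the span of u and v. *)

(* Defs.v *)
From HB Require Import structures.
From mathcomp Require Import all_boot all_order all_algebra.
From mathcomp Require Import all_classical all_reals all_analysis.
From mathcomp Require Import ring lra.

Set Implicit Arguments.
Unset Strict Implicit.
Unset Printing Implicit Defensive.
Import Order.TTheory GRing.Theory Num.Theory.
Import numFieldNormedType.Exports.
Local Open Scope classical_set_scope.
Local Open Scope ring_scope.

Definition circle_int (R : realType) (f : R -> R) : R :=
  (\int[@lebesgue_measure R]_(x in `[0%R, 1%R]) f x)%R.

Definition cosn (R : realType) (n : int) (x : R) : R := cos (2 * pi * n%:~R * x).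
Definition sinn (R : realType) (n : int) (x : R) : R := sin (2 * pi * n%:~R * x).

Definition fcos (R : realType) (f : R -> R) (n : int) : R :=
  circle_int (fun x => f x * cosn n x).
Definition fsin (R : realType) (f : R -> R) (n : int) : R :=
  circle_int (fun x => f x * sinn n x).

Section CircleInt.
Context {R : realType}.
Implicit Types f g : R -> R.

Lemma circle_integrable f : continuous f ->
  (@lebesgue_measure R).-integrable `[0%R, 1%R] (EFin \o f).
Proof.
move=> cf; apply: continuous_compact_integrable; first exact: segment_compact.
exact: continuous_subspaceT.
Qed.

Lemma circle_intD f g : continuous f -> continuous g ->
  circle_int (f \+ g) = circle_int f + circle_int g.
Proof. by move=> cf cg; rewrite /circle_int RintegralD//; exact: circle_integrable. Qed.

Lemma circle_intZ f c : continuous f ->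
  circle_int (fun x => c * f x) = c * circle_int f.
Proof. by move=> cf; rewrite /circle_int RintegralZl//; exact: circle_integrable. Qed.

Lemma circle_int_cst c : circle_int (fun=> c) = c :> R.
Proof.
rewrite /circle_int Rintegral_cst//=.
rewrite (_ : fine _ = 1) ?mulr1//.
by have := @lebesgue_measure_itv R `[0, 1] => /= ->; rewrite lte_fin ltr01 oppr0 adde0.
Qed.

Lemma le_circle_int f g : continuous f -> continuous g ->
  (forall x, x \in `[0, 1] -> f x <= g x) -> circle_int f <= circle_int g.
Proof.
move=> cf cg fg; apply: le_Rintegral => //; try exact: circle_integrable.
Qed.

Lemma continuous_cosn n : continuous (@cosn R n).
Proof.
move=> x; apply: (@continuous_comp _ _ _ (fun x => 2 * pi * n%:~R * x) cos).
  exact: mulrl_continuous.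
exact: continuous_cos.
Qed.

Lemma continuous_sinn n : continuous (@sinn R n).
Proof.
move=> x; apply: (@continuous_comp _ _ _ (fun x => 2 * pi * n%:~R * x) sin).
  exact: mulrl_continuous.
exact: continuous_sin.
Qed.

Lemma continuousMf f g : continuous f -> continuous g ->
  continuous (fun x => f x * g x).
Proof. by move=> cf cg x; apply: (@continuousM _ R); [exact: cf|exact: cg]. Qed.

Lemma continuousDf f g : continuous f -> continuous g ->
  continuous (fun x => f x + g x).
Proof. by move=> cf cg x; apply: cvgD; [exact: cf|exact: cg]. Qed.

Lemma continuous_cstf (c : R) : continuous (fun _ : R => c).
Proof. by move=> x; exact: cvg_cst. Qed.

Let circle_FTC (F f : R -> R) : continuous f ->
  (forall x : R, is_derive x (1 : R) F (f x)) -> circle_int f = F 1 - F 0.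
Proof.
move=> cf dF; rewrite /circle_int /Rintegral.
have dFx x : derivable F x 1 by have [] := dF x.
have cF x : {for x, continuous F}.
  by apply: differentiable_continuous; apply/derivable1_diffP.
rewrite (@continuous_FTC2 _ f F 0 1)//.
- exact: continuous_subspaceT.
- split => //.
  + by apply: cvg_at_right_filter; exact: cF.
  + by apply: cvg_at_left_filter; exact: cF.
- by move=> x _; rewrite derive1E; have [_ ->] := dF x.
Qed.

Let sin2pin n : sin (2 * pi * n%:~R) = 0 :> R.
Proof.
case: n => n.
  elim: n => [|n IH]; first by rewrite mulr0 sin0.
  rewrite -[n.+1%:~R]/(n.+1%:R) -(natr1 n); have -> : 2 * pi * (n%:R + 1) = 2 * pi * n%:R + pi *+ 2 :> R.
    by rewrite mulr2n; ring.
  by rewrite sinD2pi.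
rewrite NegzE intrN mulrN sinN; apply/eqP; rewrite oppr_eq0; apply/eqP.
elim: n => [|n IH].
  by rewrite mulr1 (_ : 2 * pi = pi *+ 2) ?sin2pi// mulr_natl.
rewrite -[n.+2%:~R]/(n.+2%:R) -(natr1 n.+1).
have -> : 2 * pi * (n.+1%:R + 1) = 2 * pi * n.+1%:R + pi *+ 2 :> R.
  by rewrite mulr2n; ring.
by rewrite sinD2pi.
Qed.

Let cos2pin n : cos (2 * pi * n%:~R) = 1 :> R.
Proof.
have half : 2 * pi * n%:~R = (pi * n%:~R) *+ 2 :> R by rewrite mulr2n; ring.
have /eqP := sin2pin n.
case: n half => n half _.
  elim: n {half} => [|n IH]; first by rewrite mulr0 cos0.
  rewrite -[n.+1%:~R]/(n.+1%:R) -(natr1 n).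
  have -> : 2 * pi * (n%:R + 1) = 2 * pi * n%:R + pi *+ 2 :> R.
    by rewrite mulr2n; ring.
  by rewrite cosD2pi.
rewrite NegzE intrN mulrN cosN; elim: n {half} => [|n IH].
  by rewrite mulr1 (_ : 2 * pi = pi *+ 2) ?cos2pi// mulr_natl.
rewrite -[n.+2%:~R]/(n.+2%:R) -(natr1 n.+1).
have -> : 2 * pi * (n.+1%:R + 1) = 2 * pi * n.+1%:R + pi *+ 2 :> R.
  by rewrite mulr2n; ring.
by rewrite cosD2pi.
Qed.

Lemma circle_int_cosn n : n != 0 -> circle_int (@cosn R n) = 0.
Proof.
move=> n0; have k0 : 2 * pi * n%:~R != 0 :> R.
  by rewrite !mulf_neq0 ?intr_eq0// gt_eqF ?pi_gt0.
have := @circle_FTC (fun x => (2 * pi * n%:~R)^-1 * sin (2 * pi * n%:~R * x))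
  (@cosn R n) (@continuous_cosn n).
rewrite mulr1 mulr0 sin0 sin2pin subrr; apply => x.
rewrite /cosn; apply: is_derive_eq.
by rewrite /GRing.scale/= !mulr1; move: k0; move: (2 * pi * n%:~R) => k k0; field.
Qed.

Lemma circle_int_sinn n : circle_int (@sinn R n) = 0.
Proof.
have [->|n0] := eqVneq n 0.
  rewrite (_ : @sinn R 0 = fun=> 0) ?circle_int_cst//.
  by apply/funext => x; rewrite /sinn mulr0 mul0r sin0.
have k0 : 2 * pi * n%:~R != 0 :> R.
  by rewrite !mulf_neq0 ?intr_eq0// gt_eqF ?pi_gt0.
have := @circle_FTC (fun x => - (2 * pi * n%:~R)^-1 * cos (2 * pi * n%:~R * x))
  (@sinn R n) (@continuous_sinn n).
rewrite mulr1 mulr0 cos0 cos2pin subrr; apply => x.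
rewrite /sinn; apply: is_derive_eq.
by rewrite /GRing.scale/= !mulr1; move: k0; move: (2 * pi * n%:~R) => k k0; field.
Qed.

Lemma circle_int_gt0 f x : continuous f -> (forall y, 0 <= f y) ->
  0 < x < 1 -> 0 < f x -> 0 < circle_int f.
Proof.
move=> cf f0 /andP[x0 x1] fx.
have /nbhs_ballP[d /= d0 dH] : \forall t \near x, `|f x - f t| < f x / 2.
  have := cf x; rewrite /continuous_at => /cvgrPdist_lt; apply.
  by rewrite divr_gt0.
pose e := Num.min (d / 2) (Num.min x (1 - x)).
have e0 : 0 < e.
  by rewrite !lt_min divr_gt0//= x0 subr_gt0.
have ed : e < d.
  rewrite (@le_lt_trans _ _ (d / 2)) ?ge_min ?lexx//; lra.
have ex : e <= x by rewrite !ge_min lexx orbT.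
have ex1 : e <= 1 - x by rewrite !ge_min lexx !orbT.
have sub : `[x, x + e]%classic `<=` `[0%R, 1%R].
  by move=> y /=; rewrite !in_itv/= => /andP[? ?]; apply/andP; split; lra.
have I1 := circle_integrable cf.
have I2 : (@lebesgue_measure R).-integrable `[x, x + e] (EFin \o f).
  by apply: integrableS I1.
have le1 : (\int[@lebesgue_measure R]_(y in `[x, x + e]) f y <= circle_int f)%R.
  rewrite /circle_int /Rintegral fine_le//; try exact: integrable_fin_num.
  apply: ge0_subset_integral => //=.
    by case/integrableP : I1.
  by move=> y _; rewrite lee_fin.
apply: lt_le_trans le1.
have : (\int[@lebesgue_measure R]_(y in `[x, x + e]) (f x / 2) <=
        \int[@lebesgue_measure R]_(y in `[x, x + e]) f y)%R.
  apply: le_Rintegral => //.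
    apply: integrableS (circle_integrable _) => //.
    by move=> y; exact: cvg_cst.
  move=> y /=; rewrite in_itv/= => /andP[xy yx].
  have /= : `|f x - f y| < f x / 2.
    apply: dH; rewrite /ball/= ler0_norm; lra.
  by move=> /ltr_normlP[]; lra.
rewrite Rintegral_cst//=.
have -> : fine (@lebesgue_measure R `[x, x + e]) = e.
  have := @lebesgue_measure_itv R `[x, x + e] => /= ->.
  by rewrite lte_fin ltrDl e0 -EFinB/=; lra.
by apply: lt_le_trans; rewrite mulr_gt0//; lra.
Qed.

End CircleInt.

Section FourierUniqueness.
Context {R : realType}.
Implicit Types f g : R -> R.

Let cosnD m n x : cosn (m + n) x = cosn m x * cosn n x - sinn m x * sinn n x :> R.
Proof. by rewrite /cosn /sinn intrD mulrDr mulrDl cosD. Qed.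

Let sinnD m n x : sinn (m + n) x = sinn m x * cosn n x + cosn m x * sinn n x :> R.
Proof. by rewrite /cosn /sinn intrD mulrDr mulrDl sinD. Qed.

Let cosnN m x : cosn (- m) x = cosn m x :> R.
Proof. by rewrite /cosn intrN mulrN mulNr cosN. Qed.

Let sinnN m x : sinn (- m) x = - sinn m x :> R.
Proof. by rewrite /sinn intrN mulrN mulNr sinN. Qed.

Let cosn0 x : cosn 0 x = 1 :> R.
Proof. by rewrite /cosn mulr0 mul0r cos0. Qed.

Let sinn0 x : sinn 0 x = 0 :> R.
Proof. by rewrite /sinn mulr0 mul0r sin0. Qed.

Let fourier_null f := [/\ continuous f, forall n, fcos f n = 0 & forall n, fsin f n = 0].

Let cf_cosn f n : continuous f -> continuous (fun x => f x * cosn n x).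
Proof. by move=> cf; apply: continuousMf => //; exact: continuous_cosn. Qed.

Let cf_sinn f n : continuous f -> continuous (fun x => f x * sinn n x).
Proof. by move=> cf; apply: continuousMf => //; exact: continuous_sinn. Qed.

Let cf_lin f g a b : continuous f -> continuous g ->
  continuous (fun x => a * f x + b * g x).
Proof.
by move=> cf cg; apply: continuousDf; apply: continuousMf => //;
  exact: continuous_cstf.
Qed.

Let circle_lin f g a b : continuous f -> continuous g ->
  circle_int (fun x => a * f x + b * g x) = a * circle_int f + b * circle_int g.
Proof.
move=> cf cg; rewrite -circle_intZ// -[in RHS](circle_intZ b)// -circle_intD//.
- by apply: continuousMf => //; exact: continuous_cstf.
- by apply: continuousMf => //; exact: continuous_cstf.
Qed.

Let null_lin f g a b : fourier_null f -> fourier_null g ->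
  fourier_null (fun x => a * f x + b * g x).
Proof.
move=> [cf f1 f2] [cg g1 g2]; split; first exact: cf_lin.
- move=> n; rewrite /fcos.
  under [X in circle_int X]eq_fun do rewrite mulrDl -!mulrA.
  by rewrite circle_lin; [|exact: cf_cosn|exact: cf_cosn];
    rewrite -/(fcos f n) -/(fcos g n) f1 g1 !mulr0 addr0.
- move=> n; rewrite /fsin.
  under [X in circle_int X]eq_fun do rewrite mulrDl -!mulrA.
  by rewrite circle_lin; [|exact: cf_sinn|exact: cf_sinn];
    rewrite -/(fsin f n) -/(fsin g n) f2 g2 !mulr0 addr0.
Qed.

Let null_cos f : fourier_null f -> fourier_null (fun x => f x * cosn 1 x).
Proof.
move=> [cf f1 f2]; split; first exact: cf_cosn.
- move=> n; rewrite /fcos.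
  rewrite (_ : (fun x => _) = fun x => 2^-1 * (f x * cosn (n + 1) x)
      + 2^-1 * (f x * cosn (n + -1) x)); last first.
    by apply/funext => x; rewrite !cosnD cosnN sinnN; field.
  by rewrite circle_lin; [|exact: cf_cosn|exact: cf_cosn];
    rewrite -!/(fcos f _) !f1 !mulr0 addr0.
- move=> n; rewrite /fsin.
  rewrite (_ : (fun x => _) = fun x => 2^-1 * (f x * sinn (n + 1) x)
      + 2^-1 * (f x * sinn (n + -1) x)); last first.
    by apply/funext => x; rewrite !sinnD cosnN sinnN; field.
  by rewrite circle_lin; [|exact: cf_sinn|exact: cf_sinn];
    rewrite -!/(fsin f _) !f2 !mulr0 addr0.
Qed.

Let null_sin f : fourier_null f -> fourier_null (fun x => f x * sinn 1 x).
Proof.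
move=> [cf f1 f2]; split; first exact: cf_sinn.
- move=> n; rewrite /fcos.
  rewrite (_ : (fun x => _) = fun x => 2^-1 * (f x * sinn (n + 1) x)
      + - 2^-1 * (f x * sinn (n + -1) x)); last first.
    by apply/funext => x; rewrite !sinnD cosnN sinnN; field.
  by rewrite circle_lin; [|exact: cf_sinn|exact: cf_sinn];
    rewrite -!/(fsin f _) !f2 !mulr0 addr0.
- move=> n; rewrite /fsin.
  rewrite (_ : (fun x => _) = fun x => - 2^-1 * (f x * cosn (n + 1) x)
      + 2^-1 * (f x * cosn (n + -1) x)); last first.
    by apply/funext => x; rewrite !cosnD cosnN sinnN; field.
  by rewrite circle_lin; [|exact: cf_cosn|exact: cf_cosn];
    rewrite -!/(fcos f _) !f1 !mulr0 addr0.
Qed.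

(* For c = cos (2 pi e) this exceeds 1 exactly at distance < e from [x0] mod 1. *)
Let bump x0 c x : R := 1 - c + cosn 1 x0 * cosn 1 x + sinn 1 x0 * sinn 1 x.

Let bumpE x0 c x : bump x0 c x = 1 + (cos (2 * pi * (x - x0)) - c).
Proof.
rewrite mulrBr cosB /bump /cosn /sinn !mulr1; ring.
Qed.

Let null_bump f x0 c n : fourier_null f ->
  fourier_null (fun x => f x * bump x0 c x ^+ n).
Proof.
move=> nf; elim: n => [|n IH].
  by under eq_fun do rewrite expr0 mulr1.
set g := (fun x => f x * _ ^+ n) in IH.
rewrite (_ : (fun x => _) = fun x => (1 - c) * g x + 1 *
   (cosn 1 x0 * (g x * cosn 1 x) + sinn 1 x0 * (g x * sinn 1 x))); last first.
  by apply/funext => x; rewrite /g exprS {1}/bump; ring.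
apply: null_lin => //; apply: null_lin; [exact: null_cos|exact: null_sin].
Qed.

Let null_not_gt0 f x0 : fourier_null f -> 0 < x0 < 1 -> ~~ (0 < f x0).
Proof.
move=> nf x01; apply/negP => fx0; have /andP[x00 x10] := x01.
have [cf _ _] := nf.
have [M M0 fM] : exists2 M, 0 <= M & forall x, x \in `[0, 1] -> `|f x| <= M.
  have /compact_bounded[M [_ mrt]] := continuous_compact
    (continuous_subspaceT cf) (@segment_compact R 0 1).
  exists (`|M| + 1) => [|x x1]; first by rewrite addr_ge0.
  apply: (mrt (`|M| + 1)); first by rewrite (le_lt_trans (ler_norm _)) ?ltrDl.
  by exists x.
have {}cf0 := cf x0.
have /nbhs_ballP[d /= d0 dH] : \forall t \near x0, `|f x0 - f t| < f x0 / 2.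
  by move/cvgrPdist_lt : cf0; apply; rewrite divr_gt0.
pose e := Num.min (Num.min (d / 2) (1 / 4)) (Num.min x0 (1 - x0)).
have e0 : 0 < e.
  by rewrite !lt_min !divr_gt0//= x00 subr_gt0.
have e4 : e <= 1 / 4 by rewrite !ge_min lexx !orbT.
have ed : e < d.
  by apply: (@le_lt_trans _ _ (d / 2)); [rewrite !ge_min lexx|lra].
have ex : e <= x0 by rewrite !ge_min lexx !orbT.
have ex1 : e <= 1 - x0 by rewrite !ge_min lexx !orbT.
have p0 : 0 < pi :> R := pi_gt0 R.
have pp : 0 <= 2 * pi :> R by lra.
pose c : R := cos (2 * pi * e).
pose a := f x0 / 2.
have a0 : 0 < a by rewrite divr_gt0.
pose w x := Num.max (bump x0 c x - 1) 0.
have cb : continuous (bump x0 c).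
  rewrite /bump; apply: continuousDf; [apply: continuousDf|];
    do ?apply: continuousMf; do ?exact: continuous_cstf.
  - exact: continuous_cosn.
  - exact: continuous_sinn.
have cw : continuous w.
  move=> x; apply: (@continuous_max R _ (fun x => bump x0 c x - 1) (fun=> 0)).
    by apply: continuousDf => //; exact: continuous_cstf.
  exact: cvg_cst.
have w_ge0 y : 0 <= w y by rewrite le_max lexx orbT.
have c1 : c < 1.
  rewrite -(@cos0 R) ltr_cos ?in_itv/= ?lexx ?pi_ge0//.
    by rewrite mulr_gt0// mulr_gt0.
  by rewrite mulr_ge0 ?ltW ?mulr_gt0//=; nra.
have w0 : 0 < w x0.
  by rewrite /w bumpE subrr mulr0 cos0 lt_max; apply/orP; left; lra.
have Iw := circle_int_gt0 cw w_ge0 x01 w0.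
have key n x : x \in `[0, 1] -> n%:R * a * w x + - M <= f x * bump x0 c x ^+ n.
  move=> xI; have := fM _ xI; move: (xI); rewrite in_itv/= => /andP[x0' x1'].
  have [xe|xe] := ltP `|x - x0| e.
    move=> _.
    have fa : a <= f x.
      have /= : `|f x0 - f x| < f x0 / 2 by apply: dH; rewrite /ball/= distrC; lra.
      by move=> /ltr_normlP[]; rewrite /a; lra.
    have cx : c <= cos (2 * pi * (x - x0)).
      rewrite -[leRHS]cos_norm normrM (ger0_norm pp).
      rewrite /c leNgt ltr_cos ?in_itv/=; last 2 first.
      - by apply/andP; split; [rewrite !mulr_ge0// ltW|nra].
      - by apply/andP; split; [rewrite !mulr_ge0// ltW|nra].
      by rewrite -leNgt ler_pM2l ?mulr_gt0// ltW.
    have b1 : 0 <= bump x0 c x - 1 by rewrite bumpE; lra.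
    have -> : w x = bump x0 c x - 1 by rewrite /w; apply/max_idPl.
    set b := bump x0 c x - 1 in b1 *.
    have -> : bump x0 c x = 1 + b by rewrite /b; ring.
    have bern : 1 + n%:R * b <= (1 + b) ^+ n.
      elim: n => [|n IH]; first by rewrite mul0r addr0 expr0.
      rewrite exprS -natr1; have : 0 <= n%:R * b by rewrite mulr_ge0.
      nra.
    have nb : 0 <= n%:R * b by rewrite mulr_ge0.
    nra.
  have cx : cos (2 * pi * (x - x0)) <= c.
    have p1 : 0 <= 2 * pi * `|x - x0| by rewrite !mulr_ge0// ltW.
    have xl : `|x - x0| <= 1 - e by rewrite ler_norml; apply/andP; split; lra.
    rewrite -cos_norm normrM (ger0_norm pp).
    have [xh|xh] := leP `|x - x0| (1 / 2).
      rewrite /c leNgt ltr_cos ?in_itv/=; last 2 first.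
      - by apply/andP; split; [rewrite !mulr_ge0// ltW|nra].
      - by apply/andP; split => //; nra.
      by rewrite -leNgt ler_pM2l ?mulr_gt0.
    have -> : cos (2 * pi * `|x - x0|) = cos (2 * pi * (1 - `|x - x0|)).
      rewrite -[RHS]cosN -[RHS]cosD2pi; congr cos; rewrite mulr2n; ring.
    rewrite /c leNgt ltr_cos ?in_itv/=; last 2 first.
    - by apply/andP; split; nra.
    - by apply/andP; split; nra.
    rewrite -leNgt ler_pM2l ?mulr_gt0//; lra.
  have -> : w x = 0 by rewrite /w; apply/max_idPr; rewrite bumpE; lra.
  have b1 : `|bump x0 c x| <= 1.
    have cN1 : -1 <= cos (2 * pi * (x - x0)) by exact: cos_geN1.
    by rewrite ler_norml bumpE; apply/andP; split; lra.
  move=> fx; rewrite mulr0 add0r lerNl (le_trans (ler_norm _))// normrN normrM.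
  rewrite normrX -[leRHS]mulr1 ler_pM// ?exprn_ge0//.
  by rewrite exprn_ile1.
have bound n : n%:R * a * circle_int w <= M.
  have [cn /(_ 0) I0 _] := null_bump x0 c n nf.
  have c1f : continuous (fun=> 1 : R) := @continuous_cstf _ 1.
  have cl := cf_lin (a := n%:R * a) (b := - M) cw c1f.
  have : circle_int (fun x => n%:R * a * w x + - M * 1) <=
      circle_int (fun x => f x * bump x0 c x ^+ n).
    by apply: le_circle_int => // x xI; rewrite mulr1; exact: key.
  rewrite circle_lin// circle_int_cst mulr1.
  have -> : circle_int (fun x => f x * bump x0 c x ^+ n) = 0.
    by rewrite -I0 /fcos; congr circle_int; apply/funext => x; rewrite cosn0 mulr1.
  by rewrite subr_le0.
have aw : 0 < a * circle_int w by rewrite mulr_gt0.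
have := bound (Num.trunc (M / (a * circle_int w))).+1.
apply/negP; rewrite -ltNge -mulrA -ltr_pdivrMr//.
by rewrite truncnS_gt.
Qed.

Lemma fourier_unique f : continuous f -> (forall x, f (x + 1) = f x) ->
  (forall n, fcos f n = 0) -> (forall n, fsin f n = 0) -> forall x, f x = 0.
Proof.
move=> cf pf f1 f2.
have nf : fourier_null f by [].
have nNf : fourier_null (fun x => -1 * f x + 0 * f x) by exact: null_lin.
have in01 x : 0 < x < 1 -> f x = 0.
  move=> x01; have := null_not_gt0 nf x01; have := null_not_gt0 nNf x01.
  by rewrite -!leNgt; lra.
have f0 : f 0 = 0.
  apply/eqP; apply: contraT => f00.
  have /nbhs_ballP[d /= d0 dH] : \forall t \near 0, `|f 0 - f t| < `|f 0|.
    by have := cf 0; rewrite /continuous_at => /cvgrPdist_lt; apply; rewrite normr_gt0.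
  pose t := Num.min (d / 2) (1 / 2).
  have t0 : 0 < t by rewrite lt_min !divr_gt0.
  have td : t < d by apply: (@le_lt_trans _ _ (d / 2)); [rewrite ge_min lexx|lra].
  have t1 : t <= 1 / 2 by rewrite ge_min lexx orbT.
  have /= : `|f 0 - f t| < `|f 0| by apply: dH; rewrite /ball/= sub0r normrN gtr0_norm.
  rewrite (in01 t) ?subr0 ?ltxx//; apply/andP; split => //; lra.
have pfn (n : nat) x : f (x + n%:R) = f x.
  by elim: n => [|n IH]; rewrite ?addr0// -natr1 addrA pf.
have pfz (m : int) x : f (x + m%:~R) = f x.
  by case: m => n; [exact: pfn|rewrite NegzE intrN -{2}(subrK n.+1%:R x) pfn].
move=> x; rewrite -(subrK (Num.floor x)%:~R x) pfz.
have /andP[l u] := floor_itv x.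
have [->//|n0] := eqVneq (x - (Num.floor x)%:~R) 0.
rewrite in01//; rewrite intrD in u.
by rewrite lt_neqAle eq_sym n0/= subr_ge0 l/= ltrBlDl.
Qed.

End FourierUniqueness.

Section SobolevEnergy.
Context {R : realType}.
Implicit Types (f g : R -> R) (s : R).

(* $\sum_{n\in\mathbb Z} (1+n^2)^s |\hat f(n)|^2$, where
   $|\hat f(n)|^2$ = [fcos f n ^+ 2 + fsin f n ^+ 2] for real-valued [f]. *)
Definition sob_term s f (n : int) : R :=
  (1 + n%:~R ^+ 2) `^ s * (fcos f n ^+ 2 + fsin f n ^+ 2).

Definition sob_energy s f : \bar R := (\esum_(n in [set: int]) (sob_term s f n)%:E)%E.

(* The elements of $H^s(S^1)$ are 1-periodic continuous functions on the line;
   for s > 1/2 every class of $H^s$ has exactly one such representative. *)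
Definition sobolev s : {pred R -> R} := [pred f : R -> R |
  `[< [/\ forall x, f (x + 1) = f x, continuous f & (sob_energy s f < +oo)%E] >]].

Lemma sob_term_ge0 s f n : 0 <= sob_term s f n.
Proof. by rewrite mulr_ge0 ?powR_ge0// addr_ge0 ?sqr_ge0. Qed.

Lemma sob_energy_ge0 s f : (0 <= sob_energy s f)%E.
Proof. by apply: esum_ge0 => n _; rewrite lee_fin sob_term_ge0. Qed.

Lemma sob_term_le s f n : ((sob_term s f n)%:E <= sob_energy s f)%E.
Proof.
apply: esum_ge; exists [set n]; first by split.
by rewrite fsbig_set1.
Qed.

Lemma fcosD f g n : continuous f -> continuous g ->
  fcos (f + g) n = fcos f n + fcos g n.
Proof.
move=> cf cg; rewrite /fcos -circle_intD.
- by congr circle_int; apply/funext => x /=; rewrite mulrDl.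
- by apply: continuousMf => //; exact: continuous_cosn.
- by apply: continuousMf => //; exact: continuous_cosn.
Qed.

Lemma fsinD f g n : continuous f -> continuous g ->
  fsin (f + g) n = fsin f n + fsin g n.
Proof.
move=> cf cg; rewrite /fsin -circle_intD.
- by congr circle_int; apply/funext => x /=; rewrite mulrDl.
- by apply: continuousMf => //; exact: continuous_sinn.
- by apply: continuousMf => //; exact: continuous_sinn.
Qed.

Lemma fcosZ f a n : continuous f -> fcos (a *: f) n = a * fcos f n.
Proof.
move=> cf; rewrite /fcos -circle_intZ.
- by congr circle_int; apply/funext => x /=; rewrite mulrA.
- by apply: continuousMf => //; exact: continuous_cosn.
Qed.

Lemma fsinZ f a n : continuous f -> fsin (a *: f) n = a * fsin f n.
Proof.
move=> cf; rewrite /fsin -circle_intZ.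
- by congr circle_int; apply/funext => x /=; rewrite mulrA.
- by apply: continuousMf => //; exact: continuous_sinn.
Qed.

Lemma sob_esumZ (a : R) (u : int -> R) : 0 <= a -> (forall n, 0 <= u n) ->
  (\esum_(n in [set: int]) (a * u n)%:E <=
   a%:E * \esum_(n in [set: int]) (u n)%:E)%E.
Proof.
move=> a0 u0; apply: ge_ereal_sup => _ [X [finX _] <-].
under eq_fsbigr do rewrite EFinM.
rewrite -ge0_mule_fsumr; last by move=> n; rewrite lee_fin.
by apply: lee_wpmul2l; [rewrite lee_fin|apply: esum_ge; exists X].
Qed.

Lemma sob_energyZ_le s f a : continuous f ->
  (sob_energy s (a *: f) <= (a ^+ 2)%:E * sob_energy s f)%E.
Proof.
move=> cf; apply: le_trans (sob_esumZ (sqr_ge0 a) (sob_term_ge0 s f)).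
apply: le_esum => n _; rewrite lee_fin /sob_term fcosZ// fsinZ//.
by rewrite !exprMn -mulrDr mulrCA.
Qed.

Lemma sob_energyD_le s f g (t : R) : 0 < t -> continuous f -> continuous g ->
  (sob_energy s (f + g)%R <=
   (1 + t)%:E * sob_energy s f + (1 + t^-1)%:E * sob_energy s g)%E.
Proof.
move=> t0 cf cg; have ti0 : 0 < t^-1 by rewrite invr_gt0.
have h1 : 0 <= 1 + t by lra.
have h2 : 0 <= 1 + t^-1 by lra.
apply: (@le_trans _ _ (\esum_(n in [set: int]) ((1 + t) * sob_term s f n)%:E +
    \esum_(n in [set: int]) ((1 + t^-1) * sob_term s g n)%:E)%E); last first.
  by apply: leeD; apply: sob_esumZ => // n; exact: sob_term_ge0.
rewrite -esumD; last 2 first.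
- by move=> n _; rewrite lee_fin mulr_ge0// sob_term_ge0.
- by move=> n _; rewrite lee_fin mulr_ge0// sob_term_ge0.
apply: le_esum => n _; rewrite lee_fin /sob_term fcosD// fsinD//.
set w := _ `^ _; have w0 : 0 <= w by rewrite powR_ge0.
have young (x y : R) : (x + y) ^+ 2 <= (1 + t) * x ^+ 2 + (1 + t^-1) * y ^+ 2.
  rewrite -subr_ge0.
  rewrite (_ : _ - _ = t^-1 * (t * x - y) ^+ 2); last by field; rewrite gt_eqF.
  by rewrite mulr_ge0 ?sqr_ge0 ?ltW.
have := young (fcos f n) (fcos g n); have := young (fsin f n) (fsin g n).
nra.
Qed.

Lemma sobolev_submod s : submod_closed (sobolev s).
Proof.
split.
  apply/asboolP; split => //; first by move=> x; exact: cvg_cst.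
  rewrite /sob_energy esum1 ?ltry// => n _.
  have z (h : R -> R) : circle_int (fun x => (0 : R -> R) x * h x) = 0.
    by rewrite -[RHS](@circle_int_cst R 0); congr circle_int; apply/funext => x; rewrite mul0r.
  by rewrite /sob_term /fcos /fsin !z expr0n addr0 mulr0.
move=> a f g /asboolP[pf cf ef] /asboolP[pg cg eg].
have caf : continuous (a *: f).
  by move=> x; apply: cvgZr; exact: cf.
apply/asboolP; split.
- by move=> x; rewrite -[LHS]/(a * f (x + 1) + g (x + 1)) pf pg.
- by move=> x; apply: cvgD; [exact: caf|exact: cg].
- apply: le_lt_trans (sob_energyD_le s ltr01 caf cg) _.
  apply: lte_add_pinfty; apply: lte_mul_pinfty => //.
  apply: le_lt_trans (sob_energyZ_le s a cf) _.
  by apply: lte_mul_pinfty => //; rewrite lee_fin sqr_ge0.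
Qed.

End SobolevEnergy.

HB.instance Definition _ (R : realType) (s : R) :=
  GRing.isSubmodClosed.Build R (R -> R) (sobolev s) (sobolev_submod s).

Record Hs (R : realType) (s : R) := MkHs {
  Hs_fun :> R -> R;
  Hs_mem : Hs_fun \in sobolev s
}.

Section HsNormed.
Context {R : realType} (s : R).

HB.instance Definition _ := [isSub for @Hs_fun R s].
HB.instance Definition _ := [Choice of Hs s by <:].
HB.instance Definition _ := [SubChoice_isSubLmodule of Hs s by <:].

Implicit Types f g : Hs s.

Lemma Hs_periodic f x : f (x + 1) = f x.
Proof. by case: f => f /= /asboolP[]. Qed.

Lemma Hs_continuous f : continuous f.
Proof. by case: f => f /= /asboolP[]. Qed.

Lemma Hs_energy f : (sob_energy s f < +oo)%E.
Proof. by case: f => f /= /asboolP[]. Qed.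

Arguments Hs_continuous : clear implicits.

Definition Hs_norm f : R := Num.sqrt (fine (sob_energy s f)).

Let energyE f : sob_energy s f = (Hs_norm f ^+ 2)%:E.
Proof.
rewrite /Hs_norm sqr_sqrtr ?fine_ge0 ?sob_energy_ge0//.
by rewrite fineK// ge0_fin_numE ?sob_energy_ge0// Hs_energy.
Qed.

Let Hs_norm_ge0 f : 0 <= Hs_norm f. Proof. exact: sqrtr_ge0. Qed.

Let Hs_normZ_le (a : R) f : Hs_norm (a *: f) <= `|a| * Hs_norm f.
Proof.
have := sob_energyZ_le s a (Hs_continuous f).
rewrite -[_ *: _]/(Hs_fun (a *: f)) !energyE -EFinM lee_fin -exprMn.
by rewrite -(real_normK (num_real (a * _))) ler_sqr ?nnegrE// normrM (ger0_norm (Hs_norm_ge0 f)).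
Qed.

Lemma Hs_normZ (a : R) f : Hs_norm (a *: f) = `|a| * Hs_norm f.
Proof.
apply/eqP; rewrite eq_le Hs_normZ_le/=.
have [->|a0] := eqVneq a 0; first by rewrite normr0 mul0r.
have := Hs_normZ_le a^-1 (a *: f).
rewrite scalerA mulVf// scale1r normfV => h.
by rewrite -ler_pdivlMl ?normr_gt0.
Qed.

Lemma Hs_norm_eq0 f : Hs_norm f = 0 -> f = 0.
Proof.
move=> f0; have e0 n : sob_term s f n = 0.
  apply/eqP; rewrite eq_le sob_term_ge0 andbT -lee_fin.
  by rewrite (le_trans (sob_term_le s f n))// energyE f0 expr0n.
have z n : fcos f n = 0 /\ fsin f n = 0.
  have /eqP := e0 n; rewrite mulf_eq0 powR_eq0.
  rewrite gt_eqF ?ltr_wpDr ?sqr_ge0//= paddr_eq0 ?sqr_ge0// !sqrf_eq0.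
  by move=> /andP[/eqP-> /eqP->].
apply/val_inj/funext => x; apply: fourier_unique.
- exact: Hs_continuous.
- exact: Hs_periodic.
- by move=> n; have [] := z n.
- by move=> n; have [] := z n.
Qed.

Lemma ler_Hs_normD f g : Hs_norm (f + g) <= Hs_norm f + Hs_norm g.
Proof.
have [f0|fn0] := eqVneq (Hs_norm f) 0.
  by rewrite (Hs_norm_eq0 f0) add0r lerDr.
have [g0|gn0] := eqVneq (Hs_norm g) 0.
  by rewrite (Hs_norm_eq0 g0) addr0 lerDl.
have fp : 0 < Hs_norm f by rewrite lt_neqAle eq_sym fn0 Hs_norm_ge0.
have gp : 0 < Hs_norm g by rewrite lt_neqAle eq_sym gn0 Hs_norm_ge0.
have := @sob_energyD_le _ s f g _ (divr_gt0 gp fp) (Hs_continuous f) (Hs_continuous g).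
rewrite -[(_ + _)%R in X in (sob_energy _ X <= _)%E]/(Hs_fun (f + g)) !energyE.
rewrite -!EFinM -EFinD lee_fin => h.
rewrite -ler_sqr ?nnegrE ?addr_ge0// (le_trans h)//.
rewrite le_eqVlt; apply/orP; left; apply/eqP; field.
by rewrite fn0 gn0.
Qed.

HB.instance Definition _ := Lmodule_isNormed.Build R (Hs s)
  ler_Hs_normD Hs_normZ Hs_norm_eq0.

End HsNormed.

Arguments Hs_continuous {R s} f.

(* $H^s_0(S^1)$ *)
Definition vanish0 (R : realType) (s : R) : {pred Hs s} := [pred f : Hs s | f 0 == 0].

Lemma vanish0_submod (R : realType) (s : R) : submod_closed (@vanish0 R s).
Proof.
split; first by rewrite inE.
move=> a f g; rewrite !inE => /eqP f0 /eqP g0.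
by apply/eqP; rewrite -[LHS]/(a * f 0 + g 0) f0 g0 mulr0 addr0.
Qed.

HB.instance Definition _ (R : realType) (s : R) :=
  GRing.isSubmodClosed.Build R (Hs s) (@vanish0 R s) (vanish0_submod s).

Record Hs0 (R : realType) (s : R) := MkHs0 {
  Hs0_val :> Hs s;
  Hs0_mem : Hs0_val \in @vanish0 R s
}.

Section Hs0Normed.
Context {R : realType} (s : R).

HB.instance Definition _ := [isSub for @Hs0_val R s].
HB.instance Definition _ := [Choice of Hs0 s by <:].
HB.instance Definition _ := [SubChoice_isSubLmodule of Hs0 s by <:].

Definition Hs0_norm (f : Hs0 s) : R := `|Hs0_val f|.

Let Hs0_normD (f g : Hs0 s) : Hs0_norm (f + g) <= Hs0_norm f + Hs0_norm g.
Proof. exact: ler_normD. Qed.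

Let Hs0_normZ (a : R) (f : Hs0 s) : Hs0_norm (a *: f) = `|a| * Hs0_norm f.
Proof. exact: normrZ. Qed.

Let Hs0_norm_eq0 (f : Hs0 s) : Hs0_norm f = 0 -> f = 0.
Proof. by move=> /normr0_eq0 f0; apply: val_inj. Qed.

HB.instance Definition _ := Lmodule_isNormed.Build R (Hs0 s)
  Hs0_normD Hs0_normZ Hs0_norm_eq0.

End Hs0Normed.

(* $H^s(S^1)/\mathbb R$, as a genuine quotient by the constant functions. *)
Definition constant_fun (R : realType) (s : R) : {pred Hs s} :=
  [pred f : Hs s | `[< exists c, forall x, f x = c >]].

Lemma constant_fun_submod (R : realType) (s : R) : submod_closed (@constant_fun R s).
Proof.
split; first by apply/asboolP; exists 0.
move=> a f g /asboolP[c fc] /asboolP[d gd]; apply/asboolP; exists (a * c + d) => x.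
by rewrite -[LHS]/(a * f x + g x) fc gd.
Qed.

HB.instance Definition _ (R : realType) (s : R) :=
  GRing.isSubmodClosed.Build R (Hs s) (@constant_fun R s) (constant_fun_submod s).

Definition HsR (R : realType) (s : R) : Type := Quotient.quot (@constant_fun R s).

Section HsRNormed.
Local Open Scope quotient_scope.
Context {R : realType} (s : R).

HB.instance Definition _ := Choice.on (HsR s).
HB.instance Definition _ := GRing.Zmodule.on (HsR s).
HB.instance Definition _ := EqQuotient.on (HsR s).
HB.instance Definition _ := ZmodQuotient.on (HsR s).

Definition cls (f : Hs s) : HsR s := \pi_(HsR s) f.

Lemma clsP (f g : Hs s) : cls f = cls g <-> exists c, forall x, f x = g x + c.
Proof.
rewrite (rwP eqP) /cls -Quotient.idealrBE; split.
  by move=> /asboolP[c fg]; exists c => x; rewrite -(fg x) -[(f - g) x]/(f x - g x) addrC subrK.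
by move=> [c fg]; apply/asboolP; exists c => x; rewrite -[LHS]/(f x - g x) fg addrC addKr.
Qed.

Lemma cls_repr (a : HsR s) : cls (repr a) = a.
Proof. exact: reprK. Qed.

Lemma clsD f g : cls (f + g) = cls f + cls g.
Proof. exact: raddfD. Qed.

Definition HsR_scale (a : R) (u : HsR s) : HsR s := cls (a *: repr u).

Lemma HsR_scale_cls a f : HsR_scale a (cls f) = cls (a *: f).
Proof.
have /clsP[c h] := cls_repr (cls f).
apply/clsP; exists (a * c) => x.
by rewrite -[LHS]/(a * repr (cls f) x) h mulrDr.
Qed.

Let clsE (P : HsR s -> Prop) : (forall f, P (cls f)) -> forall u, P u.
Proof. by move=> h u; rewrite -(cls_repr u). Qed.

Let HsR_scaleA a b u : HsR_scale a (HsR_scale b u) = HsR_scale (a * b) u.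
Proof. by elim/clsE: u => f; rewrite !HsR_scale_cls scalerA. Qed.

Let HsR_scale1 : left_id 1 HsR_scale.
Proof. by elim/clsE => f; rewrite HsR_scale_cls scale1r. Qed.

Let HsR_scaleDr : right_distributive HsR_scale +%R.
Proof.
move=> a; elim/clsE => f; elim/clsE => g.
by rewrite -clsD !HsR_scale_cls scalerDr clsD.
Qed.

Let HsR_scaleDl u : {morph HsR_scale^~ u : a b / a + b}.
Proof. by move=> a b; elim/clsE: u => f; rewrite !HsR_scale_cls scalerDl clsD. Qed.

HB.instance Definition _ := GRing.Zmodule_isLmodule.Build R (HsR s)
  HsR_scaleA HsR_scale1 HsR_scaleDr HsR_scaleDl.

Lemma clsZ a f : cls (a *: f) = a *: cls f.
Proof. by rewrite -HsR_scale_cls. Qed.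

(* the quotient norm *)
Definition HsR_norm (u : HsR s) : R := inf [set `|f| | f in [set f : Hs s | cls f = u]].

Let norms_neq0 u : [set `|f| | f in [set f : Hs s | cls f = u]] !=set0.
Proof. by exists `|repr u|, (repr u) => //=; exact: cls_repr. Qed.

Let norms_lb u : lbound [set `|f| | f in [set f : Hs s | cls f = u]] 0.
Proof. by move=> _ [f _ <-]. Qed.

Let norms_has_inf u : has_inf [set `|f| | f in [set f : Hs s | cls f = u]].
Proof. by split; [exact: norms_neq0|exists 0; exact: norms_lb]. Qed.

Lemma HsR_norm_le f : HsR_norm (cls f) <= `|f|.
Proof. by apply: ge_inf; [exists 0; exact: norms_lb|exists f]. Qed.

Let HsR_norm_ge0 u : 0 <= HsR_norm u.
Proof. by apply: lb_le_inf; [exact: norms_neq0|exact: norms_lb]. Qed.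

Let HsR_norm_adh u (e : R) : 0 < e -> exists2 f, cls f = u & `|f| < HsR_norm u + e.
Proof.
move=> e0; have [_ [f fu <-] h] := inf_adherent e0 (norms_has_inf u).
by exists f.
Qed.

Let HsR_normD u v : HsR_norm (u + v) <= HsR_norm u + HsR_norm v.
Proof.
apply/ler_addgt0Pr => e e0; have e2 : 0 < e / 2 by rewrite divr_gt0.
have [f <- hf] := HsR_norm_adh u e2; have [g <- hg] := HsR_norm_adh v e2.
rewrite -clsD (le_trans (HsR_norm_le _))// (le_trans (ler_normD _ _))//.
lra.
Qed.

Let HsR_normZ_le a u : HsR_norm (a *: u) <= `|a| * HsR_norm u.
Proof.
apply/ler_addgt0Pr => e e0.
have e1 : 0 < e / (`|a| + 1) by rewrite divr_gt0// ltr_wpDl.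
have [f <- hf] := HsR_norm_adh u e1.
rewrite -clsZ (le_trans (HsR_norm_le _))// normrZ.
have h : `|a| * `|f| <= `|a| * (HsR_norm (cls f) + e / (`|a| + 1)).
  by rewrite ler_wpM2l// ltW.
rewrite (le_trans h)// mulrDr lerD2l mulrCA ler_piMr ?ltW//.
by rewrite ltr_pdivrMr ?mul1r ?ltrDl// ltr_wpDl.
Qed.

Let HsR_normZ a u : HsR_norm (a *: u) = `|a| * HsR_norm u.
Proof.
apply/eqP; rewrite eq_le HsR_normZ_le/=.
have [->|a0] := eqVneq a 0; first by rewrite normr0 mul0r.
have := HsR_normZ_le a^-1 (a *: u).
rewrite scalerA mulVf// scale1r normfV => h.
by rewrite -ler_pdivlMl ?normr_gt0.
Qed.

Let HsR_norm_eq0 u : HsR_norm u = 0 -> u = 0.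
Proof.
elim/clsE: u => f f0; have cf := Hs_continuous f.
have coef n : n != 0 -> fcos f n = 0 /\ fsin f n = 0.
  move=> n0; suff : sob_term s f n <= 0.
    move=> t0; have /eqP : sob_term s f n = 0.
      by apply/eqP; rewrite eq_le sob_term_ge0 t0.
    rewrite mulf_eq0 powR_eq0 gt_eqF ?ltr_wpDr ?sqr_ge0//=.
    by rewrite paddr_eq0 ?sqr_ge0// !sqrf_eq0 => /andP[/eqP-> /eqP->].
  rewrite leNgt; apply/negP => t0.
  have e0 : 0 < Num.sqrt (sob_term s f n) by rewrite sqrtr_gt0.
  have [g /clsP[c gf]] := HsR_norm_adh (cls f) e0.
  rewrite f0 add0r; apply/negP; rewrite -leNgt.
  have gE : (g : R -> R) = (f : R -> R) + (fun=> c) by apply/funext => x; exact: gf.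
  have cc : continuous (fun _ : R => c) := @continuous_cstf _ c.
  have fE : fcos g n = fcos f n.
    rewrite gE fcosD// [fcos (fun=> c) n]/fcos circle_intZ; last exact: continuous_cosn.
    by rewrite circle_int_cosn// mulr0 addr0.
  have sE : fsin g n = fsin f n.
    rewrite gE fsinD// [fsin (fun=> c) n]/fsin circle_intZ; last exact: continuous_sinn.
    by rewrite circle_int_sinn mulr0 addr0.
  rewrite /Num.norm/= /Hs_norm ler_sqrt ?fine_ge0 ?sob_energy_ge0//.
  have gfin : sob_energy s g \is a fin_num.
    by rewrite ge0_fin_numE ?sob_energy_ge0// Hs_energy.
  by rewrite -lee_fin fineK// (_ : sob_term s f n = sob_term s g n) ?sob_term_le// /sob_term fE sE.
rewrite -[RHS](raddf0 (\pi_(HsR s))); apply/clsP; exists (circle_int f) => x.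
apply/eqP; rewrite -[X in _ == X]/(0 + circle_int f) add0r -subr_eq0; apply/eqP.
have cc : continuous (fun _ : R => - circle_int f) := @continuous_cstf _ _.
apply: (@fourier_unique _ ((f : R -> R) + (fun=> - circle_int f))).
- exact: continuousDf.
- by move=> y; rewrite -[LHS]/(f (y + 1) - circle_int f) Hs_periodic.
- move=> n; rewrite fcosD// [X in _ + X]/fcos circle_intZ; last exact: continuous_cosn.
  have [->|n0] := eqVneq n 0.
    rewrite (_ : @cosn R 0 = fun=> 1); last first.
      by apply/funext => y; rewrite /cosn mulr0 mul0r cos0.
    rewrite circle_int_cst mulr1 /fcos.
    rewrite (_ : (fun x => f x * cosn 0 x) = f) ?subrr//.
    by apply/funext => y; rewrite /cosn mulr0 mul0r cos0 mulr1.
  by rewrite circle_int_cosn// mulr0 addr0; have [] := coef n n0.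
- move=> n; rewrite fsinD// [X in _ + X]/fsin circle_intZ; last exact: continuous_sinn.
  rewrite circle_int_sinn mulr0 addr0.
  have [->|n0] := eqVneq n 0; last by have [] := coef n n0.
  rewrite /fsin (_ : (fun x => _) = fun=> 0) ?circle_int_cst//.
  by apply/funext => y; rewrite /sinn mulr0 mul0r sin0 mulr0.
Qed.

HB.instance Definition _ := Lmodule_isNormed.Build R (HsR s)
  HsR_normD HsR_normZ HsR_norm_eq0.

End HsRNormed.

Section CircleOperators.
Context {R : realType}.
Implicit Types f u v : R -> R.
Notation mu := (@lebesgue_measure R).

(* the oriented integral from 0 to x *)
Definition prim f (x : R) : R :=
  (\int[mu]_(y in `[0%R, x]) f y)%R - (\int[mu]_(y in `[x, 0%R]) f y)%R.

Definition cproj f : R -> R := fun x => f x - circle_int f.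

Definition Ainv f : R -> R := fun x => - prim (prim f) x + x * circle_int (prim f).

(* The two components of Gamma_e(u,v), as functions on the line. *)
Definition Gamma1 u1 u2 v1 v2 : R -> R := fun x =>
  - (1 / 2) * Ainv (derive1 (fun y =>
      derive1 u1 y * derive1 v1 y + cproj u2 y * cproj v2 y)) x.

Definition Gamma2 u1 u2 v1 v2 : R -> R := fun x =>
  - (1 / 2) * (derive1 u1 x * cproj v2 x + derive1 v1 x * cproj u2 x).

End CircleOperators.

(* Elements of [Hs s], [Hs0 s] given by formulas; the value is 0 if the function
   is not in the space, which does not happen below when s > 5/2. *)
Definition toHs (R : realType) (s : R) (f : R -> R) : Hs s := insubd 0 f.
Definition toHs0 (R : realType) (s : R) (f : R -> R) : Hs0 s := insubd 0 (toHs s f).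

(* $H^s_0(S^1) \times H^{s-1}(S^1)/\mathbb R$: the model space of K^s and each of
   its tangent spaces. *)
Notation TK s := (Hs0 s * HsR (s - 1))%type.

(* A point (phi, [alpha]) of K^s: phi = id + [Kh], and alpha is represented by
   its lift to the line. A map from R/Z to R/(4 pi Z) lifts to
   x |-> 4 pi k x + a x with k an integer (the degree) and a 1-periodic, the lift
   being unique up to a constant, so that [alpha] amounts to the pair
   (k, a modulo constants). *)
Record Ks (R : realType) (s : R) := MkKs {
  Kh : Hs0 s;
  Kdeg : int;
  Kang : HsR (s - 1);
  Kh_gtN1 : forall x, -1 < derive1 (Kh : R -> R) x
}.

Section Geometry.
Context {R : realType} {s : R}.
Implicit Types (m : Ks s) (u v w U V W : TK s).

Lemma Ke_gtN1 (x : R) : -1 < derive1 ((0 : Hs0 s) : R -> R) x.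
Proof.
rewrite (_ : ((0 : Hs0 s) : R -> R) = cst 0); last by apply/funext.
by rewrite derive1_cst.
Qed.

Definition Ke : Ks s := MkKs 0 0 Ke_gtN1.

Definition Kphi m : R -> R := fun x => x + Kh m x.

(* The inverse of a chart: the chart covers the component of K^s of degree k;
   the value outside the chart's (open) image is irrelevant. *)
Definition Kchart_inv (k : int) (n : TK s) : Ks s :=
  match pselect (forall x, -1 < derive1 (n.1 : R -> R) x) with
  | left p => MkKs k n.2 p
  | right _ => Ke
  end.

Definition Kcoord m : TK s := (Kh m, Kang m).

(* $\pi(U_2)$ at m; independent of the representative since phi_x has mean 1 *)
Definition Kproj m (f : R -> R) : R -> R := fun x =>
  f x - circle_int (fun y => f y * derive1 (Kphi m) y).

Definition Kmetric m U V : R := 1 / 4 * circle_int (fun x =>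
  derive1 U.1 x * derive1 V.1 x / derive1 (Kphi m) x
  + Kproj m (repr U.2) x * Kproj m (repr V.2) x * derive1 (Kphi m) x).

Definition Knorm m U : R := Num.sqrt (Kmetric m U U).

(* $\Gamma_m(U,V) = \Gamma_e(U\circ\varphi^{-1}, V\circ\varphi^{-1})\circ\varphi$ *)
Definition Kgamma m U V : TK s :=
  let phi := Kphi m in
  let psi := pinv setT phi in
  let u1 := U.1 \o psi in let u2 := repr U.2 \o psi in
  let v1 := V.1 \o psi in let v2 := repr V.2 \o psi in
  (toHs0 s (Gamma1 u1 u2 v1 v2 \o phi),
   cls (toHs (s - 1) (Gamma2 u1 u2 v1 v2 \o phi))).

(* R_m(U,V)W computed in the chart; ['d] is the Frechet differential between
   the normed spaces [TK s], i.e. differentiation in the base point. *)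
Definition Kcurv m U V W : TK s :=
  let G X Y := fun n : TK s => Kgamma (Kchart_inv (Kdeg m) n) X Y in
  'd (G W U) (Kcoord m) V - 'd (G W V) (Kcoord m) U
  + Kgamma m (Kgamma m W V) U - Kgamma m (Kgamma m W U) V.

(* Meaningful only for linearly independent u and v, where the denominator is
   positive. *)
Definition Ksec u v : R :=
  Kmetric Ke (Kcurv Ke u v v) u /
  (Knorm Ke u ^+ 2 * Knorm Ke v ^+ 2 - Kmetric Ke u v ^+ 2).

(* J and omega are those at the identity. *)
Definition KJ u : TK s :=
  (toHs0 s (fun x => - prim (cproj (repr u.2)) x),
   cls (toHs (s - 1) (derive1 u.1))).

Definition Komega u v : R := 1 / 4 * circle_int (fun x =>
  derive1 (repr u.2) x * v.1 x - derive1 (repr v.2) x * u.1 x).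

Definition lin_indep u v : Prop :=
  forall a b : R, a *: u + b *: v = 0 -> a = 0 /\ b = 0.

End Geometry.

Arguments Ke {R s}.

(* Main.v *)
Require Import Defs.
From HB Require Import structures.
From mathcomp Require Import all_boot all_order all_algebra.
From mathcomp Require Import all_classical all_reals all_analysis.
From mathcomp Require Import ring lra.
Set Implicit Arguments.
Unset Strict Implicit.
Unset Printing Implicit Defensive.
Import Order.TTheory GRing.Theory Num.Theory.
Import numFieldNormedType.Exports.
Local Open Scope classical_set_scope.
Local Open Scope ring_scope.

(* In the coordinates p = u_1x, q = pi(u_2), the space T_e K^s consists of pairs
   of mean-zero functions, the metric is a quarter of the L^2 product, J is the
   rotation (p, q) -> (-q, p), and omega(u, v) = <Ju, v>. The change of variable
   phi puts Gamma in closed form: its components at (phi, [alpha]) are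
     (int_0^x G - phi int G) / 2  with  G = X_1x Y_1x / phi_x + pi(X_2) pi(Y_2) phi_x
   and -(X_1x pi(Y_2) + Y_1x pi(X_2)) / (2 phi_x). As H^(s-1) is an algebra in which
   1 + q is invertible for small q, this is differentiable in phi, with derivative
   obtained by linearising 1 / phi_x. In <R(u,v)v, u> the quartic terms then cancel
   pointwise under the integral sign, and only products of quadratic integrals
   remain. The bounds on the curvature express that
     z = |u|^2 v - <u,v> u - <Ju,v> Ju
   has |z|^2 = |u|^2 (|u|^2 |v|^2 - <u,v>^2 - omega(u,v)^2) >= 0. *)

(** * Calculus on the circle *)

(** [Kcurv] contains a Frechet differential between Sobolev spaces, so a linear approximation with a
    small remainder has to be proved in the norm of [TK s]; and [toHs], [toHs0] return 0 outside the
    space, so every formula needs a membership bound. Hence the Sobolev estimates with explicit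
    constants. The obstacle is the inverse diffeomorphism in [Kgamma]: $\varphi\mapsto
    u\circ\varphi^{-1}$ is continuous but not differentiable on $H^s$, so Gamma cannot be
    differentiated factor by factor. One of the two integrations in $A^{-1}$ cancels the derivative
    in front of it; a substitution in the other one and the outer composition with $\varphi$ then
    absorb the inverse. The bound $s>5/2$ gives $H^{s-1}\subset C^1$, so that the derivative inside
    [Gamma1] is a classical one. Tangent vectors are mean-zero in both coordinates, so the additive
    constants coming from projections, representatives of classes and periodic corrections all
    vanish in the metric. *)

Section Calculus.
Context {R : realType}.
Implicit Types f g F G : R -> R.
Notation mu := (@lebesgue_measure R).

Lemma continuousNf f : continuous f -> continuous (fun x => - f x).
Proof. by move=> cf x; apply: cvgN; exact: cf. Qed.

Lemma continuousBf f g : continuous f -> continuous g ->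
  continuous (fun x => f x - g x).
Proof. by move=> cf cg x; apply: cvgB; [exact: cf|exact: cg]. Qed.

Lemma continuous_sumf (I : Type) (r : seq I) (F : I -> R -> R) :
  (forall i, continuous (F i)) -> continuous (fun x => \sum_(i <- r) F i x).
Proof.
move=> cF; elim: r => [|i r IH].
  by under eq_fun do rewrite big_nil; exact: continuous_cstf.
under eq_fun do rewrite big_cons; exact: continuousDf.
Qed.

Lemma continuousVf f : continuous f -> (forall x, f x != 0) ->
  continuous (fun x => (f x)^-1).
Proof. by move=> cf f0 x; apply: cvgV; [exact: f0|exact: cf]. Qed.

Lemma circle_intDf f g : continuous f -> continuous g ->
  circle_int (fun x => f x + g x) = circle_int f + circle_int g.
Proof. exact: circle_intD. Qed.

Lemma circle_intNf f : continuous f -> circle_int (fun x => - f x) = - circle_int f.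
Proof.
move=> cf; rewrite -mulN1r -circle_intZ//.
by congr circle_int; apply/funext => x; rewrite mulN1r.
Qed.

Lemma circle_intBf f g : continuous f -> continuous g ->
  circle_int (fun x => f x - g x) = circle_int f - circle_int g.
Proof. by move=> cf cg; rewrite circle_intDf ?circle_intNf//; exact: continuousNf. Qed.

Lemma circle_int_sum (I : Type) (r : seq I) (F : I -> R -> R) :
  (forall i, continuous (F i)) ->
  circle_int (fun x => \sum_(i <- r) F i x) = \sum_(i <- r) circle_int (F i).
Proof.
move=> cF; elim: r => [|i r IH].
  by rewrite big_nil -[RHS](@circle_int_cst R 0); congr circle_int;
    apply/funext => x; rewrite big_nil.
rewrite big_cons -IH -circle_intDf//; last exact: continuous_sumf.
by congr circle_int; apply/funext => x; rewrite big_cons.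
Qed.

Lemma circle_int_norm_le f (M : R) : continuous f ->
  (forall x, 0 <= x <= 1 -> `|f x| <= M) -> `|circle_int f| <= M.
Proof.
move=> cf fM; rewrite ler_norml; apply/andP; split.
  rewrite -(@circle_int_cst R M) -circle_intNf; last exact: continuous_cstf.
  apply: le_circle_int => //; first by apply: continuousNf; exact: continuous_cstf.
  by move=> x; rewrite in_itv/= => /fM; rewrite ler_norml => /andP[].
rewrite -(@circle_int_cst R M); apply: le_circle_int => //.
  exact: continuous_cstf.
by move=> x; rewrite in_itv/= => /fM; rewrite ler_norml => /andP[].
Qed.

Lemma prim0 f : prim f 0 = 0.
Proof. by rewrite /prim subrr. Qed.

Lemma circle_int_prim f : circle_int f = prim f 1.
Proof.
rewrite /prim (_ : `[1, 0]%classic = set0) ?Rintegral_set0 ?subr0//.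
by rewrite set_itv_ge// bnd_simp -ltNge ltr01.
Qed.

Let itv_integrable f a b : continuous f -> mu.-integrable `[a, b] (EFin \o f).
Proof.
move=> cf; apply: continuous_compact_integrable; first exact: segment_compact.
exact: continuous_subspaceT.
Qed.

Let chasles f a b c : continuous f -> a <= b -> b <= c ->
  (\int[mu]_(t in `[b, c]) f t =
   \int[mu]_(t in `[a, c]) f t - \int[mu]_(t in `[a, b]) f t)%R.
Proof.
move=> cf ab bc; rewrite -(@Rintegral_itv_obnd_cbnd R b); last first.
  by apply: integrableS (itv_integrable b c cf) => //; apply: subset_itvr; rewrite bnd_simp.
by rewrite -(@Rintegral_itvB R f (BLeft a) (BRight c) b) ?bnd_simp//; exact: itv_integrable.
Qed.

Let int_ge f a b : b <= a -> (\int[mu]_(t in `[a, b]) f t = 0)%R.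
Proof.
rewrite le_eqVlt => /predU1P[->|ba]; first by rewrite set_itv1 Rintegral_set1.
by rewrite set_itv_ge ?Rintegral_set0// bnd_simp -ltNge.
Qed.

(** [prim] is a difference of two integrals, one of which vanishes according to the sign of the
    bound. Starting from a point to the left of 0 gives one formula on both sides of 0, which can be
    differentiated at 0 as well. *)
Let primE f a y : continuous f -> a <= 0 -> a <= y ->
  prim f y = (\int[mu]_(t in `[a, y]) f t - \int[mu]_(t in `[a, 0%R]) f t)%R.
Proof.
move=> cf a0 ay; rewrite /prim; have [y0|/ltW y0] := leP 0 y.
  by rewrite [X in _ - X]int_ge// subr0 -chasles.
by rewrite int_ge// sub0r (chasles cf ay y0) opprB.
Qed.

Lemma is_derive_prim f x : continuous f -> is_derive x (1 : R) (prim f) (f x).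
Proof.
move=> cf; pose a := Num.min x 0 - 1.
have ax : a < x by rewrite /a ltrBlDr (le_lt_trans (y := x)) ?ltrDl// ge_min lexx.
have a0 : a < 0 by rewrite /a ltrBlDr (le_lt_trans (y := 0)) ?ltrDl// ge_min lexx orbT.
have xu : x < x + 1 by rewrite ltrDl.
have [d1 d2] := continuous_FTC1_closed xu (itv_integrable a (x + 1) cf) ax (cf x).
have h : is_derive x (1 : R)
    ((fun y => \int[mu]_(t in `[a, y]) f t) - cst (\int[mu]_(t in `[a, 0%R]) f t))%R
    (f x - 0).
  apply: is_deriveB; apply: DeriveDef; first exact: d1.
  by rewrite -derive1E; exact: d2.
rewrite subr0 in h; apply: near_eq_is_derive h.
near=> y; rewrite (primE (y := y) cf (ltW a0))//; near: y.
exact: lt_le_nbhsr.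
Unshelve. all: by end_near. Qed.

Lemma is_derive_continuous F f : (forall x, is_derive x (1 : R) F (f x)) ->
  continuous F.
Proof.
move=> dF x; apply: differentiable_continuous; apply/derivable1_diffP.
by have [] := dF x.
Qed.

Lemma is_derive_derive1 F f : (forall x, is_derive x (1 : R) F (f x)) ->
  derive1 F = f.
Proof. by move=> dF; apply/funext => x; rewrite derive1E; have [_ ->] := dF x. Qed.

Lemma is_derive_eq0 F f : (forall x, is_derive x (1 : R) F (f x)) ->
  (forall x, f x = 0) -> forall x y, F x = F y.
Proof.
move=> dF f0 x y; apply: is_derive_0_is_cst => z.
by rewrite -(f0 z).
Qed.

Lemma prim_FTC F f x : continuous f -> (forall x, is_derive x (1 : R) F (f x)) ->
  prim f x = F x - F 0.
Proof.
move=> cf dF.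
have h y : is_derive y (1 : R) (prim f - F) (f y - f y).
  by apply: is_deriveB; exact: is_derive_prim.
have := is_derive_eq0 h (fun y => subrr (f y)) x 0.
rewrite -[LHS]/(prim f x - F x) -[RHS]/(prim f 0 - F 0) prim0; lra.
Qed.

Lemma circle_int_FTC F f : continuous f -> (forall x, is_derive x (1 : R) F (f x)) ->
  circle_int f = F 1 - F 0.
Proof. by move=> cf dF; rewrite circle_int_prim (prim_FTC _ cf dF). Qed.

Lemma is_deriveMf F G x a b : is_derive x (1 : R) F a -> is_derive x (1 : R) G b ->
  is_derive x (1 : R) (fun x => F x * G x) (a * G x + F x * b).
Proof.
move=> dF dG; apply: is_derive_eq (is_deriveM dF dG) _.
by rewrite /GRing.scale/= addrC [G x * a]mulrC.
Qed.

(* The boundary terms cancel by periodicity. *)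
Lemma circle_int_by_parts F f G g : continuous f -> continuous g ->
  (forall x, is_derive x (1 : R) F (f x)) -> (forall x, is_derive x (1 : R) G (g x)) ->
  F 1 * G 1 = F 0 * G 0 ->
  circle_int (fun x => f x * G x) = - circle_int (fun x => F x * g x).
Proof.
move=> cf cg dF dG FG.
have cF := is_derive_continuous dF; have cG := is_derive_continuous dG.
apply/eqP; rewrite -addr_eq0 -circle_intDf; last 2 first.
- exact: continuousMf.
- exact: continuousMf.
have cfg : continuous (fun x => f x * G x + F x * g x).
  by apply: continuousDf; exact: continuousMf.
have dFG x := is_deriveMf (dF x) (dG x).
by rewrite (circle_int_FTC cfg dFG) FG subrr.
Qed.

Lemma prim_continuous f : continuous f -> continuous (prim f).
Proof. by move=> cf; apply: is_derive_continuous => x; exact: is_derive_prim. Qed.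

Lemma prim_lin (a b : R) f g x : continuous f -> continuous g ->
  prim (fun y => a * f y + b * g y) x = a * prim f x + b * prim g x.
Proof.
move=> cf cg.
have cfg : continuous (fun y => a * f y + b * g y).
  by apply: continuousDf; apply: continuousMf => //; exact: continuous_cstf.
have dfg y : is_derive y (1 : R) (a *: prim f + b *: prim g) (a * f y + b * g y).
  by apply: is_deriveD; apply: is_deriveZ; exact: is_derive_prim.
rewrite (prim_FTC x cfg dfg) -[(_ + _) x]/(a * prim f x + b * prim g x).
by rewrite -[(_ + _) 0]/(a * prim f 0 + b * prim g 0) !prim0 !mulr0 addr0 subr0.
Qed.

Lemma prim_cst (c x : R) : prim (fun=> c) x = c * x.
Proof.
have dc y : is_derive y (1 : R) (c *: id) c.
  by apply: is_derive_eq; rewrite [_ *: _]mulr1.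
rewrite (prim_FTC x (@continuous_cstf R c) dc).
by rewrite -[(_ *: _) x]/(c * x) -[(_ *: _) 0]/(c * 0) mulr0 subr0.
Qed.

Lemma prim_norm_le f (M x : R) : continuous f -> (forall y, `|f y| <= M) ->
  `|prim f x| <= M * `|x|.
Proof.
move=> cf fM.
have mvt a b : a < b -> exists c, prim f b - prim f a = f c * (b - a).
  move=> ab; have [||c _ ->] := @MVT R (prim f) f a b ab; last by exists c.
    by move=> y _; exact: is_derive_prim.
  by apply: continuous_subspaceT; exact: prim_continuous.
have [x0|x0|->] := ltgtP x 0; last by rewrite prim0 !normr0 mulr0.
  have [c] := mvt _ _ x0; rewrite prim0 sub0r sub0r => e.
  by rewrite -normrN e normrM normrN ler_wpM2r.
by have [c] := mvt _ _ x0; rewrite prim0 !subr0 => ->; rewrite normrM ler_wpM2r.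
Qed.

End Calculus.

(** * Sums over the integers *)

Section IntegerSums.
Context {R : realType}.
Implicit Types (F a b : int -> R) (M : R).

(* The integers from -N to N - 1: [Negz k] is -(k + 1). *)
Definition irange (N : nat) : seq int :=
  [seq Posz k | k <- iota 0 N] ++ [seq Negz k | k <- iota 0 N].

Lemma mem_irange N n : (n \in irange N) = (match n with Posz k => k | Negz k => k end < N)%N.
Proof.
have Pinj : injective Posz by move=> ? ? [].
have Ninj : injective Negz by move=> ? ? [].
rewrite mem_cat; case: n => k.
  rewrite (mem_map Pinj) mem_iota/= add0n.
  by rewrite [X in _ || X](_ : _ = false) ?orbF//; apply/negP => /mapP[].
rewrite (mem_map Ninj) mem_iota/= add0n.
by rewrite [X in X || _](_ : _ = false)//; apply/negP => /mapP[].
Qed.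

Lemma irange_uniq N : uniq (irange N).
Proof.
rewrite cat_uniq !map_inj_uniq ?iota_uniq ?andbT/=; last 2 first.
- by move=> ? ? [].
- by move=> ? ? [].
by apply/hasPn => _ /mapP[k _ ->]; apply/negP => /mapP[].
Qed.

Lemma sum_irange F N :
  \sum_(n <- irange N) F n = \sum_(0 <= k < N) (F (Posz k) + F (Negz k)).
Proof. by rewrite big_cat/= !big_map big_split /index_iota subn0. Qed.

Lemma sub_irange (X : seq int) : exists N, {subset X <= irange N}.
Proof.
elim: X => [|n X [N sN]]; first by exists 0%N.
exists (maxn N (match n with Posz k => k | Negz k => k end).+1) => m.
rewrite inE => /predU1P[->|/sN]; rewrite !mem_irange leq_max ?ltnSn ?orbT//.
by move=> ->.
Qed.

Lemma sum_sub_le F (X Y : seq int) : (forall n, 0 <= F n) -> uniq X -> uniq Y ->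
  {subset X <= Y} -> \sum_(n <- X) F n <= \sum_(n <- Y) F n.
Proof.
move=> F0 uX uY XY.
have pY : perm_eq Y (X ++ [seq n <- Y | n \notin X]).
  rewrite uniq_perm// ?cat_uniq ?uX ?filter_uniq ?andbT//=.
    by apply/hasPn => n; rewrite mem_filter => /andP[].
  move=> n; rewrite mem_cat mem_filter; case: (boolP (n \in X)) => //= nX.
  exact: XY.
by rewrite (perm_big _ pY) big_cat/= lerDl sumr_ge0.
Qed.

(** Bounding all finite sums keeps the estimates inside the reals; for nonnegative terms
    [esum_sums_le] translates to and from the extended-real sum in [sob_energy]. *)
Definition sums_le F M := forall X : seq int, uniq X -> \sum_(n <- X) F n <= M.

Lemma sums_le_irange F M : (forall n, 0 <= F n) ->
  (forall N, \sum_(n <- irange N) F n <= M) -> sums_le F M.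
Proof.
move=> F0 FM X uX; have [N sN] := sub_irange X.
by apply: le_trans (FM N); apply: sum_sub_le => //; exact: irange_uniq.
Qed.

Lemma sums_le_ge0 F M : sums_le F M -> 0 <= M.
Proof. by move=> /(_ [::] isT); rewrite big_nil. Qed.

Lemma sums_le_mono F G M : (forall n, F n <= G n) -> sums_le G M -> sums_le F M.
Proof. by move=> FG GM X uX; apply: le_trans (GM X uX); exact: ler_sum. Qed.

Lemma esum_sums_le F M : (forall n, 0 <= F n) ->
  (\esum_(n in [set: int]) (F n)%:E <= M%:E)%E <-> sums_le F M.
Proof.
move=> F0; split=> [h X uX|h].
  rewrite -lee_fin; apply: le_trans h; rewrite -sumEFin fsbig_seq//.
  by apply: esum_ge; exists [set` X] => //; split => //; exact: finite_seq.
apply: ge_ereal_sup => _ [X [fX _] <-].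
by rewrite fsbig_finite//= sumEFin lee_fin h// finmap.fset_uniq.
Qed.

(** Lagrange's identity: the defect is half the double sum of $(a_ib_j-a_jb_i)^2$. *)
Lemma sum_cauchy_schwarz (I : Type) (r : seq I) (a b : I -> R) :
  (\sum_(i <- r) a i * b i) ^+ 2 <=
  (\sum_(i <- r) a i ^+ 2) * (\sum_(i <- r) b i ^+ 2).
Proof.
have : 0 <= \sum_(i <- r) \sum_(j <- r) (a i * b j - a j * b i) ^+ 2.
  by apply: sumr_ge0 => i _; apply: sumr_ge0 => j _; rewrite sqr_ge0.
suff -> : \sum_(i <- r) \sum_(j <- r) (a i * b j - a j * b i) ^+ 2 =
    2 * ((\sum_(i <- r) a i ^+ 2) * (\sum_(i <- r) b i ^+ 2) -
    (\sum_(i <- r) a i * b i) ^+ 2) by lra.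
have e i j : (a i * b j - a j * b i) ^+ 2 = a i ^+ 2 * b j ^+ 2
    + b i ^+ 2 * a j ^+ 2 + (a i * b i) * (- 2 * (a j * b j)) by ring.
under eq_bigr do under eq_bigr do rewrite e.
under eq_bigr do rewrite !big_split/= -!mulr_sumr.
by rewrite !big_split/= -!mulr_suml; ring.
Qed.

(** The mean value theorem for $y^{1-p}$ on $[m,m+1]$. This is the integral test in discrete form:
    each term is dominated by a telescoping difference. *)
Lemma powR_neg_step (p : R) (m : nat) : 1 < p -> (0 < m)%N ->
  (p - 1) * m.+1%:R `^ (- p) <= m%:R `^ (1 - p) - m.+1%:R `^ (1 - p).
Proof.
move=> p1 m0.
have mm : (m%:R : R) < m.+1%:R by rewrite ltr_nat.
have d (x : R) : x \in `]m%:R, m.+1%:R[ ->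
    is_derive x 1 (fun y => y `^ (1 - p)) ((1 - p) * x `^ (1 - p - 1)).
  rewrite in_itv/= => /andP[mx _]; apply: is_derive1_powR.
  by rewrite (lt_trans _ mx)// ltr0n.
have c : {within `[m%:R : R, m.+1%:R], continuous (fun y : R => y `^ (1 - p))}.
  apply: derivable_within_continuous => x; rewrite in_itv/= => /andP[mx _].
  have x0 : 0 < x by rewrite (lt_le_trans _ mx)// ltr0n.
  by have [] := is_derive1_powR (1 - p) x0.
have [x] := MVT mm d c; rewrite in_itv/= => /andP[mx xm] e.
have -> : m%:R `^ (1 - p) - m.+1%:R `^ (1 - p) = (p - 1) * x `^ (- p).
  rewrite (_ : x `^ (- p) = x `^ (1 - p - 1)); last by congr (_ `^ _); ring.
  move: e; have -> : m.+1%:R - m%:R = 1 :> R by rewrite -natr1 addrAC subrr add0r.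
  by rewrite mulr1 => /(congr1 -%R); rewrite opprB => ->; rewrite -mulNr opprB.
apply: ler_wpM2l; first by rewrite subr_ge0 ltW.
have x0 : 0 < x by rewrite (lt_trans _ mx)// ltr0n.
rewrite !powRN lef_pV2 ?posrE ?powR_gt0//.
by apply: ge0_ler_powR; rewrite ?nnegrE ?ltW//; lra.
Qed.

(* The square of the Japanese bracket of n. *)
Definition japanese (n : int) : R := 1 + n%:~R ^+ 2.

Lemma japanese_ge1 n : 1 <= japanese n.
Proof. by rewrite lerDl sqr_ge0. Qed.

Lemma japanese_gt0 n : 0 < japanese n.
Proof. exact: lt_le_trans ltr01 (japanese_ge1 n). Qed.

Lemma japanese_sum (t : R) : 1 / 2 < t ->
  exists2 C, 0 < C & sums_le (fun n => japanese n `^ (- t)) C.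
Proof.
move=> t2; set p := 2 * t; have p1 : 1 < p by rewrite /p; lra.
have pN : 0 < (p - 1)^-1 by rewrite invr_gt0; lra.
have j0 (k : nat) : 0 < 1 + (k%:R : R) ^+ 2 by rewrite ltr_pwDl ?sqr_ge0.
have ge (k : nat) : (0 < k)%N -> (1 + k%:R ^+ 2) `^ (- t) <= (k%:R : R) `^ (- p).
  move=> k0; have k0' : 0 < k%:R :> R by rewrite ltr0n.
  rewrite !powRN lef_pV2 ?posrE ?powR_gt0//.
  rewrite /p powRrM powR_mulrn ?ler0n//.
  by apply: ge0_ler_powR; rewrite ?nnegrE ?sqr_ge0 ?lerDr// ?(ltW (j0 k))//; lra.
have le1 (k : nat) : (1 + (k%:R : R) ^+ 2) `^ (- t) <= 1.
  rewrite powRN invf_le1 ?powR_gt0//.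
  rewrite -[leLHS](@powRr0 _ (1 + k%:R ^+ 2)) ler_powR//; last lra.
  by rewrite lerDl sqr_ge0.
have tele (N : nat) : \sum_(0 <= k < N) (k.+2%:R : R) `^ (- p) <= (p - 1)^-1.
  rewrite -[leRHS]mulr1 -ler_pdivrMl ?invr_gt0 ?subr_gt0// invrK mulr_sumr.
  apply: (@le_trans _ _ (\sum_(0 <= k < N) (k.+1%:R `^ (1 - p) - k.+2%:R `^ (1 - p)))).
    by apply: ler_sum => k _; exact: powR_neg_step.
  under eq_bigr do rewrite -opprB.
  rewrite sumrN telescope_sumr// opprB powR1.
  by rewrite gerBl powR_ge0.
(* Two terms are added so that indices 0 and 1 can be split off, each bounded by 1; the telescoping
   estimate starts at index 2. *)
have bd N : \sum_(0 <= k < N) (1 + (k%:R : R) ^+ 2) `^ (- t) <= 2 + (p - 1)^-1.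
  apply: (@le_trans _ _ (\sum_(0 <= k < N.+2) (1 + (k%:R : R) ^+ 2) `^ (- t))).
    by rewrite !big_nat_recr//= -addrA lerDl addr_ge0 ?powR_ge0.
  rewrite !big_nat_recl//= (_ : 2 = 1 + 1)// -addrA.
  apply: lerD; first exact: (le1 0%N).
  apply: lerD; first exact: (le1 1%N).
  apply: le_trans (tele N); apply: ler_sum => k _; exact: ge.
(* One copy for each sign. The negative half starts at index 1, hence the later comparison with
   [N.+1] terms. *)
exists ((2 + (p - 1)^-1) *+ 2); first by rewrite pmulrn_lgt0// addr_gt0.
apply: sums_le_irange => [n|N]; first exact: powR_ge0.
rewrite sum_irange big_split/= mulr2n lerD//.
apply: le_trans (bd N.+1); rewrite big_nat_recl//=.
rewrite (eq_bigr (fun k => (1 + (k.+1%:R : R) ^+ 2) `^ (- t))).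
  by rewrite lerDr powR_ge0.
by move=> k _; rewrite /japanese NegzE intrN sqrrN.
Qed.

End IntegerSums.

(** * Fourier series *)

Section UniformConvergence.
Context {R : realType}.
Implicit Types (f g S : R -> R) (u t : nat -> R -> R).

Definition ucvg u S := forall e : R, 0 < e ->
  \forall N \near \oo, forall x, `|S x - u N x| <= e.

Lemma ucvg_pointwise u S x : ucvg u S -> u N x @[N --> \oo] --> S x.
Proof.
move=> uS; apply/cvgrPdist_le => e e0; near=> N; move: x.
by near: N; exact: uS.
Unshelve. all: by end_near. Qed.

Lemma ucvg_continuous u S : (forall N, continuous (u N)) -> ucvg u S -> continuous S.
Proof.
move=> cu uS x; apply/cvgrPdist_le => e e0; have e3 : 0 < e / 3 by rewrite divr_gt0.
have [N _ /(_ N (leqnn N)) h] := uS _ e3.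
near=> y.
have : `|u N x - u N y| <= e / 3 by near: y; move/cvgrPdist_le: (cu N x); apply.
have := h x; have := h y; rewrite !ler_norml => /andP[? ?] /andP[? ?] /andP[? ?].
apply/andP; split; lra.
Unshelve. all: by end_near. Qed.

Lemma ucvg_circle_int u S : (forall N, continuous (u N)) -> ucvg u S ->
  circle_int (u N) @[N --> \oo] --> circle_int S.
Proof.
move=> cu uS; have cS := ucvg_continuous cu uS.
apply/cvgrPdist_le => e e0; near=> N.
rewrite -circle_intBf//; apply: circle_int_norm_le; first exact: continuousBf.
by move=> x _; move: x; near: N; exact: uS.
Unshelve. all: by end_near. Qed.

Lemma ucvgMr u S g (M : R) : (forall x, `|g x| <= M) -> ucvg u S ->
  ucvg (fun N x => u N x * g x) (fun x => S x * g x).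
Proof.
move=> gM uS e e0; have M0 : 0 <= M by apply: le_trans (gM 0).
have eM : 0 < e / (M + 1) by rewrite divr_gt0// ltr_wpDl.
near=> N => x; rewrite -mulrBl normrM.
apply: (@le_trans _ _ (e / (M + 1) * (M + 1))); last by rewrite divfK ?gt_eqF ?ltr_wpDl.
apply: ler_pM => //; last by rewrite (le_trans (gM x))// lerDl.
by move: x; near: N; exact: uS.
Unshelve. all: by end_near. Qed.

Lemma weierstrass_M_test t (M : nat -> R) (C : R) :
  (forall k x, `|t k x| <= M k) -> (forall N, \sum_(0 <= k < N) M k <= C) ->
  exists S, ucvg (fun N x => \sum_(0 <= k < N) t k x) S.
Proof.
move=> tM MC; have M0 k : 0 <= M k by apply: le_trans (tM k 0).
have cM : cvgn (series M).
  apply: nondecreasing_is_cvgn; first exact: nondecreasing_series.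
  by exists C => _ [n _ <-]; exact: MC.
have ct x : cvgn (series (t ^~ x)).
  apply: normed_cvg; apply: series_le_cvg cM => // k /=; rewrite ?normr_ge0//; exact: tM.
exists (fun x => limn (series (t ^~ x))) => e e0.
have cM' := cM; near=> N => x.
(* The tail of the majorant bounds the error for all [x] at once. The comparison is made on the
   finite blocks from [N] to [k] and then passed to the limit in [k]. *)
apply: (@le_trans _ _ (limn (series M) - series M N)); last first.
  have : `|limn (series M) - series M N| <= e.
    by near: N; move/cvgrPdist_le : cM; apply.
  by apply: le_trans; rewrite ler_norm.
have h1 : `|series (t ^~ x) k - series (t ^~ x) N| @[k --> \oo] -->
    `|limn (series (t ^~ x)) - series (t ^~ x) N|.
  by apply: cvg_norm; apply: cvgB; [exact: ct|exact: cvg_cst].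
have h2 : series M k - series M N @[k --> \oo] --> limn (series M) - series M N.
  by apply: cvgB; [exact: cM'|exact: cvg_cst].
rewrite -[leLHS](cvg_lim _ h1)// -[leRHS](cvg_lim _ h2)//.
apply: ler_lim; [by apply/cvg_ex; eexists; exact: h1|by apply/cvg_ex; eexists; exact: h2|].
near=> k.
have Nk : (N <= k)%N by near: k; exact: nbhs_infty_ge.
rewrite !sub_series_geq//; apply: le_trans (ler_norm_sum _ _ _) _.
by apply: ler_sum => i _; exact: tM.
Unshelve. all: by end_near. Qed.

End UniformConvergence.

(** * Real Fourier coefficients and partial sums *)

Section FourierCoefficients.
Context {R : realType}.
Implicit Types (f g : R -> R) (m n : int).

Lemma cosnD m n x : cosn (m + n) x = cosn m x * cosn n x - sinn m x * sinn n x :> R.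
Proof. by rewrite /cosn /sinn intrD mulrDr mulrDl cosD. Qed.

Lemma sinnD m n x : sinn (m + n) x = sinn m x * cosn n x + cosn m x * sinn n x :> R.
Proof. by rewrite /cosn /sinn intrD mulrDr mulrDl sinD. Qed.

Lemma cosnN m x : cosn (- m) x = cosn m x :> R.
Proof. by rewrite /cosn intrN mulrN mulNr cosN. Qed.

Lemma sinnN m x : sinn (- m) x = - sinn m x :> R.
Proof. by rewrite /sinn intrN mulrN mulNr sinN. Qed.

Lemma cosn_norm_le m x : `|cosn m x| <= 1 :> R.
Proof. by rewrite ler_norml cos_geN1 cos_le1. Qed.

Lemma sinn_norm_le m x : `|sinn m x| <= 1 :> R.
Proof. by rewrite ler_norml sin_geN1 sin_le1. Qed.

Lemma fcosN f n : fcos f (- n) = fcos f n.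
Proof. by congr circle_int; apply/funext => x; rewrite cosnN. Qed.

Lemma fsinN f n : continuous f -> fsin f (- n) = - fsin f n.
Proof.
move=> cf; rewrite /fsin -circle_intNf; last by apply: continuousMf => //; exact: continuous_sinn.
by congr circle_int; apply/funext => x; rewrite sinnN mulrN.
Qed.

(** The modulus of the complex Fourier coefficient. Products of functions mix [fcos] and [fsin];
    bounding both by the amplitude reduces convolution estimates to one nonnegative sequence. *)
Definition ampl f n : R := Num.sqrt (fcos f n ^+ 2 + fsin f n ^+ 2).

Lemma ampl_ge0 f n : 0 <= ampl f n. Proof. exact: sqrtr_ge0. Qed.

Lemma ampl_sqr f n : ampl f n ^+ 2 = fcos f n ^+ 2 + fsin f n ^+ 2.
Proof. by rewrite sqr_sqrtr// addr_ge0 ?sqr_ge0. Qed.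

Lemma fcos_le_ampl f n : `|fcos f n| <= ampl f n.
Proof. by rewrite -sqrtr_sqr ler_wsqrtr// lerDl sqr_ge0. Qed.

Lemma fsin_le_ampl f n : `|fsin f n| <= ampl f n.
Proof. by rewrite -sqrtr_sqr ler_wsqrtr// lerDr sqr_ge0. Qed.

Lemma ampl_le f n : ampl f n <= `|fcos f n| + `|fsin f n|.
Proof.
rewrite -ler_sqr ?nnegrE ?ampl_ge0 ?addr_ge0// ampl_sqr -[fcos f n ^+ 2]real_normK ?num_real//.
rewrite -[fsin f n ^+ 2]real_normK ?num_real// sqrrD -subr_ge0.
by rewrite [X in 0 <= X](_ : _ = `|fcos f n| * `|fsin f n| *+ 2) ?mulrn_wge0 ?mulr_ge0//; ring.
Qed.

(** No factor 2 appears because the series runs over all integers: the terms of [n] and [-n] are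
    equal. *)
Definition fterm f n (x : R) : R := fcos f n * cosn n x + fsin f n * sinn n x.

Definition fpart f (N : nat) (x : R) : R := \sum_(n <- irange N) fterm f n x.

Lemma fterm_continuous f n : continuous (fterm f n).
Proof.
apply: continuousDf; apply: continuousMf; do ?exact: continuous_cstf.
  exact: continuous_cosn.
exact: continuous_sinn.
Qed.

Lemma fpart_continuous f N : continuous (fpart f N).
Proof. by apply: continuous_sumf => n; exact: fterm_continuous. Qed.

Lemma is_derive_cosn n x :
  is_derive x (1 : R) (cosn n) (- (2 * pi * n%:~R) * sinn n x).
Proof. rewrite /cosn /sinn; apply: is_derive_eq; rewrite /GRing.scale/=; ring. Qed.

Lemma is_derive_sinn n x :
  is_derive x (1 : R) (sinn n) (2 * pi * n%:~R * cosn n x).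
Proof. rewrite /cosn /sinn; apply: is_derive_eq; rewrite /GRing.scale/=; ring. Qed.

(** The change of the function over one period is the integral of its derivative, a multiple of
    [sinn n], which is already known to vanish. *)
Let cosn1 n : cosn n 1 = 1 :> R.
Proof.
have := circle_int_FTC (continuousMf (@continuous_cstf R (- (2 * pi * n%:~R)))
  (@continuous_sinn R n)) (@is_derive_cosn n).
rewrite circle_intZ ?circle_int_sinn ?mulr0; last exact: continuous_sinn.
by rewrite [cosn n 0]/cosn mulr0 cos0 => /esym/eqP; rewrite subr_eq0 => /eqP.
Qed.

Let sinn1 n : sinn n 1 = 0 :> R.
Proof.
have := circle_int_FTC (continuousMf (@continuous_cstf R (2 * pi * n%:~R))
  (@continuous_cosn R n)) (@is_derive_sinn n).
rewrite circle_intZ; last exact: continuous_cosn.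
rewrite [sinn n 0]/sinn mulr0 sin0 subr0 => <-.
have [->|n0] := eqVneq n 0; first by rewrite mulr0 mul0r.
by rewrite circle_int_cosn// mulr0.
Qed.

Lemma cosnD1 n x : cosn n (x + 1) = cosn n x :> R.
Proof.
rewrite {1}/cosn mulrDr cosD -!/(cosn n _) -!/(sinn n _) cosn1 sinn1; ring.
Qed.

Lemma sinnD1 n x : sinn n (x + 1) = sinn n x :> R.
Proof.
rewrite {1}/sinn mulrDr sinD -!/(cosn n _) -!/(sinn n _) cosn1 sinn1; ring.
Qed.

Lemma fpartD1 f N x : fpart f N (x + 1) = fpart f N x.
Proof. by apply: eq_bigr => n _; rewrite /fterm cosnD1 sinnD1. Qed.

(** The common shape of the four product-to-sum formulas that follow; [s] selects the sign. *)
Let half (f g h : R -> R) (s : bool) : continuous g -> continuous h ->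
  (forall x, f x = 2^-1 * (g x + (-1) ^+ s * h x)) ->
  circle_int f = 2^-1 * (circle_int g + (-1) ^+ s * circle_int h).
Proof.
move=> cg ch /funext ->.
have ch' : continuous (fun x => (-1) ^+ s * h x).
  by apply: continuousMf => //; exact: continuous_cstf.
by rewrite circle_intZ ?circle_intDf ?circle_intZ//; exact: continuousDf.
Qed.

Section Modulation.
Variables (g : R -> R) (m n : int).
Hypothesis cg : continuous g.

Let cc k : continuous (fun x => g x * cosn k x).
Proof. by apply: continuousMf => //; exact: continuous_cosn. Qed.

Let cs k : continuous (fun x => g x * sinn k x).
Proof. by apply: continuousMf => //; exact: continuous_sinn. Qed.

Lemma fcos_cosn : fcos (fun x => cosn m x * g x) n =
  2^-1 * (fcos g (n + m) + fcos g (n - m)).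
Proof.
rewrite [LHS]/fcos (half (s := false) (@cc (n + m)) (@cc (n - m))) ?expr0 ?mul1r// => x.
by rewrite !cosnD cosnN sinnN; field.
Qed.

Lemma fcos_sinn : fcos (fun x => sinn m x * g x) n =
  2^-1 * (fsin g (n + m) - fsin g (n - m)).
Proof.
rewrite [LHS]/fcos (half (s := true) (@cs (n + m)) (@cs (n - m))) ?expr1 ?mulN1r// => x.
by rewrite !sinnD cosnN sinnN; field.
Qed.

Lemma fsin_cosn : fsin (fun x => cosn m x * g x) n =
  2^-1 * (fsin g (n + m) + fsin g (n - m)).
Proof.
rewrite [LHS]/fsin (half (s := false) (@cs (n + m)) (@cs (n - m))) ?expr0 ?mul1r// => x.
by rewrite !sinnD cosnN sinnN; field.
Qed.

Lemma fsin_sinn : fsin (fun x => sinn m x * g x) n =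
  2^-1 * (fcos g (n - m) - fcos g (n + m)).
Proof.
rewrite [LHS]/fsin (half (s := true) (@cc (n - m)) (@cc (n + m))) ?expr1 ?mulN1r// => x.
by rewrite !cosnD cosnN sinnN; field.
Qed.

End Modulation.

Lemma fcos1 n : fcos (fun=> 1) n = (n == 0)%:R :> R.
Proof.
rewrite /fcos (_ : (fun x => 1 * cosn n x) = cosn n); last by apply/funext => x; rewrite mul1r.
have [->|n0] := eqVneq n 0; last exact: circle_int_cosn.
rewrite (_ : cosn 0 = fun=> 1) ?circle_int_cst//.
by apply/funext => x; rewrite /cosn mulr0 mul0r cos0.
Qed.

Lemma fsin1 n : fsin (fun=> 1) n = 0 :> R.
Proof.
rewrite /fsin (_ : (fun x => 1 * sinn n x) = sinn n) ?circle_int_sinn//.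
by apply/funext => x; rewrite mul1r.
Qed.

(** The convolution theorem in real form. The first factor is a trigonometric polynomial, so the
    convolution is a finite sum. *)
Lemma fcos_fpartM f g N n : continuous g ->
  fcos (fun x => fpart f N x * g x) n = 2^-1 * \sum_(m <- irange N)
   (fcos f m * (fcos g (n + m) + fcos g (n - m)) +
    fsin f m * (fsin g (n + m) - fsin g (n - m))).
Proof.
move=> cg.
have cT m (h : R -> R) : continuous h -> continuous (fun x => h x * g x * cosn n x).
  by move=> ch; apply: continuousMf; [exact: continuousMf|exact: continuous_cosn].
have c1 m := @cT m _ (@continuous_cosn R m).
have c2 m := @cT m _ (@continuous_sinn R m).
transitivity (circle_int (fun x => \sum_(m <- irange N)
    (fcos f m * (cosn m x * g x * cosn n x) + fsin f m * (sinn m x * g x * cosn n x)))).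
  congr circle_int; apply/funext => x.
  by rewrite -mulrA mulr_suml; apply: eq_bigr => m _; rewrite /fterm; ring.
have cZ (c : R) (h : R -> R) : continuous h -> continuous (fun x => c * h x).
  by move=> ch; apply: continuousMf => //; exact: continuous_cstf.
rewrite circle_int_sum; last by move=> m; apply: continuousDf; apply: cZ; [exact: c1|exact: c2].
rewrite mulr_sumr; apply: eq_bigr => m _.
rewrite circle_intDf; [|exact/cZ/c1|exact/cZ/c2].
rewrite !circle_intZ; [|exact: c2|exact: c1].
rewrite -[X in fcos f m * X]/(fcos (fun x => cosn m x * g x) n).
rewrite -[X in fsin f m * X]/(fcos (fun x => sinn m x * g x) n).
by rewrite fcos_cosn// fcos_sinn//; ring.
Qed.

Lemma fsin_fpartM f g N n : continuous g ->
  fsin (fun x => fpart f N x * g x) n = 2^-1 * \sum_(m <- irange N)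
   (fcos f m * (fsin g (n + m) + fsin g (n - m)) +
    fsin f m * (fcos g (n - m) - fcos g (n + m))).
Proof.
move=> cg.
have cT m (h : R -> R) : continuous h -> continuous (fun x => h x * g x * sinn n x).
  by move=> ch; apply: continuousMf; [exact: continuousMf|exact: continuous_sinn].
have c1 m := @cT m _ (@continuous_cosn R m).
have c2 m := @cT m _ (@continuous_sinn R m).
transitivity (circle_int (fun x => \sum_(m <- irange N)
    (fcos f m * (cosn m x * g x * sinn n x) + fsin f m * (sinn m x * g x * sinn n x)))).
  congr circle_int; apply/funext => x.
  by rewrite -mulrA mulr_suml; apply: eq_bigr => m _; rewrite /fterm; ring.
have cZ (c : R) (h : R -> R) : continuous h -> continuous (fun x => c * h x).
  by move=> ch; apply: continuousMf => //; exact: continuous_cstf.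
rewrite circle_int_sum; last by move=> m; apply: continuousDf; apply: cZ; [exact: c1|exact: c2].
rewrite mulr_sumr; apply: eq_bigr => m _.
rewrite circle_intDf; [|exact/cZ/c1|exact/cZ/c2].
rewrite !circle_intZ; [|exact: c2|exact: c1].
rewrite -[X in fcos f m * X]/(fsin (fun x => cosn m x * g x) n).
rewrite -[X in fsin f m * X]/(fsin (fun x => sinn m x * g x) n).
by rewrite fsin_cosn// fsin_sinn//; ring.
Qed.

Let sum_delta (F : int -> R) N n : n \in irange N ->
  \sum_(m <- irange N) F m * (m == n)%:R = F n.
Proof.
move=> nN; rewrite (bigD1_seq n)//= ?irange_uniq// eqxx mulr1.
by rewrite big1 ?addr0// => m /negPf ->; rewrite mulr0.
Qed.

Let near_irange n : \forall N \near \oo, n \in irange N.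
Proof.
by case: n => k; exists k.+1 => // N; rewrite mem_irange.
Qed.

Lemma fcos_fpart f n : continuous f -> \forall N \near \oo, fcos (fpart f N) n = fcos f n.
Proof.
move=> cf; near=> N.
(* Multiplication by 1 makes this a case of the convolution formula: the deltas at [n] and at [-n]
   contribute one half each. *)
rewrite (_ : fpart f N = fun x => fpart f N x * 1); last by apply/funext => x; rewrite mulr1.
rewrite fcos_fpartM; last exact: continuous_cstf.
rewrite (eq_bigr (fun m => fcos f m * (m == - n)%:R + fcos f m * (m == n)%:R)).
  rewrite big_split/= !sum_delta ?fcosN; first by field.
    by near: N; exact: near_irange.
  by near: N; exact: near_irange.
move=> m _; rewrite !fcos1 !fsin1 subrr mulr0 addr0 mulrDr.
by rewrite subr_eq0 addr_eq0 [m == - n]eq_sym eqr_oppLR [n == m]eq_sym.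
Unshelve. all: by end_near. Qed.

Lemma fsin_fpart f n : continuous f -> \forall N \near \oo, fsin (fpart f N) n = fsin f n.
Proof.
move=> cf; near=> N.
rewrite (_ : fpart f N = fun x => fpart f N x * 1); last by apply/funext => x; rewrite mulr1.
rewrite fsin_fpartM; last exact: continuous_cstf.
rewrite (eq_bigr (fun m => fsin f m * (m == n)%:R - fsin f m * (m == - n)%:R)).
  rewrite sumrB/= !sum_delta ?fsinN//; first by field.
    by near: N; exact: near_irange.
  by near: N; exact: near_irange.
move=> m _; rewrite !fcos1 !fsin1 addr0 mulr0 add0r mulrBr.
by rewrite subr_eq0 addr_eq0 [m == - n]eq_sym eqr_oppLR [n == m]eq_sym.
Unshelve. all: by end_near. Qed.

(** Summable amplitudes give a uniform limit by the M-test. Its Fourier coefficients are those of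
    [f], because each coefficient of the partial sums is eventually constant, so uniqueness
    identifies it with [f]. *)
Lemma ucvg_fpart f (C : R) : continuous f -> (forall x, f (x + 1) = f x) ->
  sums_le (ampl f) C -> ucvg (fpart f) f.
Proof.
move=> cf pf fC.
have tle n x : `|fterm f n x| <= 2 * ampl f n.
  rewrite (le_trans (ler_normD _ _))// !normrM mulr_natl mulr2n lerD//.
    by rewrite -[leRHS]mulr1 ler_pM ?cosn_norm_le ?fcos_le_ampl.
  by rewrite -[leRHS]mulr1 ler_pM ?sinn_norm_le ?fsin_le_ampl.
have [S uS] : exists S, ucvg (fpart f) S.
  have [|N|S uS] := @weierstrass_M_test R (fun k x => fterm f (Posz k) x + fterm f (Negz k) x)
      (fun k => 2 * (ampl f (Posz k) + ampl f (Negz k))) (2 * C).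
  - by move=> k x; rewrite (le_trans (ler_normD _ _))// mulrDr lerD.
  - by rewrite -mulr_sumr -sum_irange ler_pM2l// fC// irange_uniq.
  exists S => e /uS; apply: filterS => N h x.
  by rewrite /fpart (sum_irange (fun n => fterm f n x)).
suff e : S = f by rewrite -[X in ucvg _ X]e.
have cS := ucvg_continuous (@fpart_continuous f) uS.
have cNf : continuous (fun x => - f x) by exact: continuousNf.
apply/funext => x; apply/eqP; rewrite -subr_eq0; apply/eqP.
have fNE : (fun x => - f x) = -1 *: f.
  by apply/funext => y; rewrite -[RHS]/(-1 * f y) mulN1r.
suff z : forall y, (S + (fun x => - f x)) y = 0 by exact: (z x).
apply: fourier_unique.
- exact: continuousDf.
- move=> y; rewrite -[LHS]/(S (y + 1) - f (y + 1)) pf; congr (_ - _).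
  apply: cvg_unique (ucvg_pointwise (x := y) uS) => //.
  by rewrite -(funext (fun N => fpartD1 f N y)); exact: ucvg_pointwise.
- move=> n; rewrite fcosD// fNE fcosZ// mulN1r; apply/eqP; rewrite subr_eq0; apply/eqP.
  have cN N : continuous (fun x => fpart f N x * cosn n x).
    by apply: continuousMf; [exact: fpart_continuous|exact: continuous_cosn].
  have h := ucvg_circle_int cN (ucvgMr (cosn_norm_le n) uS).
  apply: cvg_unique h _ => //.
  by apply: cvg_near_cst; exact: fcos_fpart.
- move=> n; rewrite fsinD// fNE fsinZ// mulN1r; apply/eqP; rewrite subr_eq0; apply/eqP.
  have cN N : continuous (fun x => fpart f N x * sinn n x).
    by apply: continuousMf; [exact: fpart_continuous|exact: continuous_sinn].
  have h := ucvg_circle_int cN (ucvgMr (sinn_norm_le n) uS).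
  apply: cvg_unique h _ => //.
  by apply: cvg_near_cst; exact: fsin_fpart.
Qed.

End FourierCoefficients.

(** * Sobolev norms *)

Section SobolevBounds.
Context {R : realType}.
Implicit Types (f g : R -> R) (r A B : R) (m n : int).

(* f is in H^r and has norm at most A. *)
Definition Hle r f A := [/\ 0 <= A, forall x, f (x + 1) = f x, continuous f &
  sums_le (sob_term r f) (A ^+ 2)].

Lemma sob_termE r f n : sob_term r f n = japanese n `^ r * ampl f n ^+ 2.
Proof. by rewrite ampl_sqr. Qed.

Lemma Hle_Hs r (f : Hs r) : Hle r f `|f|.
Proof.
split; [by []|exact: Hs_periodic|exact: Hs_continuous|].
apply/esum_sums_le; first exact: sob_term_ge0.
rewrite [`|f|]/(Hs_norm f) sqr_sqrtr ?fine_ge0 ?sob_energy_ge0// fineK//.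
by rewrite ge0_fin_numE ?sob_energy_ge0// Hs_energy.
Qed.

Lemma Hle_sobolev r f A : Hle r f A -> f \in sobolev r.
Proof.
case=> A0 pf cf /esum_sums_le fA; apply/asboolP; split => //.
by apply: (le_lt_trans (fA _)); rewrite ?ltry//; exact: sob_term_ge0.
Qed.

Lemma toHsE r f A : Hle r f A -> toHs r f = f :> (R -> R).
Proof. by move=> /Hle_sobolev fr; rewrite /toHs val_insubd fr. Qed.

Lemma toHs_norm r f A : Hle r f A -> `|toHs r f| <= A.
Proof.
move=> fA; have [A0 pf cf /esum_sums_le sA] := fA.
rewrite [`|_|]/(Hs_norm _) /Hs_norm (toHsE fA) -[leRHS]ger0_norm// -sqrtr_sqr ler_wsqrtr//.
have {}sA := sA (sob_term_ge0 r f).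
rewrite -lee_fin fineK// ge0_fin_numE ?sob_energy_ge0//.
by apply: le_lt_trans sA _; rewrite ltry.
Qed.

Lemma Hle_mono r f A B : A <= B -> Hle r f A -> Hle r f B.
Proof.
move=> AB [A0 pf cf sA]; have B0 := le_trans A0 AB.
by split => // X /sA /le_trans; apply; rewrite ler_sqr.
Qed.

(** Inherited, through [toHs], from the triangle inequality of the norm on [Hs]. *)
Lemma HleD r f g A B : Hle r f A -> Hle r g B -> Hle r (fun x => f x + g x) (A + B).
Proof.
move=> fA gB; apply: (@Hle_mono _ _ `|toHs r f + toHs r g|).
  by rewrite (le_trans (ler_normD _ _))// lerD ?toHs_norm.
rewrite (_ : (fun x => _) = toHs r f + toHs r g); first exact: Hle_Hs.
by apply/funext => x; rewrite -[RHS]/(toHs r f x + toHs r g x) (toHsE fA) (toHsE gB).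
Qed.

Lemma HleZ r f A (c : R) : Hle r f A -> Hle r (fun x => c * f x) (`|c| * A).
Proof.
move=> fA; apply: (@Hle_mono _ _ `|c *: toHs r f|).
  by rewrite normrZ ler_wpM2l ?toHs_norm.
rewrite (_ : (fun x => _) = c *: toHs r f); first exact: Hle_Hs.
by apply/funext => x; rewrite -[RHS]/(c * toHs r f x) (toHsE fA).
Qed.

Lemma HleN r f A : Hle r f A -> Hle r (fun x => - f x) A.
Proof.
move=> /(HleZ (-1)); rewrite normrN1 mul1r; congr Hle.
by apply/funext => x; rewrite mulN1r.
Qed.

Lemma HleB r f g A B : Hle r f A -> Hle r g B -> Hle r (fun x => f x - g x) (A + B).
Proof. by move=> fA gB; apply: HleD fA (HleN gB). Qed.

Lemma Hle1 r : Hle r (fun=> 1) 1.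
Proof.
split => //; first exact: continuous_cstf.
move=> X uX; rewrite expr1n.
rewrite (eq_bigr (fun n => (n == 0)%:R)); last first.
  move=> n _; rewrite /sob_term fcos1 fsin1.
  have [->|n0] := eqVneq n 0; last by rewrite !expr0n addr0 mulr0.
  by rewrite expr1n !expr0n !addr0 powR1 mulr1.
have [X0|X0] := boolP (0 \in X).
  by rewrite (bigD1_seq 0)//= big1 ?addr0// => i /negPf ->.
rewrite big_seq big1 // => i iX; case: eqVneq => // i0.
by move: X0; rewrite -i0 iX.
Qed.

Lemma Hle_cst r (c : R) : Hle r (fun=> c) `|c|.
Proof. by have := HleZ c (Hle1 r); under eq_fun do rewrite mulr1; rewrite mulr1. Qed.

(** Cauchy-Schwarz against the weight $(1+n^2)^{-r/2}$, which is square summable for $r>1/2$. It is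
    stated for sequences, and not only for amplitudes of functions, so that it also applies to $|n|$
    times the amplitude. *)
Lemma japanese_l1 r : 1 / 2 < r -> exists2 C, 0 < C & forall (a : int -> R) A,
  0 <= A -> (forall n, 0 <= a n) ->
  sums_le (fun n => japanese n `^ r * a n ^+ 2) (A ^+ 2) -> sums_le a (C * A).
Proof.
move=> r2; have [C C0 CH] := @japanese_sum R r r2.
exists (Num.sqrt C) => [|a A A0 a0 aA X uX]; first by rewrite sqrtr_gt0.
have C0' := sqrtr_ge0 C.
have S0 : 0 <= \sum_(n <- X) a n by apply: sumr_ge0.
have CA0 := mulr_ge0 C0' A0.
rewrite -ler_sqr ?nnegrE//.
have j0 n : japanese n `^ (r / 2) != 0 :> R by rewrite gt_eqF// powR_gt0// japanese_gt0.
have jq n : (japanese n `^ (r / 2)) ^+ 2 = japanese n `^ r :> R.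
  by rewrite -powR_mulrn ?powR_ge0// -powRrM; congr (_ `^ _); field.
rewrite (eq_bigr (fun n => (japanese n `^ (r / 2))^-1 * (japanese n `^ (r / 2) * a n))).
  apply: le_trans (sum_cauchy_schwarz _ _ _) _.
  rewrite exprMn (sqr_sqrtr (ltW C0)); apply: ler_pM.
  - by apply: sumr_ge0 => n _; exact: sqr_ge0.
  - by apply: sumr_ge0 => n _; exact: sqr_ge0.
  - apply: le_trans (CH X uX); rewrite le_eqVlt; apply/orP; left; apply/eqP.
    by apply: eq_bigr => n _; rewrite exprVn jq powRN.
  - apply: le_trans (aA X uX); rewrite le_eqVlt; apply/orP; left; apply/eqP.
    by apply: eq_bigr => n _; rewrite exprMn jq.
by move=> n _; rewrite mulrA mulVf ?mul1r.
Qed.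

Lemma Hle_ampl_l1 r : 1 / 2 < r ->
  exists2 C, 0 < C & forall f A, Hle r f A -> sums_le (ampl f) (C * A).
Proof.
move=> /japanese_l1[C C0 CH]; exists C => // f A [A0 _ _ fA].
apply: CH => //; first exact: ampl_ge0.
by apply: sums_le_mono fA => n; rewrite sob_termE.
Qed.

Lemma Hle_ucvg_fpart r f A : 1 / 2 < r -> Hle r f A -> ucvg (fpart f) f.
Proof.
move=> /Hle_ampl_l1[C C0 CH] fA; have [_ pf cf _] := fA.
exact: ucvg_fpart cf pf (CH f A fA).
Qed.

Lemma Hle_sup r : 1 / 2 < r ->
  exists2 C, 0 < C & forall f A, Hle r f A -> forall x, `|f x| <= C * A.
Proof.
move=> r2; have [C C0 CH] := Hle_ampl_l1 r2.
exists (2 * C) => [|f A fA x]; first by rewrite mulr_gt0.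
have h : `|fpart f N x| @[N --> \oo] --> `|f x|.
  by apply: cvg_norm; exact: ucvg_pointwise (Hle_ucvg_fpart r2 fA).
rewrite -(cvg_lim _ h)//; apply: limr_le; first by apply/cvg_ex; eexists; exact: h.
near=> N; apply: le_trans (ler_norm_sum _ _ _) _.
rewrite -mulrA; apply: le_trans (_ : 2 * \sum_(n <- irange N) ampl f n <= _).
  rewrite mulr_sumr; apply: ler_sum => n _.
  rewrite (le_trans (ler_normD _ _))// !normrM mulr_natl mulr2n lerD//.
    by rewrite -[leRHS]mulr1 ler_pM ?cosn_norm_le ?fcos_le_ampl.
  by rewrite -[leRHS]mulr1 ler_pM ?sinn_norm_le ?fsin_le_ampl.
by rewrite ler_pM2l// CH// irange_uniq.
Unshelve. all: by end_near. Qed.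

(* Lower semicontinuity of the Sobolev norm under uniform convergence. *)
Lemma Hle_lim r (u : nat -> R -> R) f A : (forall N, Hle r (u N) A) ->
  ucvg u f -> Hle r f A.
Proof.
move=> uA uf.
have A0 : 0 <= A by have [] := uA 0%N.
have cu N : continuous (u N) by have [] := uA N.
have cf := ucvg_continuous cu uf.
split => //.
  move=> x; apply: cvg_unique (ucvg_pointwise (x := x) uf) => //.
  rewrite (_ : (fun N => u N x) = fun N => u N (x + 1)); first exact: ucvg_pointwise.
  by apply/funext => N; have [_ ->] := uA N.
move=> X uX.
have cN n : sob_term r (u N) n @[N --> \oo] --> sob_term r f n.
  have c1 : fcos (u N) n @[N --> \oo] --> fcos f n.
    apply: ucvg_circle_int (ucvgMr (cosn_norm_le n) uf) => N.
    by apply: continuousMf => //; exact: continuous_cosn.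
  have c2 : fsin (u N) n @[N --> \oo] --> fsin f n.
    apply: ucvg_circle_int (ucvgMr (sinn_norm_le n) uf) => N.
    by apply: continuousMf => //; exact: continuous_sinn.
  by apply: cvgM; [exact: cvg_cst|apply: cvgD; apply: cvgM].
have h : \sum_(n <- X) sob_term r (u N) n @[N --> \oo] --> \sum_(n <- X) sob_term r f n.
  elim: X {uX} => [|n X IH].
    by under eq_fun do rewrite big_nil; rewrite big_nil; exact: cvg_cst.
  by under eq_fun do rewrite big_cons; rewrite big_cons; apply: cvgD.
rewrite -(cvg_lim _ h)//; apply: limr_le; first by apply/cvg_ex; eexists; exact: h.
near=> N; have [_ _ _] := uA N; exact.
Unshelve. all: by end_near. Qed.

(** The mean is the coefficient of frequency 0, where the Sobolev weight is 1 for every exponent. *)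
Lemma Hle_mean r f A : Hle r f A -> `|circle_int f| <= A.
Proof.
move=> [A0 _ cf /(_ [:: 0] isT)]; rewrite big_seq1 => h.
rewrite -ler_sqr ?nnegrE// real_normK ?num_real//; apply: le_trans h.
rewrite /sob_term expr0n/= addr0 powR1 mul1r.
rewrite [fcos f 0](_ : _ = circle_int f) ?lerDl ?sqr_ge0//.
by congr circle_int; apply/funext => x; rewrite /cosn mulr0 mul0r cos0 mulr1.
Qed.

End SobolevBounds.

(** * Differentiation and integration between Sobolev spaces *)

Section SobolevCalculus.
Context {R : realType}.
Implicit Types (f g F G : R -> R) (r A B : R) (m n : int).

Lemma fcos_deriv F f n : continuous f -> (forall x, F (x + 1) = F x) ->
  (forall x, is_derive x (1 : R) F (f x)) -> fcos f n = 2 * pi * n%:~R * fsin F n.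
Proof.
move=> cf pF dF; have cF := is_derive_continuous dF.
have cs : continuous (fun x : R => - (2 * pi * n%:~R) * sinn n x : R).
  by apply: continuousMf; [exact: continuous_cstf|exact: continuous_sinn].
rewrite /fcos (circle_int_by_parts cf cs dF (@is_derive_cosn R n)).
  rewrite -circle_intNf; last exact: continuousMf.
  rewrite -circle_intZ; last by apply: continuousMf => //; exact: continuous_sinn.
  by congr circle_int; apply/funext => x; ring.
by rewrite -[X in cosn _ X]add0r cosnD1 -[X in F X * _]add0r pF.
Qed.

Lemma fsin_deriv F f n : continuous f -> (forall x, F (x + 1) = F x) ->
  (forall x, is_derive x (1 : R) F (f x)) -> fsin f n = - (2 * pi * n%:~R * fcos F n).
Proof.
move=> cf pF dF; have cF := is_derive_continuous dF.
have cs : continuous (fun x : R => (2 * pi * n%:~R) * cosn n x : R).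
  by apply: continuousMf; [exact: continuous_cstf|exact: continuous_cosn].
rewrite /fsin (circle_int_by_parts cf cs dF (@is_derive_sinn R n)).
  rewrite -circle_intZ; last by apply: continuousMf => //; exact: continuous_cosn.
  by congr (- circle_int _); apply/funext => x; ring.
by rewrite -[X in sinn _ X]add0r sinnD1 -[X in F X * _]add0r pF.
Qed.

Lemma ampl_deriv F f n : continuous f -> (forall x, F (x + 1) = F x) ->
  (forall x, is_derive x (1 : R) F (f x)) ->
  ampl f n ^+ 2 = (2 * pi) ^+ 2 * n%:~R ^+ 2 * ampl F n ^+ 2.
Proof.
by move=> cf pF dF; rewrite !ampl_sqr (fcos_deriv n cf pF dF) (fsin_deriv n cf pF dF); ring.
Qed.

Lemma japaneseM1 r n : japanese n `^ r = japanese n * japanese n `^ (r - 1) :> R.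
Proof.
have j0 := @japanese_gt0 R n.
rewrite -[X in X * _](@powRr1 _ (japanese n)) ?(ltW j0)// -powRD; first by congr (_ `^ _); ring.
by rewrite (gt_eqF j0) implybT.
Qed.

Definition dfpart f (N : nat) (x : R) : R := \sum_(n <- irange N)
  2 * pi * n%:~R * (fsin f n * cosn n x - fcos f n * sinn n x).

Lemma is_derive_fpart f N x : is_derive x (1 : R) (fpart f N) (dfpart f N x).
Proof.
rewrite (_ : fpart f N = \sum_(n <- irange N) fterm f n); last first.
  by apply/funext => y; rewrite fct_sumE.
rewrite /dfpart; elim: (irange N) => [|n s IH].
  by rewrite !big_nil; exact: is_derive_cst.
rewrite !big_cons; apply: is_deriveD => //.
have d := is_deriveD (is_deriveZ (fcos f n) (is_derive_cosn n x))
  (is_deriveZ (fsin f n) (is_derive_sinn n x)).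
by apply: (is_derive_eq d); rewrite /GRing.scale/=; ring.
Qed.

(** As $r-1>1/2$, the sequence $|n|$ times the amplitude is summable, so the series differentiated
    term by term converges uniformly to a continuous function. *)
Lemma Hle_C1 r f A : 3 / 2 < r -> Hle r f A ->
  exists2 g, continuous g & forall x, is_derive x (1 : R) f (g x).
Proof.
move=> r3 fA; have [A0 pf cf sA] := fA.
have [C C0 CH] : exists2 C, 0 < C & forall (a : int -> R) A,
    0 <= A -> (forall n, 0 <= a n) ->
    sums_le (fun n => japanese n `^ (r - 1) * a n ^+ 2) (A ^+ 2) -> sums_le a (C * A).
  by apply: japanese_l1; lra.
have l1 : sums_le (fun n => `|n%:~R| * ampl f n) (C * A).
  apply: CH => // [n|]; first by rewrite mulr_ge0// ampl_ge0.
  apply: sums_le_mono sA => n; rewrite sob_termE (japaneseM1 r) exprMn real_normK ?num_real//.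
  by rewrite mulrCA -[leRHS]mulrA ler_wpM2r ?lerDr// mulr_ge0 ?powR_ge0 ?sqr_ge0.
pose t n x := 2 * pi * n%:~R * (fsin f n * cosn n x - fcos f n * sinn n x).
have p0 : 0 <= 2 * pi :> R by rewrite mulr_ge0 ?pi_ge0.
have tle n x : `|t n x| <= 4 * pi * (`|n%:~R| * ampl f n).
  rewrite /t normrM normrM (ger0_norm p0).
  have -> : 4 * pi * (`|n%:~R| * ampl f n) = 2 * pi * `|n%:~R| * (2 * ampl f n) by ring.
  apply: ler_wpM2l; first by rewrite mulr_ge0.
  rewrite (le_trans (ler_normB _ _))// !normrM mulr_natl mulr2n lerD//.
    by rewrite -[leRHS]mulr1 ler_pM ?cosn_norm_le ?fsin_le_ampl.
  by rewrite -[leRHS]mulr1 ler_pM ?sinn_norm_le ?fcos_le_ampl.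
have [S uS] : exists S, ucvg (dfpart f) S.
  have [|N|S uS] := @weierstrass_M_test R (fun k x => t (Posz k) x + t (Negz k) x)
      (fun k => 4 * pi * (`|(Posz k)%:~R| * ampl f (Posz k)
                          + `|(Negz k)%:~R| * ampl f (Negz k))) (4 * pi * (C * A)).
  - by move=> k x; rewrite (le_trans (ler_normD _ _))// mulrDr lerD.
  - rewrite -mulr_sumr -(sum_irange (fun n => `|n%:~R| * ampl f n)).
    by rewrite ler_wpM2l ?mulr_ge0 ?pi_ge0// l1// irange_uniq.
  exists S => e /uS; apply: filterS => N h x.
  by rewrite /dfpart (sum_irange (fun n => t n x)).
have cd N : continuous (dfpart f N).
  apply: continuous_sumf => n; apply: continuousMf; first exact: continuous_cstf.
  apply: continuousBf; apply: continuousMf; do ?exact: continuous_cstf.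
    exact: continuous_cosn.
  exact: continuous_sinn.
have cS := ucvg_continuous cd uS.
exists S => // x.
have uf : ucvg (fpart f) f by apply: Hle_ucvg_fpart fA; lra.
(* The limit is identified after integration: primitives, unlike derivatives, pass to uniform
   limits, and for the partial sums this identity is the fundamental theorem. *)
suff -> : f = (fun x => f 0 + prim S x).
  have := is_deriveD (is_derive_cst (f 0) x 1) (is_derive_prim x cS).
  by rewrite add0r.
apply/funext => y.
apply: cvg_unique (ucvg_pointwise (x := y) uf) _ => //.
have -> : (fun N => fpart f N y) = (fun N => fpart f N 0 + prim (dfpart f N) y).
  apply/funext => N; rewrite (prim_FTC y (cd N) (is_derive_fpart f N)); ring.
apply: cvgD; first exact: ucvg_pointwise.
apply/cvgrPdist_le => e e0.
have e1 : 0 < e / (`|y| + 1) by rewrite divr_gt0// ltr_wpDl.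
near=> N.
have -> : prim S y - prim (dfpart f N) y = prim (fun x => S x - dfpart f N x) y.
  rewrite (_ : (fun x => S x - dfpart f N x) = (fun x => 1 * S x + -1 * dfpart f N x)).
    by rewrite prim_lin//; ring.
  by apply/funext => z; ring.
apply: le_trans (prim_norm_le (M := e / (`|y| + 1)) y _ _) _.
- exact: continuousBf.
- by near: N; exact: uS.
- rewrite -[leRHS](divfK (x := `|y| + 1)) ?gt_eqF ?ltr_wpDl//.
  by rewrite ler_wpM2l ?(ltW e1)// lerDl.
Unshelve. all: by end_near. Qed.

Lemma Hle_is_derive r f A : 3 / 2 < r -> Hle r f A ->
  forall x, is_derive x (1 : R) f (derive1 f x).
Proof.
move=> r3 /(Hle_C1 r3)[g cg dg] x.
by rewrite (is_derive_derive1 dg).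
Qed.

(** Differentiation multiplies the amplitude by $2\pi|n|$, and $n^2\le 1+n^2$ exchanges $|n|$ for
    one unit of the exponent. *)
Lemma Hle_derive1 r f A : 3 / 2 < r -> Hle r f A ->
  Hle (r - 1) (derive1 f) (2 * pi * A).
Proof.
move=> r3 fA; have [A0 pf cf sA] := fA.
have [g cg dg] := Hle_C1 r3 fA; rewrite (is_derive_derive1 dg).
have p0 : 0 <= 2 * pi :> R by rewrite mulr_ge0 ?pi_ge0.
split => //; first by rewrite mulr_ge0.
  move=> x.
  have d1 : is_derive x (1 : R) (f \o (fun y => y + 1)) (g (x + 1) * (1 + 0)).
    by apply: is_derive1_comp; apply: is_deriveD.
  have fE : f \o (fun y => y + 1) = f by apply/funext => y; exact: pf.
  rewrite fE addr0 mulr1 in d1.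
  by have [_ <-] := d1; have [_ <-] := dg x.
move=> X uX.
apply: (@le_trans _ _ (\sum_(n <- X) (2 * pi) ^+ 2 * sob_term r f n)).
  apply: ler_sum => n _; rewrite !sob_termE (ampl_deriv n cg pf dg) (japaneseM1 r).
  have -> : japanese n `^ (r - 1) * ((2 * pi) ^+ 2 * n%:~R ^+ 2 * ampl f n ^+ 2) =
     n%:~R ^+ 2 * ((2 * pi) ^+ 2 * (japanese n `^ (r - 1) * ampl f n ^+ 2)) by ring.
  have -> : (2 * pi) ^+ 2 * (japanese n * japanese n `^ (r - 1) * ampl f n ^+ 2) =
     japanese n * ((2 * pi) ^+ 2 * (japanese n `^ (r - 1) * ampl f n ^+ 2)) by ring.
  apply: ler_wpM2r; last by rewrite lerDr.
  by rewrite mulr_ge0 ?sqr_ge0// mulr_ge0 ?sqr_ge0 ?powR_ge0.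
by rewrite -mulr_sumr [(_ * A) ^+ 2]exprMn ler_wpM2l ?sqr_ge0// sA.
Qed.

(** Subtracting the mean makes the primitive periodic. At $n\neq0$ one unit of the exponent is
    gained from $1+n^2\le 2n^2\le(2\pi n)^2$; frequency 0 is controlled by the sup norm instead. *)
Lemma Hle_prim r : 1 / 2 < r -> exists2 C, 0 < C & forall g A, Hle r g A ->
  Hle (r + 1) (fun x => prim g x - x * circle_int g) (C * A).
Proof.
move=> r2; have [C C0 CH] := @Hle_sup R r r2.
exists (C * 2 + 2) => [|g A gA]; first by rewrite addr_gt0// mulr_gt0.
have gm := Hle_mean gA; have [A0 pg cg _] := gA.
set m := circle_int g in gm *.
pose f x := g x - m.
have fB : Hle r f (2 * A).
  apply: (@Hle_mono _ _ _ (A + `|m|)); first by rewrite mulr_natl mulr2n lerD2l.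
  by apply: HleB => //; exact: Hle_cst.
have [B0 pf cf sB] := fB.
pose F x := prim g x - x * m.
have dF x : is_derive x (1 : R) F (f x).
  apply: is_deriveB; first exact: is_derive_prim.
  apply: is_derive_eq (is_deriveMf (is_derive_id x (1 : R)) (is_derive_cst m x (1 : R))) _.
  by rewrite mul1r mulr0 addr0.
have cF := is_derive_continuous dF.
have pF x : F (x + 1) = F x.
  have d1 y : is_derive y (1 : R) (F \o (fun y => y + 1) - F) (f (y + 1) * (1 + 0) - f y).
    by apply: is_deriveB; apply: is_derive1_comp; apply: is_deriveD.
  have e0 y : f (y + 1) * (1 + 0) - f y = 0 by rewrite pf addr0 mulr1 subrr.
  have := is_derive_eq0 d1 e0 x 0.
  rewrite -[LHS]/(F (x + 1) - F x) -[RHS]/(F (0 + 1) - F 0) add0r.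
  rewrite {3 4}/F -circle_int_prim prim0 mul0r mul1r -/m; lra.
have FE x : F x = prim f x by rewrite (prim_FTC x cf dF) {3}/F prim0 mul0r subrr subr0.
have FD : `|circle_int F| <= C * (2 * A).
  apply: circle_int_norm_le => // x /andP[x0 x1].
  rewrite FE (le_trans (prim_norm_le x cf (CH f _ fB)))//.
  by rewrite ger0_norm// ler_piMr// mulr_ge0// ltW.
have CA0 : 0 <= C * A by rewrite mulr_ge0// ltW.
have B1 : 0 <= (C * 2 + 2) * A by rewrite mulr_ge0// addr_ge0// mulr_ge0// ltW.
split => // X uX.
(* The first square bounds frequency 0, the second all the others: [2 * A] is the norm bound for [g]
   minus its mean. *)
apply: (@le_trans _ _ ((C * (2 * A)) ^+ 2 + (2 * A) ^+ 2)); last first.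
  rewrite -subr_ge0 [X in 0 <= X](_ : _ = 8 * (C * A) * A); last by ring.
  by rewrite mulr_ge0// mulr_ge0.
apply: (@le_trans _ _ (\sum_(n <- X) ((C * (2 * A)) ^+ 2 * (n == 0)%:R + sob_term r f n))).
  apply: ler_sum => n _; rewrite sob_termE.
  have [->|n0] := eqVneq n 0.
    rewrite mulr1 /japanese expr0n/= addr0 powR1 mul1r.
    apply: ler_wpDr; first exact: sob_term_ge0.
    rewrite ampl_sqr [fsin F 0](_ : _ = 0); last first.
      rewrite -(@circle_int_cst R 0); congr circle_int; apply/funext => x.
      by rewrite /sinn mulr0 mul0r sin0 mulr0.
    rewrite expr0n addr0 -[fcos F 0 ^+ 2]real_normK ?num_real// ler_sqr ?nnegrE//.
      rewrite [fcos F 0](_ : _ = circle_int F)//.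
      by congr circle_int; apply/funext => x; rewrite /cosn mulr0 mul0r cos0 mulr1.
    by rewrite mulr_ge0// ltW.
  rewrite mulr0 add0r sob_termE (ampl_deriv n cf pF dF) japaneseM1 addrK.
  have n1 : 1 <= n%:~R ^+ 2 :> R.
    rewrite -[n%:~R ^+ 2]real_normK ?num_real// expr_ge1// -intr_norm.
    by rewrite (ler_int _ 1) -gtz0_ge1 normr_gt0.
  have p1 : 2 <= (2 * pi) ^+ 2 :> R.
    have := pi_ge2 R; nra.
  have -> : japanese n `^ r * ((2 * pi) ^+ 2 * n%:~R ^+ 2 * ampl F n ^+ 2) =
     ((2 * pi) ^+ 2 * n%:~R ^+ 2) * (japanese n `^ r * ampl F n ^+ 2) by ring.
  rewrite -[leLHS]mulrA; apply: ler_wpM2r; first by rewrite mulr_ge0 ?powR_ge0 ?sqr_ge0.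
  rewrite /japanese.
  apply: (@le_trans _ _ (2 * n%:~R ^+ 2)); first lra.
  by rewrite ler_wpM2r ?sqr_ge0.
rewrite big_split/= -mulr_sumr lerD ?sB// ler_piMr ?sqr_ge0//.
have [X0|X0] := boolP (0 \in X).
  by rewrite (bigD1_seq 0)//= big1 ?addr0// => i /negPf ->.
rewrite big_seq big1 // => i iX; case: eqVneq => // i0.
by move: X0; rewrite -i0 iX.
Qed.

End SobolevCalculus.

(** * The algebra H^r *)

Section SobolevAlgebra.
Context {R : realType}.
Implicit Types (f g q : R -> R) (r A B : R) (m n : int) (a b : int -> R).

Lemma sums_le_inj a A (X : seq int) (e : int -> int) : injective e ->
  sums_le a A -> uniq X -> \sum_(n <- X) a (e n) <= A.
Proof.
move=> ie aA uX; rewrite -(big_map e xpredT a).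
by apply: aA; rewrite map_inj_uniq.
Qed.

Section Young.
Variables (e : int -> int -> int) (a b : int -> R) (A B : R) (Y : seq int).
Hypotheses (e1 : forall n, injective (e n)) (e2 : forall m, injective (e ^~ m)).
Hypotheses (a0 : forall n, 0 <= a n) (b0 : forall n, 0 <= b n) (uY : uniq Y).

Let double_sum (F G : int -> R) (X : seq int) :
  \sum_(n <- X) \sum_(m <- Y) F m * G (e n m) =
  \sum_(m <- Y) F m * \sum_(n <- X) G (e n m).
Proof. by rewrite exchange_big/=; apply: eq_bigr => m _; rewrite mulr_sumr. Qed.

(** Young's inequality: write $ab=\sqrt b\,(a\sqrt b)$, apply Cauchy-Schwarz, and exchange the sums.
    The index [e n m] stands for $n+m$ or $n-m$; injectivity in each argument replaces translation
    invariance. *)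
Lemma young_sqr_l1 : sums_le (fun m => a m ^+ 2) (A ^+ 2) -> sums_le b B ->
  sums_le (fun n => (\sum_(m <- Y) a m * b (e n m)) ^+ 2) (B ^+ 2 * A ^+ 2).
Proof.
move=> aA bB X uX; have B0 := sums_le_ge0 bB.
apply: (@le_trans _ _ (\sum_(n <- X) B * \sum_(m <- Y) a m ^+ 2 * b (e n m))).
  apply: ler_sum => n _.
  rewrite (eq_bigr (fun m => Num.sqrt (b (e n m)) * (a m * Num.sqrt (b (e n m))))); last first.
    by move=> m _; rewrite mulrCA -expr2 sqr_sqrtr.
  apply: le_trans (sum_cauchy_schwarz _ _ _) _; apply: ler_pM.
  - by apply: sumr_ge0 => m _; exact: sqr_ge0.
  - by apply: sumr_ge0 => m _; exact: sqr_ge0.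
  - under eq_bigr do rewrite sqr_sqrtr//.
    exact: sums_le_inj.
  - rewrite le_eqVlt; apply/orP; left; apply/eqP.
    by apply: eq_bigr => m _; rewrite exprMn sqr_sqrtr.
rewrite -mulr_sumr double_sum expr2 -mulrA ler_wpM2l//.
apply: (@le_trans _ _ (\sum_(m <- Y) a m ^+ 2 * B)).
  apply: ler_sum => m _; apply: ler_wpM2l; first exact: sqr_ge0.
  exact: (sums_le_inj (@e2 m)).
by rewrite -mulr_suml mulrC ler_wpM2l// aA.
Qed.

Lemma young_l1_sqr : sums_le a A -> sums_le (fun n => b n ^+ 2) (B ^+ 2) ->
  sums_le (fun n => (\sum_(m <- Y) a m * b (e n m)) ^+ 2) (A ^+ 2 * B ^+ 2).
Proof.
move=> aA bB X uX; have A0 := sums_le_ge0 aA.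
apply: (@le_trans _ _ (\sum_(n <- X) A * \sum_(m <- Y) a m * b (e n m) ^+ 2)).
  apply: ler_sum => n _.
  rewrite (eq_bigr (fun m => Num.sqrt (a m) * (Num.sqrt (a m) * b (e n m)))); last first.
    by move=> m _; rewrite mulrA -expr2 sqr_sqrtr.
  apply: le_trans (sum_cauchy_schwarz _ _ _) _; apply: ler_pM.
  - by apply: sumr_ge0 => m _; exact: sqr_ge0.
  - by apply: sumr_ge0 => m _; exact: sqr_ge0.
  - by under eq_bigr do rewrite sqr_sqrtr//; exact: aA.
  - rewrite le_eqVlt; apply/orP; left; apply/eqP.
    by apply: eq_bigr => m _; rewrite exprMn sqr_sqrtr.
rewrite -mulr_sumr (double_sum a (fun n => b n ^+ 2)) expr2 -mulrA ler_wpM2l//.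
apply: (@le_trans _ _ (\sum_(m <- Y) a m * B ^+ 2)).
  apply: ler_sum => m _; apply: ler_wpM2l => //.
  exact: (sums_le_inj (a := fun n => b n ^+ 2) (@e2 m)).
by rewrite -mulr_suml ler_wpM2r ?sqr_ge0// aA.
Qed.

End Young.

(** $1+(m+n)^2$ is at most 4 times the larger of $1+m^2$ and $1+n^2$, and a power of a maximum is at
    most the sum of the powers. In a product it lets the Sobolev weight fall on one factor at a
    time. *)
Lemma japanese_peetre r m n : 0 <= r ->
  japanese (m + n) `^ r <= 4 `^ r * (japanese m `^ r + japanese n `^ r) :> R.
Proof.
move=> r0; have jm := @japanese_gt0 R m; have jn := @japanese_gt0 R n.
have jmn := @japanese_gt0 R (m + n).
have le4 : japanese (m + n) <= 4 * Num.max (japanese m) (japanese n) :> R.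
  rewrite /japanese intrD; set x : R := m%:~R; set y : R := n%:~R.
  have : 0 <= (x - y) ^+ 2 by exact: sqr_ge0.
  have h1 : 1 + x ^+ 2 <= Num.max (1 + x ^+ 2) (1 + y ^+ 2) by rewrite le_max lexx.
  have h2 : 1 + y ^+ 2 <= Num.max (1 + x ^+ 2) (1 + y ^+ 2) by rewrite le_max lexx orbT.
  nra.
have max0 : 0 <= Num.max (japanese m) (japanese n) :> R by rewrite le_max (ltW jm).
apply: (@le_trans _ _ ((4 * Num.max (japanese m) (japanese n)) `^ r)).
  by apply: ge0_ler_powR => //; rewrite nnegrE ?mulr_ge0// ltW.
rewrite powRM// ler_wpM2l ?powR_ge0//.
by case: (leP (@japanese R m) (japanese n)) => _; rewrite ?lerDl ?lerDr ?powR_ge0.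
Qed.

Definition wampl r f n : R := japanese n `^ (r / 2) * ampl f n.

Lemma wampl_ge0 r f n : 0 <= wampl r f n.
Proof. by rewrite mulr_ge0 ?powR_ge0 ?ampl_ge0. Qed.

Lemma wampl_sqr r f n : wampl r f n ^+ 2 = sob_term r f n.
Proof.
rewrite exprMn sob_termE; congr (_ * _).
by rewrite -powR_mulrn ?powR_ge0// -powRrM; congr (_ `^ _); field.
Qed.

Lemma ampl_fpartM f g N n : continuous g -> ampl (fun x => fpart f N x * g x) n <=
  2 * (\sum_(m <- irange N) ampl f m * ampl g (n + m) +
       \sum_(m <- irange N) ampl f m * ampl g (n - m)).
Proof.
move=> cg.
have key (a b x y z t : R) m k l : `|a| <= ampl f m -> `|b| <= ampl f m ->
    `|x| <= ampl g k -> `|y| <= ampl g l -> `|z| <= ampl g k -> `|t| <= ampl g l ->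
    `|a * (x + y) + b * (z + t)| <= 2 * (ampl f m * ampl g k + ampl f m * ampl g l).
  move=> ha hb hx hy hz ht.
  rewrite (le_trans (ler_normD _ _))// mulr_natl mulr2n lerD// normrM -mulrDr ler_pM//.
    by rewrite (le_trans (ler_normD _ _))// lerD.
  by rewrite (le_trans (ler_normD _ _))// lerD.
have h0 : `|2^-1 : R| = 2^-1 by rewrite ger0_norm.
apply: le_trans (ampl_le _ _) _; rewrite mulr_natl mulr2n; apply: lerD.
  rewrite fcos_fpartM// normrM h0 mulrC ler_pdivrMr// mulrC -big_split/= mulr_sumr.
  apply: le_trans (ler_norm_sum _ _ _) _; apply: ler_sum => m _.
  by apply: key; rewrite ?normrN ?fcos_le_ampl ?fsin_le_ampl.
rewrite fsin_fpartM// normrM h0 mulrC ler_pdivrMr// mulrC -big_split/= mulr_sumr.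
apply: le_trans (ler_norm_sum _ _ _) _; apply: ler_sum => m _.
rewrite (addrC (fcos g (n - m))).
by apply: key; rewrite ?normrN ?fcos_le_ampl ?fsin_le_ampl.
Qed.

Let wampl_conv r f g (Y : seq int) n (k : int -> int) : 0 <= r ->
  (forall m, japanese n `^ (r / 2) <=
    4 `^ (r / 2) * (japanese m `^ (r / 2) + japanese (k m) `^ (r / 2)) :> R) ->
  japanese n `^ (r / 2) * \sum_(m <- Y) ampl f m * ampl g (k m) <=
  4 `^ (r / 2) * (\sum_(m <- Y) wampl r f m * ampl g (k m) +
                  \sum_(m <- Y) ampl f m * wampl r g (k m)).
Proof.
move=> r0 h; rewrite -big_split/= !mulr_sumr; apply: ler_sum => m _.
rewrite /wampl.
have -> : 4 `^ (r / 2) * (japanese m `^ (r / 2) * ampl f m * ampl g (k m) +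
   ampl f m * (japanese (k m) `^ (r / 2) * ampl g (k m))) =
   4 `^ (r / 2) * (japanese m `^ (r / 2) + japanese (k m) `^ (r / 2)) *
   (ampl f m * ampl g (k m)) by ring.
by apply: ler_wpM2r; rewrite ?mulr_ge0 ?ampl_ge0.
Qed.

Let japaneseN n : japanese (- n) = japanese n :> R.
Proof. by rewrite /japanese intrN sqrrN. Qed.

(** On the Fourier side the product is a convolution. Once the weight is distributed, each of four
    pieces pairs a weighted $\ell^2$ sequence with an $\ell^1$ one, as Young's inequality requires.
    Truncating [f] keeps the sums finite, and [Hle_lim] removes the truncation. *)
Lemma HleM r : 1 / 2 < r -> exists2 C, 1 <= C & forall f g A B,
  Hle r f A -> Hle r g B -> Hle r (fun x => f x * g x) (C * A * B).
Proof.
move=> r2; have r0 : 0 <= r by lra.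
have [C C0 CH] := @Hle_ampl_l1 R r r2; have [D D0 DH] := @Hle_sup R r r2.
pose K : R := 4 `^ (r / 2); have K0 : 0 <= K by exact: powR_ge0.
(* The square of the factor [2 * K] in [Q0], a factor 4 from squaring a sum of four terms, and four
   equal Young bounds $(CAB)^2$ multiply to $(8KCAB)^2$. The summand 1 makes the constant at least
   1. *)
exists (8 * K * C + 1) => [|f g A B fA gB].
  by rewrite lerDr !mulr_ge0// ltW.
have [A0 pf cf sA] := fA; have [B0 pg cg sB] := gB.
have AB : 8 * K * (C * A * B) <= (8 * K * C + 1) * A * B.
  rewrite -subr_ge0 [X in 0 <= X](_ : _ = A * B); last by ring.
  exact: mulr_ge0.
apply: (Hle_mono AB).
apply: (@Hle_lim _ _ (fun N x => fpart f N x * g x)); last first.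
  by apply: ucvgMr (Hle_ucvg_fpart r2 fA); exact: DH gB.
move=> N; split.
- by rewrite !mulr_ge0// ltW.
- by move=> x; rewrite fpartD1 pg.
- by apply: continuousMf => //; exact: fpart_continuous.
move=> X uX; set Y := irange N; have uY : uniq Y := irange_uniq N.
pose Q1 n := \sum_(m <- Y) wampl r f m * ampl g (n + m).
pose Q2 n := \sum_(m <- Y) ampl f m * wampl r g (n + m).
pose Q3 n := \sum_(m <- Y) wampl r f m * ampl g (n - m).
pose Q4 n := \sum_(m <- Y) ampl f m * wampl r g (n - m).
have wA : sums_le (fun n => wampl r f n ^+ 2) (A ^+ 2).
  by apply: sums_le_mono sA => n; rewrite wampl_sqr.
have wB : sums_le (fun n => wampl r g n ^+ 2) (B ^+ 2).
  by apply: sums_le_mono sB => n; rewrite wampl_sqr.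
have i1 n : injective (fun m => n + m) by exact: addrI.
have i2 m : injective (fun n => n + m) by exact: addIr.
have i3 n : injective (fun m => n - m) by move=> x y /addrI /oppr_inj.
have i4 m : injective (fun n => n - m) by exact: addIr.
have f0 := @ampl_ge0 R f; have g0 := @ampl_ge0 R g.
have S1 : \sum_(n <- X) Q1 n ^+ 2 <= (C * B) ^+ 2 * A ^+ 2.
  exact: (young_sqr_l1 i1 i2 g0 uY wA (CH _ _ gB)).
have S3 : \sum_(n <- X) Q3 n ^+ 2 <= (C * B) ^+ 2 * A ^+ 2.
  exact: (young_sqr_l1 i3 i4 g0 uY wA (CH _ _ gB)).
have S2 : \sum_(n <- X) Q2 n ^+ 2 <= (C * A) ^+ 2 * B ^+ 2.
  exact: (young_l1_sqr i2 f0 uY (CH _ _ fA) wB).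
have S4 : \sum_(n <- X) Q4 n ^+ 2 <= (C * A) ^+ 2 * B ^+ 2.
  exact: (young_l1_sqr i4 f0 uY (CH _ _ fA) wB).
apply: (@le_trans _ _ (\sum_(n <- X) (16 * K ^+ 2) *
   (Q1 n ^+ 2 + Q2 n ^+ 2 + Q3 n ^+ 2 + Q4 n ^+ 2))); last first.
  rewrite -mulr_sumr !big_split/=.
  have -> : (8 * K * (C * A * B)) ^+ 2 = 16 * K ^+ 2 * ((C * B) ^+ 2 * A ^+ 2 +
    (C * A) ^+ 2 * B ^+ 2 + (C * B) ^+ 2 * A ^+ 2 + (C * A) ^+ 2 * B ^+ 2) by ring.
  by rewrite ler_wpM2l ?mulr_ge0 ?sqr_ge0// !lerD.
apply: ler_sum => n _; rewrite -wampl_sqr.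
have Q0 : wampl r (fun x => fpart f N x * g x) n <= 2 * K * (Q1 n + Q2 n + (Q3 n + Q4 n)).
  rewrite /wampl; apply: le_trans (ler_wpM2l (powR_ge0 _ _) (ampl_fpartM f N n cg)) _.
  rewrite mulrCA -[2 * K * _]mulrA ler_wpM2l// mulrDr [leRHS]mulrDr lerD//.
    (* Here $n=(n+m)-m$; the minus sign is absorbed because the weight is even. *)
    apply: wampl_conv => // m; rewrite -{1}[n](addrK m) addrC -japaneseN.
    rewrite -(@japaneseN m).
    have -> : - (- m + (n + m)) = (m - (n + m)) by rewrite opprD opprK.
    by rewrite -(japaneseN (n + m)) japaneseN; apply: japanese_peetre; rewrite divr_ge0.
  apply: wampl_conv => // m; rewrite -{1}[n](subrK m) addrC.
  by apply: japanese_peetre; rewrite divr_ge0.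
have Qp : 0 <= 2 * K * (Q1 n + Q2 n + (Q3 n + Q4 n)).
  by apply: le_trans Q0; exact: wampl_ge0.
apply: (@le_trans _ _ ((2 * K * (Q1 n + Q2 n + (Q3 n + Q4 n))) ^+ 2)).
  by rewrite ler_sqr ?nnegrE// wampl_ge0.
have -> : (2 * K * (Q1 n + Q2 n + (Q3 n + Q4 n))) ^+ 2 =
  4 * K ^+ 2 * (Q1 n + Q2 n + (Q3 n + Q4 n)) ^+ 2 by ring.
have -> : 16 * K ^+ 2 * (Q1 n ^+ 2 + Q2 n ^+ 2 + Q3 n ^+ 2 + Q4 n ^+ 2) =
  4 * K ^+ 2 * (4 * (Q1 n ^+ 2 + Q2 n ^+ 2 + Q3 n ^+ 2 + Q4 n ^+ 2)) by ring.
apply: ler_wpM2l; first by rewrite mulr_ge0 ?sqr_ge0.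
move: (Q1 n) (Q2 n) (Q3 n) (Q4 n) => x y z t.
rewrite -subr_ge0 [X in 0 <= X](_ : _ = (x - y) ^+ 2 + (x - z) ^+ 2 + (x - t) ^+ 2
  + (y - z) ^+ 2 + (y - t) ^+ 2 + (z - t) ^+ 2); last by ring.
by rewrite !addr_ge0 ?sqr_ge0.
Qed.

(* The iteration u = 1 - q u converges uniformly to 1 / (1 + q) inside a fixed ball. *)
Lemma Hle_inv r : 1 / 2 < r -> exists2 d, 0 < d & forall q A, Hle r q A -> A <= d ->
  (forall x, `|q x| <= 1 / 2) /\ Hle r (fun x => (1 + q x)^-1) 2.
Proof.
move=> r2; have [C C1 CH] := HleM r2; have [D D0 DH] := @Hle_sup R r r2.
have C0 : 0 < C by rewrite (lt_le_trans ltr01).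
(* The first bound gives $1+2CA\le2$, so the iteration stays in the ball of radius 2 of $H^r$; the
   second gives $|q|\le1/2$ pointwise, so it converges uniformly. *)
exists (Num.min (2 * C)^-1 (2 * D)^-1) => [|q A qA].
  by rewrite lt_min !invr_gt0 !mulr_gt0.
rewrite le_min => /andP[AC AD].
have {}AC : C * A <= 1 / 2.
  by rewrite -ler_pdivlMl// mul1r mulrC -invfM.
have {}AD : D * A <= 1 / 2.
  by rewrite -ler_pdivlMl// mul1r mulrC -invfM.
have q2 x : `|q x| <= 1 / 2 by apply: le_trans (DH _ _ qA x) AD.
have q1 x : 1 / 2 <= 1 + q x.
  by have := q2 x; rewrite ler_norml => /andP[]; lra.
have q0 x : 1 + q x != 0 by rewrite gt_eqF// (lt_le_trans _ (q1 x)).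
split => //.
pose u := fix u N := if N is M.+1 then (fun x => 1 - q x * u M x) else (fun=> 0 : R).
apply: (@Hle_lim _ _ u) => [N|].
  elim: N => [|N IH].
    by apply: Hle_mono (Hle_cst r 0); rewrite normr0.
  apply: (@Hle_mono _ _ _ (1 + C * A * 2)); first lra.
  by apply: HleB; [exact: Hle1|exact: CH].
have err N x : `|(1 + q x)^-1 - u N x| <= 2 * 2^-1 ^+ N.
  elim: N => [|N IH].
    rewrite subr0 mulr1 ger0_norm ?invr_ge0; last by rewrite (le_trans _ (q1 x)).
    rewrite -[leRHS]invrK lef_pV2 ?posrE//; last by rewrite (lt_le_trans _ (q1 x)).
    by rewrite -[2^-1]mul1r.
  have -> : (1 + q x)^-1 - u N.+1 x = - q x * ((1 + q x)^-1 - u N x).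
    by rewrite /=; field; exact: q0.
  rewrite normrM normrN exprS mulrCA ler_pM//.
  by rewrite -[2^-1]mul1r.
move=> e e0.
have h : 2 * 2^-1 ^+ N @[N --> \oo] --> (2 * 0 : R).
  apply: cvgM; first exact: cvg_cst.
  by apply: cvg_expr; rewrite ger0_norm// invf_lt1// ltr1n.
rewrite mulr0 in h; move/cvgr0Pnorm_le : h => /(_ e e0).
apply: filterS => N h x; apply: le_trans (err N x) _.
by apply: le_trans h; rewrite ler_norm.
Qed.

End SobolevAlgebra.

(** * The Christoffel map away from the identity *)

Section ChangeOfVariable.
Context {R : realType}.
Implicit Types (f g F G : R -> R).

(** One of the two integrations in $A^{-1}$ cancels the derivative; the boundary value [g 0] occurs
    in both terms and drops out. *)
Lemma Ainv_derive1 g g' : continuous g' -> (forall x, is_derive x (1 : R) g (g' x)) ->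
  Ainv (derive1 g) = fun x => - prim g x + x * circle_int g.
Proof.
move=> cg' dg; rewrite (is_derive_derive1 dg); have cg := is_derive_continuous dg.
have pg : prim g' = fun y => 1 * g y + (- g 0) * 1.
  by apply/funext => y; rewrite (prim_FTC y cg' dg); ring.
apply/funext => x; rewrite /Ainv pg prim_lin//; last exact: continuous_cstf.
rewrite prim_cst circle_intDf; last 2 first.
- by apply: continuousMf => //; exact: continuous_cstf.
- exact: continuous_cstf.
by rewrite circle_intZ// circle_int_cst; ring.
Qed.

Variables (phi j j' : R -> R).
Hypotheses (dphi : forall x, is_derive x (1 : R) phi (j x))
  (dj : forall x, is_derive x (1 : R) j (j' x)) (cj' : continuous j')
  (j_ge : forall x, 1 / 2 <= j x) (phi0 : phi 0 = 0) (phi1 : phi 1 = 1).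
Notation psi := (pinv setT phi).

Let cj : continuous j := is_derive_continuous dj.
Let cphi : continuous phi := is_derive_continuous dphi.

Let j0 x : j x != 0.
Proof. by rewrite gt_eqF// (lt_le_trans _ (j_ge x)). Qed.

(** This lower bound yields both halves of bijectivity: injectivity at once, and surjectivity
    because [phi] is unbounded on either side. *)
Let phi_expand a b : a < b -> (b - a) / 2 <= phi b - phi a.
Proof.
move=> ab; have [|c _ ->] := @MVT R phi j a b ab (fun x _ => dphi x).
  exact: continuous_subspaceT.
by rewrite mulrC -[2^-1]mul1r ler_wpM2r// subr_ge0 ltW.
Qed.

Let phiK : cancel phi psi.
Proof.
move=> x; apply: pinvKV; rewrite ?inE// => a b _ _ ab.
have [h|h|//] := ltgtP a b; have := phi_expand h; rewrite ab subrr.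
  by rewrite pmulr_lle0 ?invr_gt0// subr_le0 leNgt h.
by rewrite pmulr_lle0 ?invr_gt0// subr_le0 leNgt h.
Qed.

Let phi_surj y : exists x, phi x = y.
Proof.
(* Since [phi] expands by at least 1/2, its values at [b] and [- b] enclose [y]. *)
pose b := 2 * `|y| + 1; have y0 : 0 <= `|y| by [].
have b0 : 0 < b by rewrite ltr_wpDl// mulr_ge0.
have bN : - b < 0 by rewrite oppr_lt0.
have h1 := phi_expand b0; have h2 := phi_expand bN.
rewrite phi0 in h1 h2; have := ler_norm y; have := ler_norm (- y); rewrite normrN => y1 y2.
have ab : - b <= b by lra.
have [|//|x _ <-] := @IVT R phi (- b) b y ab; last by exists x.
  exact: continuous_subspaceT.
by rewrite ge_min le_max; apply/andP; split; apply/orP; [left|right]; rewrite /b in h1 h2; lra.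
Qed.

Let psiK : cancel psi phi.
Proof. by move=> y; have [x <-] := phi_surj y; rewrite phiK. Qed.

Let dpsi y : is_derive y (1 : R) psi (j (psi y))^-1.
Proof.
rewrite -{1}(psiK y); apply: is_derive_inverse => //.
- by near=> z; exact: phiK.
- by near=> z; exact: cphi.
Unshelve. all: by end_near. Qed.

Let cpsi : continuous psi := is_derive_continuous dpsi.

Let dcomp F F' y : is_derive (psi y) (1 : R) F (F' (psi y)) ->
  is_derive y (1 : R) (F \o psi) (F' (psi y) / j (psi y)).
Proof. by move=> dF; apply: is_derive1_comp. Qed.

Let continuous_psi F : continuous F -> continuous (F \o psi).
Proof. by move=> cF x; apply: continuous_comp; [exact: cpsi|exact: cF]. Qed.

Lemma prim_subst F x : continuous F ->
  prim (F \o psi) (phi x) = prim (fun y => F y * j y) x.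
Proof.
move=> cF.
have d y : is_derive y (1 : R) (prim (F \o psi) \o phi) (F y * j y).
  have h := is_derive_prim (phi y) (continuous_psi cF).
  by have := is_derive1_comp h (dphi y); rewrite /= phiK.
have cFj : continuous (fun y => F y * j y) by exact: continuousMf.
by rewrite (prim_FTC x cFj d) /= phi0 prim0 subr0.
Qed.

Lemma circle_int_subst F : continuous F ->
  circle_int (F \o psi) = circle_int (fun y => F y * j y).
Proof. by move=> cF; rewrite !circle_int_prim -prim_subst// phi1. Qed.

Lemma derive1_subst F F' : (forall x, is_derive x (1 : R) F (F' x)) ->
  derive1 (F \o psi) = (fun x => F' x / j x) \o psi.
Proof. by move=> dF; apply: is_derive_derive1 => y; exact: dcomp. Qed.

Lemma cproj_subst F : continuous F ->
  cproj (F \o psi) = (fun x => F x - circle_int (fun y => F y * j y)) \o psi.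
Proof. by move=> cF; apply/funext => y; rewrite /cproj circle_int_subst. Qed.

Variables (U1 U2 V1 V2 a b a' b' U2' V2' : R -> R).
Hypotheses (dU1 : forall x, is_derive x (1 : R) U1 (a x))
  (dV1 : forall x, is_derive x (1 : R) V1 (b x))
  (da : forall x, is_derive x (1 : R) a (a' x))
  (db : forall x, is_derive x (1 : R) b (b' x))
  (dU2 : forall x, is_derive x (1 : R) U2 (U2' x))
  (dV2 : forall x, is_derive x (1 : R) V2 (V2' x))
  (ca' : continuous a') (cb' : continuous b')
  (cU2' : continuous U2') (cV2' : continuous V2').

Let pU x := U2 x - circle_int (fun y => U2 y * j y).
Let pV x := V2 x - circle_int (fun y => V2 y * j y).
Let G x := a x * b x / j x + pU x * pV x * j x.

Let cU2 : continuous U2 := is_derive_continuous dU2.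
Let cV2 : continuous V2 := is_derive_continuous dV2.

Lemma Gamma2_subst : Gamma2 (U1 \o psi) (U2 \o psi) (V1 \o psi) (V2 \o psi) \o phi =
  fun x => - (1 / 2) * (a x / j x * pV x + b x / j x * pU x).
Proof.
apply/funext => x; rewrite /Gamma2/= (derive1_subst dU1) (derive1_subst dV1).
by rewrite !cproj_subst//= phiK.
Qed.

Let is_deriveV_fun F F' x : is_derive x (1 : R) F (F' x) -> F x != 0 ->
  is_derive x (1 : R) (fun y => (F y)^-1) (- (F x) ^- 2 * F' x).
Proof. by move=> dF F0; have := is_deriveV F0 dF. Qed.

Lemma Gamma1_subst : Gamma1 (U1 \o psi) (U2 \o psi) (V1 \o psi) (V2 \o psi) \o phi =
  fun x => 1 / 2 * (prim G x - phi x * circle_int G).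
Proof.
have ca := is_derive_continuous da; have cb := is_derive_continuous db.
have cpU : continuous pU by apply: continuousBf => //; exact: continuous_cstf.
have cpV : continuous pV by apply: continuousBf => //; exact: continuous_cstf.
have cV : continuous (fun x => (j x)^-1) by exact: continuousVf.
(* The function differentiated in [Gamma1], pulled back by [phi]; times the Jacobian [j] it becomes
   [G]. *)
pose G0 x := a x / j x * (b x / j x) + pU x * pV x.
have cG0 : continuous G0.
  by apply: continuousDf; apply: continuousMf => //; exact: continuousMf.
(* [Gamma1] differentiates [G0] composed with [psi], so [G0] has to be $C^1$, even though
   [Ainv_derive1] then removes that derivative. *)
have [G0' cG0' dG0] : exists2 G0', continuous G0' &
    forall x, is_derive x (1 : R) G0 (G0' x).
  have dc (c : R -> R) (c' : R -> R) x : is_derive x (1 : R) c (c' x) ->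
      is_derive x (1 : R) (fun x => c x / j x) (c' x * (j x)^-1 + c x * (- (j x) ^- 2 * j' x)).
    by move=> h; apply: is_deriveMf => //; exact: is_deriveV_fun.
  have cjj : continuous (fun x => - (j x) ^- 2 * j' x).
    apply: continuousMf => //; apply: continuousNf.
    apply: continuousVf => [|x]; last by rewrite expf_neq0.
    under eq_fun do rewrite expr2; exact: continuousMf.
  have cc (c c' : R -> R) : continuous c -> continuous c' ->
      continuous (fun x => c' x * (j x)^-1 + c x * (- (j x) ^- 2 * j' x)).
    by move=> ? ?; apply: continuousDf; exact: continuousMf.
  have dp (F F' : R -> R) (k : R) x : is_derive x (1 : R) F (F' x) ->
      is_derive x (1 : R) (fun x => F x - k) (F' x).
    by move=> h; rewrite -[F' x]subr0; apply: is_deriveB.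
  pose A' x := a' x * (j x)^-1 + a x * (- (j x) ^- 2 * j' x).
  pose B' x := b' x * (j x)^-1 + b x * (- (j x) ^- 2 * j' x).
  exists (fun x => (A' x * (b x / j x) + a x / j x * B' x) +
    (U2' x * pV x + pU x * V2' x)).
    have cA' := cc _ _ ca ca'; have cB' := cc _ _ cb cb'.
    by apply: continuousDf; apply: continuousDf; apply: continuousMf => //; exact: continuousMf.
  move=> x; apply: is_deriveD; apply: is_deriveMf; try exact: dc; exact: dp.
have GE : (fun y => G0 y * j y) = G.
  by apply/funext => y; rewrite /G /G0; field; exact: j0.
have dg y : is_derive y (1 : R) (G0 \o psi) (G0' (psi y) / j (psi y)).
  exact: dcomp.
have cg : continuous (fun y => G0' (psi y) / j (psi y)).
  exact: (@continuous_psi (fun z => G0' z / j z) (continuousMf cG0' cV)).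
apply/funext => x; rewrite /Gamma1/=.
rewrite (_ : (fun y => _) = G0 \o psi); last first.
  apply/funext => y; rewrite (derive1_subst dU1) (derive1_subst dV1).
  by rewrite !cproj_subst.
rewrite (Ainv_derive1 cg dg) prim_subst// circle_int_subst// GE; ring.
Qed.

End ChangeOfVariable.

(** * Tangent vectors *)

Section TangentSpace.
Context {R : realType}.
Implicit Types (f g h : R -> R) (r s A : R).

Lemma toHs0E s f A : Hle s f A -> f 0 = 0 -> toHs0 s f = f :> (R -> R).
Proof.
move=> fA f0; have fE := toHsE fA.
by rewrite /toHs0 val_insubd inE fE f0 eqxx fE.
Qed.

Lemma toHs0_norm s f A : Hle s f A -> f 0 = 0 -> `|toHs0 s f| <= A.
Proof.
move=> fA f0; rewrite [`|_|]/(Hs0_norm _) /Hs0_norm /toHs0 val_insubd.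
by rewrite inE (toHsE fA) f0 eqxx; exact: toHs_norm fA.
Qed.

Lemma Hs0_eq s (u v : Hs0 s) : (forall x, u x = v x) -> u = v.
Proof. by move=> uv; apply/val_inj/val_inj/funext. Qed.

Lemma Hle_Hs0 s (u : Hs0 s) : Hle s u `|u|.
Proof. exact: Hle_Hs. Qed.

Lemma Hs0_at0 s (u : Hs0 s) : u 0 = 0.
Proof. by case: u => u /= /eqP. Qed.

Definition tanP s (u : TK s) : R -> R := derive1 u.1.
Definition tanQ s (u : TK s) : R -> R := cproj (repr u.2).

Lemma cproj_cst f c : continuous f -> cproj (fun x => f x + c) = cproj f.
Proof.
move=> cf; apply/funext => x; rewrite /cproj circle_intDf//; last exact: continuous_cstf.
by rewrite circle_int_cst; ring.
Qed.

(** [repr] returns a representative known only up to a constant, and [cproj] removes that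
    constant. *)
Lemma tanQ_cls s (f : Hs0 s) (g : Hs (s - 1)) : tanQ (f, cls g) = cproj g.
Proof.
rewrite /tanQ/=; have /clsP[c gE] := cls_repr (cls g).
by rewrite (funext gE) cproj_cst//; exact: Hs_continuous.
Qed.

Lemma circle_int_cproj f : continuous f -> circle_int (cproj f) = 0.
Proof.
move=> cf; rewrite circle_intBf//; last exact: continuous_cstf.
by rewrite circle_int_cst subrr.
Qed.

End TangentSpace.

Section KGeometry.
Context {R : realType} {s : R}.
Hypothesis hs : 5 / 2 < s.
Notation r := (s - 1).
Implicit Types (u v w U V X Y : TK s) (f g h : R -> R).

Let r3 : 3 / 2 < r. Proof. rewrite ltrBrDr; have := hs; lra. Qed.
Let s3 : 3 / 2 < s. Proof. by apply: lt_trans hs; lra. Qed.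
Lemma is_derive_Hs0 (h : Hs0 s) x : is_derive x (1 : R) h (derive1 h x).
Proof. exact: Hle_is_derive s3 (Hle_Hs0 h) x. Qed.

Lemma is_derive_HsR (b : HsR r) x :
  is_derive x (1 : R) (repr b) (derive1 (repr b) x).
Proof. exact: Hle_is_derive r3 (Hle_Hs (repr b)) x. Qed.

Lemma tanP_Hle u : Hle r (tanP u) (2 * pi * `|u.1|).
Proof. exact: Hle_derive1 s3 (Hle_Hs0 u.1). Qed.

Lemma tanQ_Hle u : exists A, Hle r (tanQ u) A.
Proof. by eexists; apply: HleB; [exact: Hle_Hs|exact: Hle_cst]. Qed.

Lemma continuous_tanP u : continuous (tanP u).
Proof. by have [] := tanP_Hle u. Qed.

Lemma continuous_tanQ u : continuous (tanQ u).
Proof. by have [A []] := tanQ_Hle u. Qed.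

Lemma circle_int_tanP u : circle_int (tanP u) = 0.
Proof.
rewrite (circle_int_FTC (@continuous_tanP u) (is_derive_Hs0 u.1)).
by rewrite -[X in _ X - _]add0r Hs_periodic subrr.
Qed.

Lemma circle_int_tanQ u : circle_int (tanQ u) = 0.
Proof. by rewrite circle_int_cproj//; exact: Hs_continuous. Qed.

Lemma tanP_lin a u v : tanP (a *: u + v) = fun x => a * tanP u x + tanP v x.
Proof.
apply: is_derive_derive1 => x.
exact: is_deriveD (is_deriveZ a (is_derive_Hs0 u.1 x)) (is_derive_Hs0 v.1 x).
Qed.

Lemma tanQ_lin a u v : tanQ (a *: u + v) = fun x => a * tanQ u x + tanQ v x.
Proof.
have e : (a *: u + v).2 = cls (a *: repr u.2 + repr v.2).
  by rewrite clsD clsZ !cls_repr.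
have -> : tanQ (a *: u + v) = cproj (a *: repr u.2 + repr v.2 : Hs r).
  by rewrite -(tanQ_cls 0) -e.
apply/funext => x; rewrite /tanQ /cproj.
have cu := @Hs_continuous _ _ (repr u.2); have cv := @Hs_continuous _ _ (repr v.2).
rewrite -[circle_int (a *: _ + _)]/(circle_int (fun x => a * repr u.2 x + repr v.2 x)).
rewrite circle_intDf//; last by apply: continuousMf => //; exact: continuous_cstf.
rewrite circle_intZ// -[(_ + _ : Hs r) x]/(a * repr u.2 x + repr v.2 x); ring.
Qed.

End KGeometry.

(** * Orders of vanishing in Sobolev norm *)

Section BigO.
Context {R : realType} {s : R}.
Implicit Types (F G : TK s -> R -> R) (q : R) (k l : nat).

(* F(n) = O(|n|^k) in H^q as n -> 0, for a map F defined on all of T_e K^s. *)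
Definition bigOH q k F := exists K d, [/\ 0 <= K, 0 < d &
  forall n : TK s, `|n| <= d -> Hle q (F n) (K * `|n| ^+ k)].

Lemma bigOH_eq q k F G : (exists2 d, 0 < d & forall n : TK s, `|n| <= d -> F n = G n) ->
  bigOH q k F -> bigOH q k G.
Proof.
move=> [e e0 FG] [K [d [K0 d0 H]]]; exists K, (Num.min d e); split => //.
  by rewrite lt_min d0.
by move=> n; rewrite le_min => /andP[/H + /FG <-].
Qed.

Lemma bigOHD q k F G : bigOH q k F -> bigOH q k G ->
  bigOH q k (fun n x => F n x + G n x).
Proof.
move=> [K [d [K0 d0 H]]] [L [e [L0 e0 I]]]; exists (K + L), (Num.min d e).
split; [exact: addr_ge0|by rewrite lt_min d0|].
by move=> n; rewrite le_min mulrDl => /andP[/H h /I i]; exact: HleD.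
Qed.

Lemma bigOHZ q k F (c : R) : bigOH q k F -> bigOH q k (fun n x => c * F n x).
Proof.
move=> [K [d [K0 d0 H]]]; exists (`|c| * K), d; split => //; first exact: mulr_ge0.
by move=> n /H h; rewrite -mulrA; exact: HleZ.
Qed.

Lemma bigOHN q k F : bigOH q k F -> bigOH q k (fun n x => - F n x).
Proof.
move=> /(bigOHZ (-1)); apply: bigOH_eq; exists 1 => // n _.
by apply/funext => x; rewrite mulN1r.
Qed.

Lemma bigOHB q k F G : bigOH q k F -> bigOH q k G ->
  bigOH q k (fun n x => F n x - G n x).
Proof. by move=> FO GO; apply: bigOHD => //; exact: bigOHN. Qed.

Lemma bigOHM q k l F G : 1 / 2 < q -> bigOH q k F -> bigOH q l G ->
  bigOH q (k + l) (fun n x => F n x * G n x).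
Proof.
move=> /HleM[C C1 CH] [K [d [K0 d0 H]]] [L [e [L0 e0 I]]].
have C0 : 0 <= C by rewrite (le_trans ler01).
exists (C * K * L), (Num.min d e).
split; [by rewrite !mulr_ge0|by rewrite lt_min d0|].
move=> n; rewrite le_min => /andP[/H h /I i]; have := CH _ _ _ _ h i.
by congr Hle; rewrite exprD; ring.
Qed.

Lemma bigOH_mean q q' k F : bigOH q k F -> bigOH q' k (fun n _ => circle_int (F n)).
Proof.
move=> [K [d [K0 d0 H]]]; exists K, d; split => // n /H h.
by apply: Hle_mono (Hle_cst q' _); exact: Hle_mean h.
Qed.

Lemma bigOH_cst q f A : Hle q f A -> bigOH q 0 (fun=> f).
Proof.
move=> fA; have [A0 _ _ _] := fA; exists A, 1; split => // n _.
by rewrite expr0 mulr1.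
Qed.

Lemma bigOH_weaken q k l F : (l <= k)%N -> bigOH q k F -> bigOH q l F.
Proof.
move=> lk [K [d [K0 d0 H]]]; exists K, (Num.min d 1); split => //.
  by rewrite lt_min d0 ltr01.
move=> n; rewrite le_min => /andP[/H h n1]; apply: Hle_mono h.
by apply: ler_wpM2l => //; apply: ler_wiXn2l.
Qed.

Lemma bigOH_prim q k F : 1 / 2 < q -> bigOH q k F ->
  bigOH (q + 1) k (fun n x => prim (F n) x - x * circle_int (F n)).
Proof.
move=> /Hle_prim[C C0 CH] [K [d [K0 d0 H]]]; exists (C * K), d.
split => //; first by rewrite mulr_ge0// ltW.
by move=> n /H /CH; rewrite mulrA.
Qed.

Lemma bigOH_inv q F : 1 / 2 < q -> bigOH q 1 F ->
  bigOH q 0 (fun n x => (1 + F n x)^-1) /\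
  exists2 d, 0 < d & forall n : TK s, `|n| <= d -> forall x, `|F n x| <= 1 / 2.
Proof.
move=> /Hle_inv[c c0 cH] [K [d [K0 d0 H]]].
have K1 : 0 < K + 1 by rewrite ltr_wpDl.
pose e := Num.min d (c / (K + 1)).
have e0 : 0 < e by rewrite lt_min d0 divr_gt0.
have key (n : TK s) : `|n| <= e ->
    (forall x, `|F n x| <= 1 / 2) /\ Hle q (fun x => (1 + F n x)^-1) 2.
  rewrite le_min => /andP[/H h nc]; apply: cH h _.
  rewrite expr1; apply: (@le_trans _ _ ((K + 1) * `|n|)).
    by rewrite ler_wpM2r// lerDl.
  by rewrite mulrC -ler_pdivlMr.
split; last by exists e => // n /key[].
by exists 2, e; split => // n /key[_]; rewrite expr0 mulr1.
Qed.

(** Homogeneity scales any [n] into the ball where the bound is known, and back. The 1 added to the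
    norm in [t] covers [n = 0]. *)
Lemma bigOH_linear q F : (forall (t : R) n x, F (t *: n) x = t * F n x) ->
  bigOH q 1 F -> exists2 K, 0 <= K & forall n, Hle q (F n) (K * `|n|).
Proof.
move=> Flin [K [d [K0 d0 H]]]; exists K => // n.
have n1 : 0 < `|n| + 1 by rewrite ltr_wpDl.
pose t := d / (`|n| + 1); have t0 : 0 < t by rewrite divr_gt0.
have tn : `|t *: n| <= d.
  rewrite normrZ gtr0_norm// /t mulrAC ler_pdivrMr// ler_wpM2l ?lerDl//.
  exact: ltW.
have := HleZ t^-1 (H _ tn); rewrite expr1 normrZ normfV (gtr0_norm t0).
have -> : t^-1 * (K * (t * `|n|)) = K * `|n| by field; rewrite gt_eqF.
by congr Hle; apply/funext => x; rewrite Flin mulKf// gt_eqF.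
Qed.

End BigO.

(** * Closed form of the Christoffel map near the identity *)

Section KGammaExplicit.
Context {R : realType} {s : R}.
Hypothesis hs : 5 / 2 < s.
Notation r := (s - 1).
Implicit Types (u v w U V X Y n : TK s) (f g h : R -> R).

Let r3 : 3 / 2 < r. Proof. rewrite ltrBrDr; have := hs; lra. Qed.
Let r2 : 1 / 2 < r. Proof. by apply: lt_trans r3; lra. Qed.

(** The projection $\pi(X_2)$ at a diffeomorphism with $\varphi_x=1+h$: when [h] has mean 0, passing
    from the projection at the identity changes it only by the mean of [tanQ X] against [h]. *)
Definition twistQ (h : R -> R) X x : R :=
  tanQ X x - circle_int (fun y => tanQ X y * h y).

Definition gamG (h : R -> R) X Y x : R :=
  tanP X x * tanP Y x * (1 + h x)^-1 + twistQ h X x * twistQ h Y x * (1 + h x).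

(** The term $\varphi\int G$ is split as $x\int G+n_1\int G$, so that the primitive and its linear
    correction form the periodic function bounded by [Hle_prim]. *)
Definition gam1 n X Y x : R :=
  1 / 2 * (prim (gamG (tanP n) X Y) x - x * circle_int (gamG (tanP n) X Y)
           - n.1 x * circle_int (gamG (tanP n) X Y)).

Definition gam2 n X Y x : R := - (1 / 2) *
  (tanP X x * (1 + tanP n x)^-1 * twistQ (tanP n) Y x +
   tanP Y x * (1 + tanP n x)^-1 * twistQ (tanP n) X x).

(* Gamma_m(X, Y) at m = (id + n_1, [n_2]). *)
Definition gam n X Y : TK s := (toHs0 s (gam1 n X Y), cls (toHs r (gam2 n X Y))).

Lemma Kgamma_gam (m : Ks s) n X Y : Kh m = n.1 -> (forall x, `|tanP n x| <= 1 / 2) ->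
  Kgamma m X Y = gam n X Y.
Proof.
move=> mn n2.
have phiE : Kphi m = fun x => x + n.1 x by rewrite /Kphi mn.
have [k' ck' dk] := Hle_C1 r3 (tanP_Hle hs n).
have cP := @continuous_tanP R s hs n.
have dphi x : is_derive x (1 : R) (fun x => x + n.1 x) (1 + tanP n x).
  by apply: is_deriveD; exact: is_derive_Hs0.
have dj x : is_derive x (1 : R) (fun x => 1 + tanP n x) (k' x).
  by rewrite -[k' x]add0r; apply: is_deriveD.
have j2 x : 1 / 2 <= 1 + tanP n x by have := n2 x; rewrite ler_norml => /andP[]; lra.
have n0 : n.1 0 = 0 := Hs0_at0 _.
have n1 : n.1 1 = 0 by have := Hs_periodic n.1 0; rewrite add0r n0.
have phi0 : 0 + n.1 0 = 0 by rewrite n0 addr0.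
have phi1 : 1 + n.1 1 = 1 by rewrite n1 addr0.
have qE (Z : TK s) x : twistQ (tanP n) Z x =
    repr Z.2 x - circle_int (fun y => repr Z.2 y * (1 + tanP n y)).
  have cZ := @Hs_continuous _ _ (repr Z.2).
  rewrite /twistQ /tanQ /cproj.
  set c := circle_int (repr Z.2).
  rewrite (_ : (fun y => repr Z.2 y * (1 + tanP n y)) =
    (fun y => repr Z.2 y + repr Z.2 y * tanP n y)); last by apply/funext => y; ring.
  rewrite (_ : (fun y => (repr Z.2 y - c) * tanP n y) =
    (fun y => repr Z.2 y * tanP n y - c * tanP n y)); last by apply/funext => y; ring.
  rewrite circle_intDf//; last exact: continuousMf.
  rewrite circle_intBf; [|exact: continuousMf|by apply: continuousMf => //; exact: continuous_cstf].
  by rewrite circle_intZ// circle_int_tanP// -/c; ring.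
have [aX caX daX] := Hle_C1 r3 (tanP_Hle hs X).
have [aY caY daY] := Hle_C1 r3 (tanP_Hle hs Y).
have [bX cbX dbX] := Hle_C1 r3 (Hle_Hs (repr X.2)).
have [bY cbY dbY] := Hle_C1 r3 (Hle_Hs (repr Y.2)).
have dX := is_derive_Hs0 hs X.1; have dY := is_derive_Hs0 hs Y.1.
have e1 := Gamma1_subst dphi dj ck' j2 phi0 phi1 dX dY daX daY dbX dbY caX caY cbX cbY.
have e2 := Gamma2_subst dphi dj j2 phi0 phi1 dX dY dbX dbY.
rewrite /Kgamma phiE e1 e2 /gam.
have -> : gam1 n X Y = fun x => 1 / 2 * (prim (fun x => tanP X x * tanP Y x / (1 + tanP n x)
    + (repr X.2 x - circle_int (fun y => repr X.2 y * (1 + tanP n y))) *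
      (repr Y.2 x - circle_int (fun y => repr Y.2 y * (1 + tanP n y))) * (1 + tanP n x)) x
    - (x + n.1 x) * circle_int (fun x => tanP X x * tanP Y x / (1 + tanP n x)
    + (repr X.2 x - circle_int (fun y => repr X.2 y * (1 + tanP n y))) *
      (repr Y.2 x - circle_int (fun y => repr Y.2 y * (1 + tanP n y))) * (1 + tanP n x))).
  apply/funext => x; rewrite /gam1.
  set G := fun x : R => _ + _; have -> : gamG (tanP n) X Y = G.
    by apply/funext => y; rewrite /gamG !qE.
  by rewrite mulrDl opprD !addrA.
have -> : gam2 n X Y = fun x => - (1 / 2) * (tanP X x / (1 + tanP n x) *
    (repr Y.2 x - circle_int (fun y => repr Y.2 y * (1 + tanP n y))) +
    tanP Y x / (1 + tanP n x) *
    (repr X.2 x - circle_int (fun y => repr X.2 y * (1 + tanP n y)))).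
  by apply/funext => x; rewrite /gam2 !qE.
by [].
Qed.

Lemma Kchart_inv_gam k : exists2 d, 0 < d & forall n X Y, `|n| <= d ->
  Kgamma (Kchart_inv k n) X Y = gam n X Y.
Proof.
have P1 : @bigOH R s r 1 (@tanP R s).
  exists (2 * pi), 1; split => //; first by rewrite mulr_ge0 ?pi_ge0.
  move=> n _; apply: Hle_mono (tanP_Hle hs n).
  by rewrite expr1 ler_wpM2l ?mulr_ge0 ?pi_ge0// prod_normE/= le_max lexx.
have [_ [d d0 dH]] := bigOH_inv r2 P1.
exists d; first exact: d0.
move=> n X Y nd; apply: (@Kgamma_gam (Kchart_inv k n) n X Y _ (dH n nd)).
(* For small [n] the derivative of [n.1] is at least -1/2, so the fallback value of [Kchart_inv]
   does not occur. *)
rewrite /Kchart_inv; case: pselect => //= -[] x.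
by have := dH n nd x; rewrite ler_norml => /andP[]; rewrite /tanP; lra.
Qed.

End KGammaExplicit.

(** * The derivative of the Christoffel map at the identity *)

Section KGammaDifferential.
Context {R : realType} {s : R}.
Hypothesis hs : 5 / 2 < s.
Notation r := (s - 1).
Variables X Y : TK s.
Implicit Types (u v w U V n : TK s) (f g h : R -> R).

Let r3 : 3 / 2 < r. Proof. rewrite ltrBrDr; have := hs; lra. Qed.
Let r2 : 1 / 2 < r. Proof. by apply: lt_trans r3; lra. Qed.
Let s2 : 1 / 2 < s. Proof. by apply: lt_trans hs; lra. Qed.

(* [twistQ (tanP n) X] = [tanQ X] - [meanQP X n]: the projection pi is affine in n. *)
Definition meanQP (U V : TK s) : R := circle_int (fun y => tanQ U y * tanP V y).

Definition gamG0 x : R := tanP X x * tanP Y x + tanQ X x * tanQ Y x.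

(** The linear part of [gamG] at 0: $1/(1+h)$ contributes $-h$, the Jacobian $1+h$ contributes $h$,
    and each projection contributes minus its [meanQP]. *)
Definition dgamG V x : R := (tanQ X x * tanQ Y x - tanP X x * tanP Y x) * tanP V x
  - meanQP X V * tanQ Y x - meanQP Y V * tanQ X x.

Definition dgam1 V x : R := 1 / 2 * (prim (dgamG V) x - x * circle_int (dgamG V)
  - V.1 x * circle_int gamG0).

Definition dgam2 V x : R := 1 / 2 *
  ((tanP X x * tanQ Y x + tanP Y x * tanQ X x) * tanP V x
   + meanQP Y V * tanP X x + meanQP X V * tanP Y x).

Definition dgam V : TK s := (toHs0 s (dgam1 V), cls (toHs r (dgam2 V))).

Let cP (V : TK s) : continuous (tanP V). Proof. exact: continuous_tanP. Qed.
Let cQ (V : TK s) : continuous (tanQ V). Proof. exact: continuous_tanQ. Qed.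
Let cM f g : continuous f -> continuous g -> continuous (fun x => f x * g x).
Proof. exact: continuousMf. Qed.
Let cZ (a : R) f : continuous f -> continuous (fun x => a * f x).
Proof. by move=> cf; apply: continuousMf => //; exact: continuous_cstf. Qed.

Lemma continuous_gamG0 : continuous gamG0.
Proof. by apply: continuousDf; exact: cM. Qed.

Lemma continuous_dgamG V : continuous (dgamG V).
Proof.
apply: continuousBf; last exact: cZ.
apply: continuousBf; last exact: cZ.
by apply: cM => //; apply: continuousBf; exact: cM.
Qed.

Let meanQP_lin U a V W : meanQP U (a *: V + W) = a * meanQP U V + meanQP U W.
Proof.
rewrite /meanQP (tanP_lin hs a V W) -circle_intZ; last exact: cM.
rewrite -circle_intDf; [|by apply: cZ; exact: cM|exact: cM].
by congr circle_int; apply/funext => y; ring.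
Qed.

Let dgamG_lin a V W : dgamG (a *: V + W) = fun x => a * dgamG V x + 1 * dgamG W x.
Proof.
apply/funext => x.
rewrite /dgamG.
rewrite (meanQP_lin X a V W).
rewrite (meanQP_lin Y a V W).
rewrite (tanP_lin hs a V W).
move: (meanQP X V) (meanQP X W) (meanQP Y V) (meanQP Y W) => m1 m2 m3 m4.
move: (tanP X x) (tanQ X x) (tanP Y x) (tanQ Y x) (tanP V x) (tanP W x) => x1 x2 x3 x4 x5 x6.
ring. Qed.

Let prim_mean_lin (F F1 F2 : R -> R) (a v w c x : R) :
  F = (fun y => a * F1 y + 1 * F2 y) -> continuous F1 -> continuous F2 ->
  1 / 2 * (prim F x - x * circle_int F - (a * v + w) * c) =
  a * (1 / 2 * (prim F1 x - x * circle_int F1 - v * c)) +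
  1 / 2 * (prim F2 x - x * circle_int F2 - w * c).
Proof.
move=> -> c1 c2; rewrite prim_lin// circle_intDf; [|exact: cZ..].
by rewrite !circle_intZ//; ring.
Qed.

Let Hs0_lin (a : R) (v w : Hs0 s) x : (a *: v + w) x = a * v x + w x.
Proof. by []. Qed.

Let dgam1_lin a V W x : dgam1 (a *: V + W) x = a * dgam1 V x + dgam1 W x.
Proof.
have e := prim_mean_lin (V.1 x) (W.1 x) (circle_int gamG0) x (dgamG_lin a V W)
  (@continuous_dgamG V) (@continuous_dgamG W).
rewrite -(Hs0_lin a V.1 W.1 x) in e; exact: e.
Qed.

Let dgam2_lin a V W x : dgam2 (a *: V + W) x = a * dgam2 V x + dgam2 W x.
Proof.
rewrite /dgam2 (meanQP_lin X a V W) (meanQP_lin Y a V W) (tanP_lin hs a V W).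
move: (meanQP X V) (meanQP X W) (meanQP Y V) (meanQP Y W) => m1 m2 m3 m4.
move: (tanP X x) (tanQ X x) (tanP Y x) (tanQ Y x) (tanP V x) (tanP W x) => x1 x2 x3 x4 x5 x6.
ring.
Qed.

Let O_P0 (V : TK s) : @bigOH R s r 0 (fun=> tanP V).
Proof. exact: bigOH_cst (tanP_Hle hs V). Qed.

Let O_Q0 (V : TK s) : @bigOH R s r 0 (fun=> tanQ V).
Proof. by have [A] := tanQ_Hle V; exact: bigOH_cst. Qed.

Lemma bigOH_tanP : @bigOH R s r 1 (@tanP R s).
Proof.
exists (2 * pi), 1; split => //; first by rewrite mulr_ge0 ?pi_ge0.
move=> n _; apply: Hle_mono (tanP_Hle hs n).
by rewrite expr1 ler_wpM2l ?mulr_ge0 ?pi_ge0// prod_normE/= le_max lexx.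
Qed.

Let O_h : @bigOH R s s 1 (fun n => n.1).
Proof.
exists 1, 1; split => // n _; apply: Hle_mono (Hle_Hs0 n.1).
by rewrite expr1 mul1r prod_normE/= le_max lexx.
Qed.

Let O_mean (U : TK s) q : @bigOH R s q 1 (fun V _ => meanQP U V).
Proof. exact: bigOH_mean (bigOHM r2 (O_Q0 U) bigOH_tanP). Qed.

Let O_prim k (F : TK s -> R -> R) : bigOH r k F ->
  bigOH s k (fun n x => prim (F n) x - x * circle_int (F n)).
Proof. by move=> /(bigOH_prim r2); rewrite subrK. Qed.

Let O_G0 : @bigOH R s r 0 (fun=> gamG0).
Proof. exact: bigOHD (bigOHM r2 (O_P0 X) (O_P0 Y)) (bigOHM r2 (O_Q0 X) (O_Q0 Y)). Qed.

Lemma bigOH_dgamG : bigOH r 1 dgamG.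
Proof.
have h1 := bigOHM r2 (O_mean X r) (O_Q0 Y); have h2 := bigOHM r2 (O_mean Y r) (O_Q0 X).
apply: bigOHB h2; apply: bigOHB h1; apply: (bigOHM (k := 0) r2 _ bigOH_tanP).
exact: bigOHB (bigOHM r2 (O_Q0 X) (O_Q0 Y)) (bigOHM r2 (O_P0 X) (O_P0 Y)).
Qed.

Let O_hG0 : @bigOH R s s 1 (fun n x => n.1 x * circle_int gamG0).
Proof. exact: (bigOHM s2 O_h (bigOH_mean s O_G0)). Qed.

Let O_dgam1 : bigOH s 1 dgam1.
Proof. by apply: bigOHZ; apply: bigOHB O_hG0; apply: O_prim; exact: bigOH_dgamG. Qed.

Let O_dgam2 : bigOH r 1 dgam2.
Proof.
apply: bigOHZ; apply: bigOHD (bigOHM r2 (O_mean X r) (O_P0 Y)).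
apply: bigOHD (bigOHM r2 (O_mean Y r) (O_P0 X)).
apply: (bigOHM (k := 0) r2 _ bigOH_tanP).
exact: bigOHD (bigOHM r2 (O_P0 X) (O_Q0 Y)) (bigOHM r2 (O_P0 Y) (O_Q0 X)).
Qed.

Let homog (F : TK s -> R -> R) :
  (forall a V W x, F (a *: V + W) x = a * F V x + F W x) ->
  forall a V x, F (a *: V) x = a * F V x.
Proof.
move=> Flin a V x; have F0 : F 0 x = 0.
  by have := Flin 1 0 0 x; rewrite scale1r addr0 mul1r; lra.
by rewrite -[a *: V]addr0 Flin F0 addr0.
Qed.

Lemma dgam1_Hle : exists2 K, 0 <= K & forall V, Hle s (dgam1 V) (K * `|V|).
Proof. by apply: bigOH_linear O_dgam1 => a V x; exact: homog. Qed.

Lemma dgam2_Hle : exists2 K, 0 <= K & forall V, Hle r (dgam2 V) (K * `|V|).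
Proof. by apply: bigOH_linear O_dgam2 => a V x; exact: homog. Qed.

Lemma dgam1_at0 V : dgam1 V 0 = 0.
Proof. by rewrite /dgam1 prim0 Hs0_at0 !mul0r !subr0 mulr0. Qed.

Let pair_lin (a : R) (f f1 f2 : Hs0 s) (g g1 g2 : Hs r) :
  f = a *: f1 + f2 -> g = a *: g1 + g2 ->
  (f, cls g) = a *: ((f1, cls g1) : TK s) + (f2, cls g2).
Proof. by move=> -> ->; rewrite clsD clsZ. Qed.

(** Outside the space [toHs0] takes the value 0, so its linearity is available only with a bound for
    each function involved. *)
Let toHs0_lin (a : R) (F F1 F2 : R -> R) A A1 A2 :
  Hle s F A -> Hle s F1 A1 -> Hle s F2 A2 -> F 0 = 0 -> F1 0 = 0 -> F2 0 = 0 ->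
  (forall x, F x = a * F1 x + F2 x) -> toHs0 s F = a *: toHs0 s F1 + toHs0 s F2.
Proof.
move=> h h1 h2 z z1 z2 FE; apply: Hs0_eq => x.
rewrite (toHs0E h z) FE -[in LHS](toHs0E h1 z1) -[in LHS](toHs0E h2 z2).
by rewrite -Hs0_lin.
Qed.

Let toHs_lin (a : R) (F F1 F2 : R -> R) A A1 A2 :
  Hle r F A -> Hle r F1 A1 -> Hle r F2 A2 ->
  (forall x, F x = a * F1 x + F2 x) -> toHs r F = a *: toHs r F1 + toHs r F2.
Proof.
move=> h h1 h2 FE; apply/val_inj/funext => x.
by rewrite /= (toHsE h) FE -[in LHS](toHsE h1) -[in LHS](toHsE h2).
Qed.

Lemma dgam_linear : linear dgam.
Proof.
move=> a V W; have [K K0 HK] := dgam1_Hle; have [L L0 HL] := dgam2_Hle.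
have h1 := toHs0_lin (HK (a *: V + W)) (HK V) (HK W) (dgam1_at0 _) (dgam1_at0 V)
  (dgam1_at0 W) (dgam1_lin a V W).
have h2 := toHs_lin (HL (a *: V + W)) (HL V) (HL W) (dgam2_lin a V W).
exact: pair_lin h1 h2.
Qed.

End KGammaDifferential.

(** Boundedness of [L] supplies the continuity that [diff_unique] asks for. For small [v] the
    remainder $M|v|^2$ is at most $e|v|$; dividing by $M+1$ covers $M=0$. *)
Lemma diff_quadratic_remainder (R : realType) (V W : normedModType R)
    (f L rem : V -> W) (x : V) (K M d : R) : linear L -> 0 < d -> 0 <= M ->
  (forall v, `|L v| <= K * `|v|) ->
  (forall v, `|v| <= d -> f (v + x) = f x + L v + rem v) ->
  (forall v, `|v| <= d -> `|rem v| <= M * `|v| ^+ 2) ->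
  'd f x = L :> (V -> W).
Proof.
move=> linL d0 M0 LK fE remM.
pose l : {linear V -> W} := HB.pack L (GRing.isLinear.Build R V W *:%R L linL).
suff -> : 'd f x = l :> (V -> W) by [].
apply: diff_unique.
  apply/linear_bounded_continuous/linear_boundedP.
  near=> k => v; apply: le_trans (LK v) _.
  by apply: ler_wpM2r => //; near: k; apply: nbhs_pinfty_ge; exact: num_real.
apply/eqaddoP => e e0.
have M1 : 0 < M + 1 by rewrite ltr_wpDl.
have eM : 0 < Num.min d (e / (M + 1)) by rewrite lt_min d0 divr_gt0.
near=> v.
have : `|v| <= Num.min d (e / (M + 1)).
  by near: v; exact: nbhs0_le.
rewrite le_min => /andP[vd ve].
rewrite -[X in `|X|]/(f (v + x) - (f x + L v)) fE// addrAC subrr add0r.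
apply: le_trans (remM v vd) _; rewrite expr2 mulrA; apply: ler_wpM2r => //.
apply: (@le_trans _ _ ((M + 1) * `|v|)); first by rewrite ler_wpM2r// lerDl.
by rewrite mulrC -ler_pdivlMr.
Unshelve. all: by end_near. Qed.

(** * The second-order remainder of the Christoffel map *)

Section KGammaRemainder.
Context {R : realType} {s : R}.
Hypothesis hs : 5 / 2 < s.
Notation r := (s - 1).
Variables X Y : TK s.
Implicit Types (u v w U V n : TK s) (f g h : R -> R).

Let r3 : 3 / 2 < r. Proof. rewrite ltrBrDr; have := hs; lra. Qed.
Let r2 : 1 / 2 < r. Proof. by apply: lt_trans r3; lra. Qed.
Let s2 : 1 / 2 < s. Proof. by apply: lt_trans hs; lra. Qed.

Let cP (V : TK s) : continuous (tanP V). Proof. exact: continuous_tanP. Qed.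
Let cQ (V : TK s) : continuous (tanQ V). Proof. exact: continuous_tanQ. Qed.
Let cM f g : continuous f -> continuous g -> continuous (fun x => f x * g x).
Proof. exact: continuousMf. Qed.

(* The parts of [gamG], [gam1] and [gam2] of second order in n. *)
Definition rhoG n x : R :=
  tanP X x * tanP Y x * (tanP n x * tanP n x * (1 + tanP n x)^-1) +
  (meanQP X n * meanQP Y n * (1 + tanP n x)
   - meanQP X n * tanQ Y x * tanP n x - meanQP Y n * tanQ X x * tanP n x).

Definition rho1 n x : R := 1 / 2 * (prim (rhoG n) x - x * circle_int (rhoG n)
  - n.1 x * (circle_int (dgamG X Y n) + circle_int (rhoG n))).

Definition rho2 n x : R := - (1 / 2) *
  ((tanP X x * tanQ Y x + tanP Y x * tanQ X x)
      * (tanP n x * tanP n x * (1 + tanP n x)^-1)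
   + (meanQP Y n * tanP X x + meanQP X n * tanP Y x) * (tanP n x * (1 + tanP n x)^-1)).

(** The exact identity $1/(1+k)=1-k+k^2/(1+k)$ replaces a power series. Each term on the last line
    has at least two factors among [m], [m'], [k], all of which are of first order in [n]. *)
Let gamG_expand (a b c d m m' k : R) : 1 + k != 0 ->
  a * b * (1 + k)^-1 + (c - m) * (d - m') * (1 + k) =
  (a * b + c * d) + ((c * d - a * b) * k - m * d - m' * c)
  + (a * b * (k * k * (1 + k)^-1) + (m * m' * (1 + k) - m * d * k - m' * c * k)).
Proof. by move=> k0; field. Qed.

Let gam2_expand (a b c d m m' k : R) : 1 + k != 0 ->
  - (1 / 2) * (a * (1 + k)^-1 * (d - m') + b * (1 + k)^-1 * (c - m)) =
  - (1 / 2) * (a * d + b * c) + 1 / 2 * ((a * d + b * c) * k + m' * a + m * b)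
  + - (1 / 2) * ((a * d + b * c) * (k * k * (1 + k)^-1) + (m' * a + m * b) * (k * (1 + k)^-1)).
Proof. by move=> k0; field. Qed.

Lemma gamG_split n : (forall x, 1 + tanP n x != 0) ->
  gamG (tanP n) X Y = fun x => gamG0 X Y x + dgamG X Y n x + rhoG n x.
Proof. by move=> n0; apply/funext => x; exact: gamG_expand. Qed.

(** The factor [h] is itself of first order, so each mean multiplying it moves up by one order: that
    of [F0] joins the linear part, those of [F1] and [F2] the remainder. *)
Let gam1_expand (F F0 F1 F2 h : R -> R) x : continuous F0 -> continuous F1 ->
  continuous F2 -> F = (fun x => F0 x + F1 x + F2 x) ->
  1 / 2 * (prim F x - x * circle_int F - h x * circle_int F) =
  1 / 2 * (prim F0 x - x * circle_int F0)
  + 1 / 2 * (prim F1 x - x * circle_int F1 - h x * circle_int F0)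
  + 1 / 2 * (prim F2 x - x * circle_int F2 - h x * (circle_int F1 + circle_int F2)).
Proof.
move=> c0 c1 c2 ->.
have c01 : continuous (fun x => F0 x + F1 x) by exact: continuousDf.
have e : prim (fun x => F0 x + F1 x + F2 x) x = prim F0 x + prim F1 x + prim F2 x.
  have -> : (fun x => F0 x + F1 x + F2 x) = (fun x => 1 * (F0 x + F1 x) + 1 * F2 x).
    by apply/funext => y; rewrite !mul1r.
  rewrite prim_lin//.
  have -> : (fun x => F0 x + F1 x) = (fun x => 1 * F0 x + 1 * F1 x).
    by apply/funext => y; rewrite !mul1r.
  by rewrite prim_lin// !mul1r.
by rewrite e circle_intDf// circle_intDf//; ring.
Qed.

Definition gam1_base x : R :=
  1 / 2 * (prim (gamG0 X Y) x - x * circle_int (gamG0 X Y)).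

Definition gam2_base x : R :=
  - (1 / 2) * (tanP X x * tanQ Y x + tanP Y x * tanQ X x).

(* Gamma_e(X, Y). *)
Definition gam_base : TK s := (toHs0 s gam1_base, cls (toHs r gam2_base)).

Lemma continuous_rhoG n : (forall x, 1 + tanP n x != 0) -> continuous (rhoG n).
Proof.
move=> n0.
have cI : continuous (fun x => (1 + tanP n x)^-1).
  by apply: continuousVf => //; apply: continuousDf => //; exact: continuous_cstf.
have cZ (a : R) f : continuous f -> continuous (fun x => a * f x).
  by move=> cf; apply: continuousMf => //; exact: continuous_cstf.
apply: continuousDf.
  by apply: cM; [exact: cM|apply: cM => //; exact: cM].
apply: continuousBf; last by apply: cM => //; exact: cZ.
apply: continuousBf; last by apply: cM => //; exact: cZ.
by apply: cZ; apply: continuousDf => //; exact: continuous_cstf.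
Qed.

Lemma gam1_split n x : (forall x, 1 + tanP n x != 0) ->
  gam1 n X Y x = gam1_base x + dgam1 X Y n x + rho1 n x.
Proof.
move=> n0; exact: (gam1_expand n.1 x (continuous_gamG0 hs (Y := Y))
  (continuous_dgamG hs (V := n)) (continuous_rhoG n0) (gamG_split n0)).
Qed.

Lemma gam2_split n x : (forall x, 1 + tanP n x != 0) ->
  gam2 n X Y x = gam2_base x + dgam2 X Y n x + rho2 n x.
Proof. by move=> n0; exact: gam2_expand (n0 x). Qed.

Let O_P0 (V : TK s) : @bigOH R s r 0 (fun=> tanP V).
Proof. exact: bigOH_cst (tanP_Hle hs V). Qed.

Let O_Q0 (V : TK s) : @bigOH R s r 0 (fun=> tanQ V).
Proof. by have [A] := tanQ_Hle V; exact: bigOH_cst. Qed.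

Let O_prim k (F : TK s -> R -> R) : bigOH r k F ->
  bigOH s k (fun n x => prim (F n) x - x * circle_int (F n)).
Proof. by move=> /(bigOH_prim r2); rewrite subrK. Qed.

Lemma gam1_base_Hle : exists A, Hle s gam1_base A.
Proof.
have O_G0 : @bigOH R s r 0 (fun=> gamG0 X Y).
  exact: bigOHD (bigOHM r2 (O_P0 X) (O_P0 Y)) (bigOHM r2 (O_Q0 X) (O_Q0 Y)).
(* A fixed function is a constant family of order 0; its bound is read off at [n = 0], where the
   power $0^0$ equals 1. *)
have [K [d [K0 d0 /(_ 0)]]] := bigOHZ (1 / 2) (O_prim O_G0).
by rewrite normr0 ltW// => /(_ isT); exists (K * 0 ^+ 0).
Qed.

Lemma gam2_base_Hle : exists A, Hle r gam2_base A.
Proof.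
have := bigOHD (bigOHM r2 (O_P0 X) (O_Q0 Y)) (bigOHM r2 (O_P0 Y) (O_Q0 X)).
move=> /(bigOHZ (- (1 / 2)))[K [d [K0 d0 /(_ 0)]]].
by rewrite normr0 ltW// => /(_ isT); exists (K * 0 ^+ 0).
Qed.

Lemma gam1_base_at0 : gam1_base 0 = 0.
Proof. by rewrite /gam1_base prim0 mul0r subr0 mulr0. Qed.

Let O_mean (U : TK s) q : @bigOH R s q 1 (fun V _ => meanQP U V).
Proof. exact: bigOH_mean (bigOHM r2 (O_Q0 U) (bigOH_tanP hs)). Qed.

Let O_I : @bigOH R s r 0 (fun n x => (1 + tanP n x)^-1).
Proof. by have [] := bigOH_inv r2 (bigOH_tanP hs). Qed.

Let O_P := bigOH_tanP hs.

Let O_KKI : @bigOH R s r 2 (fun n x => tanP n x * tanP n x * (1 + tanP n x)^-1).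
Proof. exact: bigOHM r2 (bigOHM r2 O_P O_P) O_I. Qed.

Let O_KI : @bigOH R s r 1 (fun n x => tanP n x * (1 + tanP n x)^-1).
Proof. exact: bigOHM r2 O_P O_I. Qed.

Let O_1K : @bigOH R s r 0 (fun n x => 1 + tanP n x).
Proof.
apply: bigOHD; first exact: bigOH_cst (Hle1 r).
exact: bigOH_weaken (leqnSn 0) O_P.
Qed.

Lemma bigOH_rhoG : bigOH r 2 rhoG.
Proof.
have mm := bigOHM r2 (bigOHM r2 (O_mean X r) (O_mean Y r)) O_1K.
have m1 := bigOHM r2 (bigOHM r2 (O_mean X r) (O_Q0 Y)) O_P.
have m2 := bigOHM r2 (bigOHM r2 (O_mean Y r) (O_Q0 X)) O_P.
apply: bigOHD (bigOHB (bigOHB mm m1) m2).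
exact: bigOHM r2 (bigOHM r2 (O_P0 X) (O_P0 Y)) O_KKI.
Qed.

Let O_h : @bigOH R s s 1 (fun n => n.1).
Proof.
exists 1, 1; split => // n _; apply: Hle_mono (Hle_Hs0 n.1).
by rewrite expr1 mul1r prod_normE/= le_max lexx.
Qed.

Lemma bigOH_rho1 : bigOH s 2 rho1.
Proof.
apply: bigOHZ; apply: bigOHB; first by apply: O_prim; exact: bigOH_rhoG.
apply: (bigOHM (k := 1) (l := 1) s2 O_h); apply: bigOHD.
  exact: bigOH_mean (bigOH_dgamG hs X Y).
exact: bigOH_mean (bigOH_weaken (leqnSn 1) bigOH_rhoG).
Qed.

Lemma bigOH_rho2 : bigOH r 2 rho2.
Proof.
apply: bigOHZ; apply: bigOHD.
  apply: (bigOHM (k := 0) r2 _ O_KKI).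
  exact: bigOHD (bigOHM r2 (O_P0 X) (O_Q0 Y)) (bigOHM r2 (O_P0 Y) (O_Q0 X)).
apply: (bigOHM (k := 1) r2 _ O_KI).
exact: bigOHD (bigOHM r2 (O_mean Y r) (O_P0 X)) (bigOHM r2 (O_mean X r) (O_P0 Y)).
Qed.

End KGammaRemainder.

Section KGammaDiff.
Context {R : realType} {s : R}.
Hypothesis hs : 5 / 2 < s.
Notation r := (s - 1).
Variables X Y : TK s.
Implicit Types (V n : TK s).

Let r3 : 3 / 2 < r. Proof. rewrite ltrBrDr; have := hs; lra. Qed.
Let r2 : 1 / 2 < r. Proof. by apply: lt_trans r3; lra. Qed.

Let toHs0D3 (F F0 F1 F2 : R -> R) A0 A1 A2 :
  Hle s F0 A0 -> Hle s F1 A1 -> Hle s F2 A2 -> F0 0 = 0 -> F1 0 = 0 -> F2 0 = 0 ->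
  (forall x, F x = F0 x + F1 x + F2 x) ->
  toHs0 s F = toHs0 s F0 + toHs0 s F1 + toHs0 s F2.
Proof.
move=> h0 h1 h2 z0 z1 z2 /funext ->; apply: Hs0_eq => x.
rewrite (toHs0E (HleD (HleD h0 h1) h2)) ?z0 ?z1 ?z2 ?addr0//.
by rewrite -[in LHS](toHs0E h0 z0) -[in LHS](toHs0E h1 z1) -[in LHS](toHs0E h2 z2).
Qed.

Let toHsD3 (F F0 F1 F2 : R -> R) A0 A1 A2 :
  Hle r F0 A0 -> Hle r F1 A1 -> Hle r F2 A2 ->
  (forall x, F x = F0 x + F1 x + F2 x) ->
  toHs r F = toHs r F0 + toHs r F1 + toHs r F2.
Proof.
move=> h0 h1 h2 /funext ->; apply/val_inj/funext => x.
rewrite /= (toHsE (HleD (HleD h0 h1) h2)).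
by rewrite -[in LHS](toHsE h0) -[in LHS](toHsE h1) -[in LHS](toHsE h2).
Qed.

Let pairD3 (f f0 f1 f2 : Hs0 s) (g g0 g1 g2 : Hs r) :
  f = f0 + f1 + f2 -> g = g0 + g1 + g2 ->
  (f, cls g) = (f0, cls g0) + (f1, cls g1) + (f2, cls g2) :> TK s.
Proof. by move=> -> ->; rewrite !clsD. Qed.

Definition gam_rem n : TK s := (toHs0 s (rho1 X Y n), cls (toHs r (rho2 X Y n))).

Lemma rho1_at0 n : rho1 X Y n 0 = 0.
Proof. by rewrite /rho1 prim0 Hs0_at0 !mul0r !subr0 mulr0. Qed.

Lemma gam_split : exists d M, [/\ 0 < d, 0 <= M,
  forall n, `|n| <= d -> gam n X Y = gam_base X Y + dgam X Y n + gam_rem n &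
  forall n, `|n| <= d -> `|gam_rem n| <= M * `|n| ^+ 2].
Proof.
have [_ [d d0 dH]] := bigOH_inv r2 (bigOH_tanP hs).
have [K1 [d1 [K10 d10 H1]]] := bigOH_rho1 hs X Y.
have [K2 [d2 [K20 d20 H2]]] := bigOH_rho2 hs X Y.
have [A1 HA1] := gam1_base_Hle hs X Y; have [A2 HA2] := gam2_base_Hle hs X Y.
have [L1 _ HL1] := dgam1_Hle hs X Y; have [L2 _ HL2] := dgam2_Hle hs X Y.
exists (Num.min d (Num.min d1 d2)), (K1 + K2).
split; [by rewrite !lt_min d0 d10|exact: addr_ge0| |].
  move=> n; rewrite !le_min => /and3P[nd /H1 h1 /H2 h2].
  have n0 x : 1 + tanP n x != 0.
    by have := dH n nd x; rewrite ler_norml => /andP[? ?]; rewrite gt_eqF//; lra.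
  have e1 := toHs0D3 HA1 (HL1 n) h1 (gam1_base_at0 X Y) (dgam1_at0 X Y n) (rho1_at0 n)
    (fun x => gam1_split hs X Y x n0).
  have e2 := toHsD3 HA2 (HL2 n) h2 (fun x => gam2_split X Y x n0).
  exact: pairD3 e1 e2.
move=> n; rewrite !le_min => /and3P[nd /H1 h1 /H2 h2].
rewrite prod_normE ge_max; apply/andP; split; rewrite mulrDl /=.
  apply: le_trans (toHs0_norm h1 (rho1_at0 n)) _.
  by rewrite lerDl mulr_ge0 ?sqr_ge0.
apply: le_trans (HsR_norm_le _) _; apply: le_trans (toHs_norm h2) _.
by rewrite lerDr mulr_ge0 ?sqr_ge0.
Qed.

Lemma dgam_bounded : exists K, forall n, `|dgam X Y n| <= K * `|n|.
Proof.
have [L1 L10 HL1] := dgam1_Hle hs X Y; have [L2 L20 HL2] := dgam2_Hle hs X Y.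
exists (L1 + L2) => n.
rewrite prod_normE ge_max; apply/andP; split; rewrite mulrDl /=.
  apply: le_trans (toHs0_norm (HL1 n) (dgam1_at0 X Y n)) _.
  by rewrite lerDl mulr_ge0.
apply: le_trans (HsR_norm_le _) _; apply: le_trans (toHs_norm (HL2 n)) _.
by rewrite lerDr mulr_ge0.
Qed.

(** Read off from the splitting at [n = 0], where the norm bounds force the linear part and the
    remainder to vanish. *)
Lemma gam0 : gam 0 X Y = gam_base X Y.
Proof.
have [d [M [d0 M0 e b]]] := gam_split.
have z : `|0 : TK s| <= d by rewrite normr0 ltW.
have r0 : gam_rem 0 = 0.
  by apply/eqP; rewrite -normr_le0 (le_trans (b 0 z))// normr0 expr0n mulr0.
have l0 : dgam X Y 0 = 0.
  have [K /(_ (0 : TK s))] := dgam_bounded.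
  by rewrite normr0 mulr0 normr_le0 => /eqP.
by rewrite (e 0 z) r0 l0 !addr0.
Qed.

Lemma Kgamma_diff k :
  'd (fun n => Kgamma (Kchart_inv k n) X Y) 0 = dgam X Y :> (TK s -> TK s).
Proof.
have [d [M [d0 M0 e b]]] := gam_split; have [c c0 cE] := Kchart_inv_gam hs k.
have [K HK] := dgam_bounded.
apply: (@diff_quadratic_remainder _ _ _ _ _ gam_rem 0 K M (Num.min d c)).
- exact: dgam_linear.
- by rewrite lt_min d0.
- by [].
- exact: HK.
- move=> n; rewrite le_min => /andP[nd nc].
  by rewrite addr0 !cE ?normr0 ?(ltW c0)// gam0 e.
- by move=> n; rewrite le_min => /andP[nd _]; exact: b.
Qed.

Lemma Kgamma_e : Kgamma Ke X Y = gam_base X Y.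
Proof.
rewrite -gam0; apply: Kgamma_gam => // x.
have -> : tanP (0 : TK s) x = 0.
  rewrite /tanP (_ : ((0 : TK s).1 : R -> R) = cst 0) ?derive1_cst//.
by rewrite normr0.
Qed.

End KGammaDiff.

(** * The curvature at the identity *)

Section CurvatureIntegrals.
Context {R : realType}.
Implicit Types (a b c d k p q f g : R -> R).

Let cM f g : continuous f -> continuous g -> continuous (fun x => f x * g x).
Proof. exact: continuousMf. Qed.
Let cZ (e : R) f : continuous f -> continuous (fun x => e * f x).
Proof. by move=> cf; apply: continuousMf => //; exact: continuous_cstf. Qed.

Lemma circle_int_lin2 (e1 e2 : R) f1 f2 : continuous f1 -> continuous f2 ->
  circle_int (fun x => e1 * f1 x + e2 * f2 x) = e1 * circle_int f1 + e2 * circle_int f2.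
Proof. by move=> c1 c2; rewrite circle_intDf ?circle_intZ//; exact: cZ. Qed.

(** It allows a coordinate of a tangent vector to be computed only up to a constant when it is
    paired with another tangent vector. *)
Lemma circle_int_mean_zero (e e' : R) f g p q : continuous f -> continuous g ->
  continuous p -> continuous q -> circle_int p = 0 -> circle_int q = 0 ->
  circle_int (fun x => (f x - e) * p x + (g x - e') * q x) =
  circle_int (fun x => f x * p x + g x * q x).
Proof.
move=> cf cg cp cq p0 q0.
have -> : (fun x => (f x - e) * p x + (g x - e') * q x) =
  fun x => 1 * (f x * p x + g x * q x) + (- 1) * (e * p x + e' * q x).
  by apply/funext => x; ring.
rewrite circle_int_lin2; last 2 first.
- by apply: continuousDf; exact: cM.
- by apply: continuousDf; exact: cZ.
by rewrite (circle_int_lin2 e e' cp cq) p0 q0; ring.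
Qed.

(** Here $(a,b)$ are the coordinates of [v] and $(p,q)$ those of [u]. The four summands of the
    integrand are, in order, the four terms of [Kcurv] paired with [u]; [Ebp - Eaq] is 4 times the
    symplectic form. *)
Lemma curvature_integral a b p q (Eab Eap Ebq Eaq Ebp Eaa Ebb : R) :
  continuous a -> continuous b -> continuous p -> continuous q ->
  Eap = circle_int (fun x => a x * p x) -> Ebq = circle_int (fun x => b x * q x) ->
  Eaq = circle_int (fun x => a x * q x) -> Ebp = circle_int (fun x => b x * p x) ->
  circle_int (fun x =>
    (1 / 2 * ((b x * q x - a x * p x) * a x - Eab * q x - Eaq * b x
              - a x * (Eap + Ebq)) * p x
     + 1 / 2 * ((a x * q x + p x * b x) * a x + Eaq * a x + Eab * p x) * q x)
    - (1 / 2 * ((b x * b x - a x * a x) * p x - Ebp * b x - Ebp * b x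
              - p x * (Eaa + Ebb)) * p x
     + 1 / 2 * ((a x * b x + a x * b x) * p x + Ebp * a x + Ebp * a x) * q x)
    + (1 / 2 * ((1 / 2 * (a x * a x + b x * b x - (Eaa + Ebb))) * p x +
           (- (1 / 2) * (a x * b x + a x * b x - (Eab + Eab))) * q x) * p x
       + - (1 / 2) * ((1 / 2 * (a x * a x + b x * b x - (Eaa + Ebb))) * q x +
           p x * (- (1 / 2) * (a x * b x + a x * b x - (Eab + Eab)))) * q x)
    - (1 / 2 * ((1 / 2 * (a x * p x + b x * q x - (Eap + Ebq))) * a x +
           (- (1 / 2) * (a x * q x + p x * b x - (Eaq + Ebp))) * b x) * p x
       + - (1 / 2) * ((1 / 2 * (a x * p x + b x * q x - (Eap + Ebq))) * b x +
           a x * (- (1 / 2) * (a x * q x + p x * b x - (Eaq + Ebp)))) * q x)) =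
  1 / 4 * ((Eaa + Ebb) * (circle_int (fun x => p x * p x) + circle_int (fun x => q x * q x))
     - (Eap + Ebq) ^+ 2 + 3 * (Ebp - Eaq) ^+ 2).
Proof.
move=> ca cb cp cq e1 e2 e3 e4.
set n := Eap + Ebq; set m := Eaa + Ebb.
transitivity (circle_int (fun x => 1 * ((m / 4) * (p x * p x) + (m / 4) * (q x * q x)) +
  1 * (1 * (- (n / 4) * (a x * p x) + - (n / 4) * (b x * q x)) +
  1 * (3 / 4 * (Ebp - Eaq) * (b x * p x) + - (3 / 4) * (Ebp - Eaq) * (a x * q x))))).
  by congr circle_int; apply/funext => x; rewrite /n /m; field.
rewrite !circle_int_lin2; do ?[exact: cM|apply: continuousDf; apply: cZ; exact: cM];
  last by apply: continuousDf; apply: cZ; apply: continuousDf; apply: cZ; exact: cM.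
by rewrite -e1 -e2 -e3 -e4 /n; field.
Qed.

End CurvatureIntegrals.

Section CurvatureAtIdentity.
Context {R : realType} {s : R}.
Hypothesis hs : 5 / 2 < s.
Notation r := (s - 1).
Implicit Types (u v w U V W X Y Z : TK s) (f g h : R -> R).

Let r3 : 3 / 2 < r. Proof. rewrite ltrBrDr; have := hs; lra. Qed.

Let cP V : continuous (tanP V). Proof. exact: continuous_tanP. Qed.
Let cQ V : continuous (tanQ V). Proof. exact: continuous_tanQ. Qed.
Let cM f g : continuous f -> continuous g -> continuous (fun x => f x * g x).
Proof. exact: continuousMf. Qed.
Let cZ (e : R) f : continuous f -> continuous (fun x => e * f x).
Proof. by move=> cf; apply: continuousMf => //; exact: continuous_cstf. Qed.

Lemma Kmetric_e U V : Kmetric Ke U V =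
  1 / 4 * circle_int (fun x => tanP U x * tanP V x + tanQ U x * tanQ V x).
Proof.
have phi1 : derive1 (Kphi (Ke : Ks s)) = fun=> 1.
  apply: is_derive_derive1 => x; rewrite -[X in is_derive _ _ _ X]addr0.
  apply: is_deriveD; exact: is_derive_cst.
have pE (Z : TK s) : Kproj Ke (repr Z.2) = tanQ Z.
  rewrite /Kproj phi1 /tanQ /cproj; apply/funext => x; congr (_ - circle_int _).
  by apply/funext => y; rewrite mulr1.
rewrite /Kmetric phi1 !pE; congr (_ * circle_int _); apply/funext => x.
by rewrite divr1 mulr1.
Qed.

Lemma KmetricC U V : Kmetric Ke U V = Kmetric Ke V U.
Proof.
rewrite !Kmetric_e; congr (_ * circle_int _); apply/funext => x.
by rewrite mulrC [X in _ + X]mulrC.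
Qed.

Let lin_integral (e : R) (a1 b1 a2 b2 p q : R -> R) :
  continuous a1 -> continuous b1 -> continuous a2 -> continuous b2 ->
  continuous p -> continuous q ->
  1 / 4 * circle_int (fun x => (e * a1 x + a2 x) * p x + (e * b1 x + b2 x) * q x) =
  e * (1 / 4 * circle_int (fun x => a1 x * p x + b1 x * q x)) +
  1 / 4 * circle_int (fun x => a2 x * p x + b2 x * q x).
Proof.
move=> ca1 cb1 ca2 cb2 cp cq.
have -> : (fun x => (e * a1 x + a2 x) * p x + (e * b1 x + b2 x) * q x) =
  (fun x => e * (a1 x * p x + b1 x * q x) + 1 * (a2 x * p x + b2 x * q x)).
  by apply/funext => x; ring.
by rewrite circle_int_lin2; [ring|apply: continuousDf; exact: cM..].
Qed.

Lemma Kmetric_lin (e : R) U V W :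
  Kmetric Ke (e *: U + V) W = e * Kmetric Ke U W + Kmetric Ke V W.
Proof.
by rewrite !Kmetric_e (tanP_lin hs e U V) (tanQ_lin e U V) lin_integral.
Qed.

Let sub_scaleN1 (M : lmodType R) (x y : M) : x - y = -1 *: y + x.
Proof. by rewrite scaleN1r addrC. Qed.

Lemma KmetricD U V W : Kmetric Ke (U + V) W = Kmetric Ke U W + Kmetric Ke V W.
Proof.
have -> : U + V = 1 *: U + V by rewrite scale1r.
have := Kmetric_lin 1 U V W.
by move: (Kmetric _ _ _) (Kmetric _ _ _) (Kmetric _ _ _) => x y z ->; ring.
Qed.

Lemma KmetricB U V W : Kmetric Ke (U - V) W = Kmetric Ke U W - Kmetric Ke V W.
Proof.
rewrite (sub_scaleN1 U V).
have := Kmetric_lin (-1) V U W.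
by move: (Kmetric _ _ _) (Kmetric _ _ _) (Kmetric _ _ _) => x y z ->; ring.
Qed.

Lemma Kmetric_mean_zero (f g : R -> R) (e e' : R) Z W :
  continuous f -> continuous g -> tanP Z = (fun x => f x - e) ->
  tanQ Z = (fun x => g x - e') ->
  Kmetric Ke Z W = 1 / 4 * circle_int (fun x => f x * tanP W x + g x * tanQ W x).
Proof.
move=> cf cg ZP ZQ; rewrite Kmetric_e ZP ZQ circle_int_mean_zero//.
  exact: circle_int_tanP.
exact: circle_int_tanQ.
Qed.

Let tanP_prim (f h h' : R -> R) (c c' A : R) (F : R -> R) (Z : HsR r) :
  continuous f -> (forall x, is_derive x (1 : R) h (h' x)) ->
  F = (fun x => 1 / 2 * (prim f x - x * c - h x * c')) -> Hle s F A -> F 0 = 0 ->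
  tanP ((toHs0 s F, Z) : TK s) = fun x => 1 / 2 * (f x - h' x * c') - 1 / 2 * c.
Proof.
move=> cf dh FE hF F0; rewrite /tanP/= (toHs0E hF F0) FE.
apply: is_derive_derive1 => x.
have d1 := is_deriveMf (is_derive_id x (1 : R)) (is_derive_cst c x (1 : R)).
have d2 := is_deriveMf (dh x) (is_derive_cst c' x (1 : R)).
have d := is_deriveZ (1 / 2) (is_deriveB (is_deriveB (is_derive_prim x cf) d1) d2).
by apply: is_derive_eq d _; rewrite /GRing.scale/=; ring.
Qed.

Lemma tanP_dgam X Y V : tanP (dgam X Y V) = fun x =>
  1 / 2 * (dgamG X Y V x - tanP V x * circle_int (gamG0 X Y))
  - 1 / 2 * circle_int (dgamG X Y V).
Proof.
have [K K0 HK] := dgam1_Hle hs X Y.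
exact: tanP_prim (continuous_dgamG hs (V := V)) (is_derive_Hs0 hs V.1)
  (erefl (dgam1 X Y V)) (HK V) (dgam1_at0 X Y V).
Qed.

Lemma tanQ_dgam X Y V : tanQ (dgam X Y V) = cproj (dgam2 X Y V).
Proof. by have [K K0 HK] := dgam2_Hle hs X Y; rewrite tanQ_cls (toHsE (HK V)). Qed.

Lemma tanP_gam_base X Y : tanP (gam_base X Y) = fun x =>
  1 / 2 * (gamG0 X Y x - circle_int (gamG0 X Y)).
Proof.
have [A HA] := gam1_base_Hle hs X Y.
have z x : is_derive x (1 : R) (fun=> 0 : R) 0 by exact: is_derive_cst.
have e : gam1_base X Y = fun x =>
    1 / 2 * (prim (gamG0 X Y) x - x * circle_int (gamG0 X Y) - 0 * 0).
  by apply/funext => x; rewrite mul0r subr0.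
have := tanP_prim (cls (toHs r (gam2_base X Y))) (continuous_gamG0 hs (Y := Y)) z e
  HA (gam1_base_at0 X Y).
move=> ->; apply/funext => x; rewrite mul0r subr0.
by move: (gamG0 X Y x) (circle_int _) => t c; ring.
Qed.

Lemma tanQ_gam_base X Y : tanQ (gam_base X Y) = cproj (gam2_base X Y).
Proof. by have [A HA] := gam2_base_Hle hs X Y; rewrite tanQ_cls (toHsE HA). Qed.

End CurvatureAtIdentity.

(** * A plane and the rotation of one of its vectors *)

Section HermitianPlanes.
Context {R : realType} {T : lmodType R}.
Variables (g : T -> T -> R) (u v j : T).
Hypotheses (gC : forall x y, g x y = g y x)
  (gL : forall (e : R) x y z, g (e *: x + y) z = e * g x z + g y z)
  (g_ge0 : forall x, 0 <= g x x) (g_def : forall x, g x x = 0 -> x = 0)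
  (gjj : g j j = g u u) (gju : g j u = 0)
  (indep : forall a b : R, a *: u + b *: v = 0 -> a = 0 /\ b = 0).
Notation M := (g u u).
Notation m := (g v v).
Notation n := (g u v).
Notation w := (g j v).

Let g0 z : g 0 z = 0.
Proof. by have := gL 1 0 0 z; rewrite scale1r addr0 mul1r; lra. Qed.

Let gD x y z : g (x + y) z = g x z + g y z.
Proof. by have := gL 1 x y z; rewrite scale1r mul1r. Qed.

Let gZ (e : R) x z : g (e *: x) z = e * g x z.
Proof. by rewrite -[e *: x]addr0 gL g0 addr0. Qed.

Lemma plane_sqr_norm_gt0 : 0 < M.
Proof.
rewrite lt_neqAle g_ge0 andbT eq_sym; apply/eqP => /g_def u0.
have := indep (a := 1) (b := 0); rewrite u0 scaler0 scale0r addr0 => /(_ erefl)[].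
by move/eqP; rewrite oner_eq0.
Qed.

Let sqr_norm3 (a b c : R) : let z := a *: v + (b *: u + c *: j) in
  g z z = a ^+ 2 * m + b ^+ 2 * M + c ^+ 2 * M + 2 * a * b * n + 2 * a * c * w.
Proof.
move=> z; rewrite /z !gD !gZ ![g _ (_ + _)]gC !gD !gZ gjj gju.
rewrite (gC u j) gju (gC v u) (gC v j); ring.
Qed.

(** The vector $Mv-nu$ has square norm $M(Mm-n^2)$ and is nonzero by independence. *)
Lemma plane_gram_gt0 : 0 < M * m - n ^+ 2.
Proof.
have M0 := plane_sqr_norm_gt0.
have := sqr_norm3 M (- n) 0; rewrite scale0r addr0 /=.
set z := _ + _ => e; have := g_ge0 z; rewrite le_eqVlt => /predU1P[/esym/g_def z0|].
  have [|_ M00] := indep (a := - n) (b := M); first by rewrite addrC.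
  by move: M0; rewrite M00 ltxx.
rewrite e (_ : _ + _ = M * (M * m - n ^+ 2)); last by ring.
by rewrite pmulr_rgt0.
Qed.

Let residue_norm : let z := M *: v + (- n *: u + - w *: j) in
  g z z = M * (M * m - n ^+ 2 - w ^+ 2).
Proof. by move=> z; rewrite sqr_norm3; ring. Qed.

Lemma plane_kahler_le : w ^+ 2 <= M * m - n ^+ 2.
Proof.
rewrite -subr_ge0 -(pmulr_rge0 _ plane_sqr_norm_gt0) -residue_norm; exact: g_ge0.
Qed.

(** Equality makes the residue vanish, so $wj=Mv-nu$, and [w] is nonzero because the Gram
    determinant is. Conversely, pairing $j=au+bv$ with $u$, $v$ and $j$ gives three relations from
    which [a] and [b] are eliminated. *)
Lemma plane_kahler_eq : w ^+ 2 = M * m - n ^+ 2 <-> exists a b : R, j = a *: u + b *: v.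
Proof.
have D0 := plane_gram_gt0; have M0 := plane_sqr_norm_gt0; split=> [e|[a [b je]]].
  have w0 : w != 0 by apply/eqP => w0; move: D0; rewrite -e w0 expr0n ltxx.
  have /g_def : g (M *: v + (- n *: u + - w *: j)) (M *: v + (- n *: u + - w *: j)) = 0.
    by rewrite residue_norm e subrr mulr0.
  move=> /eqP; rewrite addrA addr_eq0 -scaleNr opprK => /eqP z0.
  exists (- n / w), (M / w); apply: (scalerI w0).
  rewrite -z0 scalerDr !scalerA addrC.
  by congr (_ *: _ + _ *: _); field.
have E1 : a * M + b * n = 0.
  by have := gju; rewrite [X in g X _]je gD !gZ (gC v u).
have E2 : a * n + b * m = w by rewrite [in RHS]je gD !gZ.
have E3 : b * w = M.
  have := gjj; rewrite [X in g X _]je gD !gZ (gC u j) gju (gC v j); lra.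
have E4 : M * w = b * (M * m - n ^+ 2).
  transitivity (n * (a * M + b * n) + b * (M * m - n ^+ 2)); last by rewrite E1 mulr0 add0r.
  by rewrite -E2; ring.
apply: (mulfI (lt0r_neq0 M0)).
have -> : M * w ^+ 2 = M * w * w by ring.
by rewrite E4 mulrAC E3.
Qed.

Lemma plane_kahler_eq_orthogonal : n = 0 ->
  (w ^+ 2 = M * m - n ^+ 2 <-> exists c : R, j = c *: v).
Proof.
move=> n0; rewrite plane_kahler_eq; split=> [[a [b je]]|[c je]]; last first.
  by exists 0, c; rewrite scale0r add0r.
have /eqP : a * M + b * n = 0.
  by have := gju; rewrite [X in g X _]je gD !gZ (gC v u).
rewrite n0 mulr0 addr0 mulf_eq0 (gt_eqF plane_sqr_norm_gt0) orbF => /eqP a0.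
by exists b; rewrite je a0 scale0r add0r.
Qed.

End HermitianPlanes.

(** * Assembly of the curvature formula *)

Section CurvatureFormula.
Context {R : realType} {s : R}.
Hypothesis hs : 5 / 2 < s.
Notation r := (s - 1).
Implicit Types (u v w U V W X Y Z : TK s) (f g h : R -> R).

Let r3 : 3 / 2 < r. Proof. rewrite ltrBrDr; have := hs; lra. Qed.

Let cP V : continuous (tanP V). Proof. exact: continuous_tanP. Qed.
Let cQ V : continuous (tanQ V). Proof. exact: continuous_tanQ. Qed.
Let cM f g : continuous f -> continuous g -> continuous (fun x => f x * g x).
Proof. exact: continuousMf. Qed.
Let cZ (e : R) f : continuous f -> continuous (fun x => e * f x).
Proof. by move=> cf; apply: continuousMf => //; exact: continuous_cstf. Qed.

(** The integrals enter through equations so that each use can supply them under the form that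
    [curvature_integral] expects. *)
Lemma Kmetric_dgam X Y V W (mX mY c0 : R) : meanQP X V = mX -> meanQP Y V = mY ->
  circle_int (gamG0 X Y) = c0 ->
  Kmetric Ke (dgam X Y V) W = 1 / 4 * circle_int (fun x =>
    1 / 2 * ((tanQ X x * tanQ Y x - tanP X x * tanP Y x) * tanP V x
       - mX * tanQ Y x - mY * tanQ X x - tanP V x * c0) * tanP W x
    + 1 / 2 * ((tanP X x * tanQ Y x + tanP Y x * tanQ X x) * tanP V x
       + mY * tanP X x + mX * tanP Y x) * tanQ W x).
Proof.
move=> <- <- <-.
have c1 : continuous (fun x => 1 / 2 *
    (dgamG X Y V x - tanP V x * circle_int (gamG0 X Y))).
  apply: cZ; apply: continuousBf; first exact: continuous_dgamG.
  by apply: cM => //; exact: continuous_cstf.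
have c2 : continuous (dgam2 X Y V).
  apply: cZ; apply: continuousDf; last exact: cZ.
  apply: continuousDf; last exact: cZ.
  by apply: cM => //; apply: continuousDf; exact: cM.
exact: (Kmetric_mean_zero hs W c1 c2 (tanP_dgam hs X Y V) (tanQ_dgam hs X Y V)).
Qed.

Let continuous_gam2_base X Y : continuous (gam2_base X Y).
Proof. by apply: cZ; apply: continuousDf; exact: cM. Qed.

Lemma Kmetric_gam_base Z Y W (A B : R -> R) : tanP Z = A -> tanQ Z = B ->
  Kmetric Ke (gam_base Z Y) W = 1 / 4 * circle_int (fun x =>
    1 / 2 * (A x * tanP Y x + B x * tanQ Y x) * tanP W x
    + - (1 / 2) * (A x * tanQ Y x + tanP Y x * B x) * tanQ W x).
Proof.
move=> <- <-.
have c1 : continuous (fun x => 1 / 2 * gamG0 Z Y x).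
  by apply: cZ; exact: continuous_gamG0.
have e : tanP (gam_base Z Y) =
    fun x => 1 / 2 * gamG0 Z Y x - 1 / 2 * circle_int (gamG0 Z Y).
  by rewrite tanP_gam_base//; apply/funext => x; rewrite mulrBr.
exact: (Kmetric_mean_zero hs W c1 (@continuous_gam2_base Z Y) e (tanQ_gam_base hs Z Y)).
Qed.

Lemma tanQ_gam_base_mean X Y (l : R) :
  circle_int (fun x => tanP X x * tanQ Y x) + circle_int (fun x => tanP Y x * tanQ X x) = l ->
  tanQ (gam_base X Y) = fun x =>
    - (1 / 2) * (tanP X x * tanQ Y x + tanP Y x * tanQ X x - l).
Proof.
move=> <-; rewrite tanQ_gam_base// /cproj.
have -> : circle_int (gam2_base X Y) = - (1 / 2) *
    (circle_int (fun x => tanP X x * tanQ Y x) + circle_int (fun x => tanP Y x * tanQ X x)).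
  rewrite -circle_intDf; [|exact: cM..].
  by rewrite -circle_intZ//; apply: continuousDf; exact: cM.
by apply/funext => x; rewrite -mulrBr.
Qed.

Let sum4 (f1 f2 f3 f4 : R -> R) : continuous f1 -> continuous f2 -> continuous f3 ->
  continuous f4 ->
  1 / 4 * circle_int f1 - 1 / 4 * circle_int f2 + 1 / 4 * circle_int f3
    - 1 / 4 * circle_int f4 =
  1 / 4 * circle_int (fun x => f1 x - f2 x + f3 x - f4 x).
Proof.
move=> c1 c2 c3 c4.
have c12 : continuous (fun x => f1 x - f2 x) by exact: continuousBf.
have c123 : continuous (fun x => f1 x - f2 x + f3 x) by exact: continuousDf.
by rewrite circle_intBf// circle_intDf// circle_intBf//; ring.
Qed.

(** One integration by parts in each term. The boundary terms vanish because [V.1] is 0 at 0 and at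
    1, and [tanQ] has the same derivative as the representative. *)
Lemma Komega_e u v : Komega u v = 1 / 4 *
  (circle_int (fun x => tanQ v x * tanP u x) - circle_int (fun x => tanP v x * tanQ u x)).
Proof.
have ibp U V : circle_int (fun x => derive1 (repr U.2) x * V.1 x) =
    - circle_int (fun x => tanQ U x * tanP V x).
  have dU := is_derive_HsR hs U.2; have dV := is_derive_Hs0 hs V.1.
  have [_ _ cU _] := Hle_derive1 r3 (Hle_Hs (repr U.2)).
  have dT x : is_derive x (1 : R) (tanQ U) (derive1 (repr U.2) x).
    by rewrite -[derive1 _ x]subr0; apply: is_deriveB; exact: is_derive_cst.
  apply: (circle_int_by_parts cU (@cP V) dT dV).
  by have := Hs_periodic V.1 0; rewrite add0r Hs0_at0 => ->; rewrite !mulr0.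
rewrite /Komega; congr (_ * _).
have [_ _ cu _] := Hle_derive1 r3 (Hle_Hs (repr u.2)).
have [_ _ cv _] := Hle_derive1 r3 (Hle_Hs (repr v.2)).
have c1 := @Hs_continuous _ _ v.1; have c2 := @Hs_continuous _ _ u.1.
rewrite circle_intBf; [|exact: cM..].
rewrite !ibp opprK addrC; congr (_ - circle_int _).
by apply/funext => x; rewrite mulrC.
Qed.

Let combine4 (M : zmodType) (a b c d a' b' c' d' : M) :
  a = a' -> b = b' -> c = c' -> d = d' -> a - b + c - d = a' - b' + c' - d'.
Proof. by move=> -> -> -> ->. Qed.

Lemma Kcurv_e u v : Kcurv Ke u v v =
  dgam v u v - dgam v v u + gam_base (gam_base v v) u - gam_base (gam_base v u) v.
Proof.
have d1 : 'd (fun n : TK s => Kgamma (Kchart_inv (Kdeg (Ke : Ks s)) n) v u)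
    (Kcoord (Ke : Ks s)) = dgam v u :> (TK s -> TK s) := Kgamma_diff hs v u _.
have d2 : 'd (fun n : TK s => Kgamma (Kchart_inv (Kdeg (Ke : Ks s)) n) v v)
    (Kcoord (Ke : Ks s)) = dgam v v :> (TK s -> TK s) := Kgamma_diff hs v v _.
have k1 : Kgamma Ke (Kgamma Ke v v) u = gam_base (gam_base v v) u.
  by rewrite (Kgamma_e hs v v); exact: Kgamma_e.
have k2 : Kgamma Ke (Kgamma Ke v u) v = gam_base (gam_base v u) v.
  by rewrite (Kgamma_e hs v u); exact: Kgamma_e.
exact: (combine4 (congr1 (fun F => F v) d1) (congr1 (fun F => F u) d2) k1 k2).
Qed.

Lemma Kcurv_formula u v : Kmetric Ke (Kcurv Ke u v v) u =
  Kmetric Ke u u * Kmetric Ke v v - Kmetric Ke u v ^+ 2 + 3 * Komega u v ^+ 2.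
Proof.
have sym f g : circle_int (fun x => f x * g x) = circle_int (fun x => g x * f x).
  by congr circle_int; apply/funext => x; rewrite mulrC.
pose E f g := circle_int (fun x => f x * g x).
have G0E X Y : circle_int (gamG0 X Y) = E (tanP X) (tanP Y) + E (tanQ X) (tanQ Y).
  by rewrite circle_intDf//; exact: cM.
(* The same integral with its factors in either order: [h1] needs the forms [E a b] and [E a q] of
   [curvature_integral], [h2] the form [E b p]. *)
have m1 X Y : meanQP X Y = E (tanP Y) (tanQ X) by exact: sym.
have m2 X Y : meanQP X Y = E (tanQ X) (tanP Y) by [].
have h1 := Kmetric_dgam u (m1 v v) (m1 u v) (G0E v u).
have h2 := Kmetric_dgam u (m2 v u) (m2 v u) (G0E v v).
have PE X Y : tanP (gam_base X Y) = fun x => 1 / 2 * (tanP X x * tanP Y x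
    + tanQ X x * tanQ Y x - (E (tanP X) (tanP Y) + E (tanQ X) (tanQ Y))).
  by have := tanP_gam_base hs X Y; rewrite (G0E X Y).
have l1 : E (tanP v) (tanQ v) + E (tanP v) (tanQ v) =
  E (tanP v) (tanQ v) + E (tanP v) (tanQ v) by [].
have l2 : E (tanP v) (tanQ u) + E (tanP u) (tanQ v) =
  E (tanP v) (tanQ u) + E (tanQ v) (tanP u).
  by rewrite [E (tanP u) _]sym.
have h3 := Kmetric_gam_base u u (PE v v) (tanQ_gam_base_mean l1).
have h4 := Kmetric_gam_base v u (PE v u) (tanQ_gam_base_mean l2).
have hR1 := Kmetric_e u u.
have hR2 := Kmetric_e v v.
have hR3 := Kmetric_e u v.
have hR4 := Komega_e u v.
have e0 : Kmetric Ke (Kcurv Ke u v v) u = Kmetric Ke (dgam v u v) u -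
    Kmetric Ke (dgam v v u) u + Kmetric Ke (gam_base (gam_base v v) u) u
    - Kmetric Ke (gam_base (gam_base v u) v) u.
  by rewrite Kcurv_e (KmetricB hs) (KmetricD hs) (KmetricB hs).
rewrite e0 (combine4 h1 h2 h3 h4) hR1 hR2 hR3 hR4.
(* The rest is an identity between integrals of four continuous functions: [p], [q] come from [u]
   and [a], [b] from [v]. *)
have cp := @cP u; have cq := @cQ u; have ca := @cP v; have cb := @cQ v.
move: (tanP u) (tanQ u) (tanP v) (tanQ v) cp cq ca cb => p q a b cp cq ca cb.
have cc (e : R) (f : R -> R) : continuous f -> continuous (fun x => f x * e).
  by move=> cf; apply: continuousMf => //; exact: continuous_cstf.
have cB (e : R) (f : R -> R) : continuous f -> continuous (fun x => f x - e).
  by move=> cf; apply: continuousBf => //; exact: continuous_cstf.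
have cpq (e e' : R) (f g : R -> R) : continuous f -> continuous g ->
    continuous (fun x => e * f x * p x + e' * g x * q x).
  by move=> cf cg; apply: continuousDf; apply: continuousMf => //; exact: cZ.
have cMM (f1 g1 f2 g2 : R -> R) : continuous f1 -> continuous g1 -> continuous f2 ->
    continuous g2 -> continuous (fun x => f1 x * g1 x + f2 x * g2 x).
  by move=> *; apply: continuousDf; exact: cM.
have cBM (f1 g1 f2 g2 : R -> R) : continuous f1 -> continuous g1 -> continuous f2 ->
    continuous g2 -> continuous (fun x => f1 x * g1 x - f2 x * g2 x).
  by move=> *; apply: continuousBf; exact: cM.
have cbz (e : R) (f g : R -> R) : continuous f -> continuous g ->
    continuous (fun x => f x - e * g x).
  by move=> *; apply: continuousBf => //; exact: cZ.
have cdz (e : R) (f g : R -> R) : continuous f -> continuous g ->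
    continuous (fun x => f x + e * g x).
  by move=> *; apply: continuousDf => //; exact: cZ.
rewrite sum4; last 4 first.
- apply: cpq.
    apply: continuousBf; last exact: (cc _ _ ca).
    apply: (cbz _ _ _ _ cb); apply: (cbz _ _ _ _ cq); apply: (@cM _ _ _ ca).
    exact: (cBM _ _ _ _ cb cq ca cp).
  by apply: (cdz _ _ _ _ cp); apply: (cdz _ _ _ _ ca); apply: (@cM _ _ _ ca);
    exact: (cMM _ _ _ _ ca cq cp cb).
- apply: cpq.
    apply: continuousBf; last exact: (cc _ _ cp).
    by apply: (cbz _ _ _ _ cb); apply: (cbz _ _ _ _ cb); apply: (@cM _ _ _ cp);
      exact: (cBM _ _ _ _ cb cb ca ca).
  by apply: (cdz _ _ _ _ ca); apply: (cdz _ _ _ _ ca); apply: (@cM _ _ _ cp);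
    exact: (cMM _ _ _ _ ca cb ca cb).
- have A1 (e : R) : continuous (fun x => 1 / 2 * (a x * a x + b x * b x - e)).
    by apply: cZ; apply: cB; exact: (cMM _ _ _ _ ca ca cb cb).
  have A2 (e : R) : continuous (fun x => - (1 / 2) * (a x * b x + a x * b x - e)).
    by apply: cZ; apply: cB; exact: (cMM _ _ _ _ ca cb ca cb).
  by apply: cpq;
    [exact: (cMM _ _ _ _ (A1 _) cp (A2 _) cq)|exact: (cMM _ _ _ _ (A1 _) cq cp (A2 _))].
- have A1 (e : R) : continuous (fun x => 1 / 2 * (a x * p x + b x * q x - e)).
    by apply: cZ; apply: cB; exact: (cMM _ _ _ _ ca cp cb cq).
  have A2 (e : R) : continuous (fun x => - (1 / 2) * (a x * q x + p x * b x - e)).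
    by apply: cZ; apply: cB; exact: (cMM _ _ _ _ ca cq cp cb).
  by apply: cpq;
    [exact: (cMM _ _ _ _ (A1 _) ca (A2 _) cb)|exact: (cMM _ _ _ _ (A1 _) cb ca (A2 _))].
rewrite (@curvature_integral R a b p q _ (E a p) (E b q) (E a q) (E b p))//.
rewrite !circle_intDf; try by apply: continuousMf.
rewrite -!/(E _ _) [E p a]sym [E q b]sym -!/(E _ _).
move: (E a a) (E b b) (E a p) (E b q) (E b p) (E a q) (E p p) (E q q).
by move=> *; field.
Qed.

End CurvatureFormula.

(** * The Kaehler structure at the identity *)

Section KahlerStructure.
Context {R : realType} {s : R}.
Hypothesis hs : 5 / 2 < s.
Notation r := (s - 1).
Implicit Types (u v w : TK s) (f g h : R -> R).

Let r3 : 3 / 2 < r. Proof. rewrite ltrBrDr; have := hs; lra. Qed.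
Let r2 : 1 / 2 < r. Proof. by apply: lt_trans r3; lra. Qed.

Lemma Kmetric_ge0 u : 0 <= Kmetric Ke u u.
Proof.
rewrite Kmetric_e mulr_ge0//.
have cp := @continuous_tanP R s hs u; have cq := @continuous_tanQ R s u.
move: (tanP u) (tanQ u) cp cq => p q cp cq.
rewrite -(@circle_int_cst R 0); apply: le_circle_int.
- exact: continuous_cstf.
- by apply: continuousDf; exact: continuousMf.
- by move=> x _; rewrite -!expr2 addr_ge0 ?sqr_ge0.
Qed.

Lemma Knorm_sqr u : Knorm Ke u ^+ 2 = Kmetric Ke u u.
Proof. by rewrite sqr_sqrtr// Kmetric_ge0. Qed.

Let orthogonal_null (f g : R -> R) : continuous f -> continuous g ->
  circle_int (fun x => f x * f x) = 0 -> circle_int (fun x => f x * g x) = 0.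
Proof.
move=> cf cg f0; apply/eqP; apply: contraT => K0.
set K := circle_int _ in K0; set G := circle_int (fun x => g x * g x).
(* With this [t] the integral of $(tf+g)^2$ would be $2tK+G=-1$. *)
pose t := - (G + 1) / (2 * K).
have cZ (e : R) (h : R -> R) : continuous h -> continuous (fun x => e * h x).
  by move=> ch; apply: continuousMf => //; exact: continuous_cstf.
have c1 := continuousMf cf cf; have c2 := continuousMf cf cg.
have c3 := continuousMf cg cg; have c23 := continuousDf (cZ (2 * t) _ c2) (cZ 1 _ c3).
have h0 : 0 <= circle_int (fun x => t ^+ 2 * (f x * f x) +
    1 * (2 * t * (f x * g x) + 1 * (g x * g x))).
  rewrite -(@circle_int_cst R 0); apply: le_circle_int.
  - exact: continuous_cstf.
  - exact: continuousDf (cZ _ _ c1) (cZ _ _ c23).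
  - move=> x _; rewrite [leRHS](_ : _ = (t * f x + g x) ^+ 2) ?sqr_ge0//; ring.
rewrite (circle_int_lin2 _ _ c1 c23) (circle_int_lin2 _ _ c2 c3) in h0.
move: h0; rewrite f0 mulr0 add0r !mul1r -/K -/G.
have -> : 2 * t * K = - (G + 1) by rewrite /t; field; rewrite K0.
lra.
Qed.

(** A function of zero $L^2$ norm is orthogonal to every sine and cosine, so Fourier uniqueness
    applies. *)
Let null_of_sqr (f : R -> R) : continuous f -> (forall x, f (x + 1) = f x) ->
  circle_int (fun x => f x * f x) = 0 -> forall x, f x = 0.
Proof.
move=> cf pf f0; apply: fourier_unique => // n; apply: orthogonal_null => //.
  exact: continuous_cosn.
exact: continuous_sinn.
Qed.

(** The metric sees only $u_{1x}$ and $\pi(u_2)$; the condition $u_1(0)=0$ and the quotient by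
    constants remove exactly what these two lose. *)
Lemma Kmetric_definite u : Kmetric Ke u u = 0 -> u = 0.
Proof.
have [_ pp cp _] := tanP_Hle hs u; have [A [_ pq cq _]] := tanQ_Hle u.
have dP := is_derive_Hs0 hs u.1.
have u20 : (forall x, tanQ u x = 0) -> u.2 = 0.
  move=> q0; rewrite -[LHS]cls_repr -[RHS](raddf0 (\pi_(HsR r)%qT)).
  apply/clsP; exists (circle_int (repr u.2)) => x.
  have := q0 x; rewrite /tanQ /cproj => /eqP; rewrite subr_eq0 => /eqP ->.
  by rewrite -[in RHS]/(0 + circle_int (repr u.2)) add0r.
have u10 : (forall x, tanP u x = 0) -> u.1 = 0.
  move=> p0; apply: Hs0_eq => x.
  by rewrite (is_derive_eq0 dP p0 x 0) Hs0_at0.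
rewrite Kmetric_e => /eqP; rewrite mulf_eq0 => /orP[|/eqP].
  by rewrite mulf_eq0 oner_eq0 invr_eq0 pnatr_eq0.
rewrite circle_intDf; [|exact: continuousMf..] => /eqP.
have sq_ge0 (f : R -> R) : continuous f -> 0 <= circle_int (fun x => f x * f x).
  move=> cf; rewrite -(@circle_int_cst R 0); apply: le_circle_int.
  - exact: continuous_cstf.
  - exact: continuousMf.
  - by move=> x _; rewrite -expr2 sqr_ge0.
rewrite paddr_eq0 ?sq_ge0// => /andP[/eqP p0 /eqP q0].
have /u10 e1 := null_of_sqr cp pp p0; have /u20 e2 := null_of_sqr cq pq q0.
by case: u e1 e2 {pp cp pq cq dP u20 u10 p0 q0} => u1 u2 /= -> ->.
Qed.

Lemma tanP_KJ u : tanP (KJ u) = fun x => - tanQ u x.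
Proof.
(* The first component of [KJ] has to be shown to lie in $H^s$: as [tanQ u] has mean 0, its
   primitive is periodic and gains one derivative. *)
have [A qA] := tanQ_Hle u; have [C C0 /(_ _ _ qA)] := @Hle_prim R r r2.
have cq := @continuous_tanQ R s u; have q0 := circle_int_tanQ u.
rewrite subrK q0.
have -> : (fun x => prim (tanQ u) x - x * 0) = prim (tanQ u).
  by apply/funext => x; rewrite mulr0 subr0.
move=> /HleN h; rewrite /tanP/= (toHs0E h) ?prim0 ?oppr0//.
by apply: is_derive_derive1 => x; apply: is_deriveN; exact: is_derive_prim.
Qed.

Lemma tanQ_KJ u : tanQ (KJ u) = tanP u.
Proof.
rewrite tanQ_cls (toHsE (tanP_Hle hs u)); apply/funext => x.
by rewrite /cproj -/(tanP u) circle_int_tanP// subr0.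
Qed.

Lemma Kmetric_KJ_norm u : Kmetric Ke (KJ u) (KJ u) = Kmetric Ke u u.
Proof.
rewrite !Kmetric_e tanP_KJ tanQ_KJ; congr (_ * circle_int _); apply/funext => x.
by rewrite mulrNN addrC.
Qed.

Lemma Kmetric_KJ_orthogonal u : Kmetric Ke (KJ u) u = 0.
Proof.
rewrite Kmetric_e tanP_KJ tanQ_KJ -[RHS](mulr0 (1 / 4)) -[X in _ = _ * X](@circle_int_cst R 0).
congr (_ * circle_int _); apply/funext => x.
by rewrite mulrC mulrN addNr.
Qed.

Lemma Kmetric_KJ u v : Kmetric Ke (KJ u) v = Komega u v.
Proof.
rewrite (Komega_e hs) Kmetric_e tanP_KJ tanQ_KJ; congr (_ * _).
rewrite -circle_intBf; [|by apply: continuousMf; [exact: continuous_tanQ|exact: continuous_tanP]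
  |by apply: continuousMf; [exact: continuous_tanP|exact: continuous_tanQ]].
by congr circle_int; apply/funext => x; rewrite mulNr addrC mulrC [tanQ u x * _]mulrC.
Qed.

End KahlerStructure.

(** The sectional curvature depends only on the plane, whereas being a multiple of [v] depends on
    the basis: $Ju=cv$ forces $u\perp v$. The criterion is therefore given literally for orthogonal
    pairs, and with the span of [u] and [v] in general. *)
Theorem corollary7p2 (R : realType) (s : R) (hs : 5 / 2 < s) :
  (forall u v : TK s,
     Kmetric Ke (Kcurv Ke u v v) u =
       Knorm Ke u ^+ 2 * Knorm Ke v ^+ 2 - Kmetric Ke u v ^+ 2
       + 3 * Komega u v ^+ 2)
  /\ (forall u v : TK s, lin_indep u v -> 1 <= Ksec u v <= 4)
  /\ (forall u v : TK s, lin_indep u v -> Kmetric Ke u v = 0 ->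
        (Ksec u v = 4 <-> exists c : R, KJ u = c *: v))
  /\ (forall u v : TK s, lin_indep u v ->
        (Ksec u v = 4 <-> exists a b : R, KJ u = a *: u + b *: v)).
Proof.
have formula (u v : TK s) : Kmetric Ke (Kcurv Ke u v v) u =
    Knorm Ke u ^+ 2 * Knorm Ke v ^+ 2 - Kmetric Ke u v ^+ 2 + 3 * Komega u v ^+ 2.
  exact: etrans (Kcurv_formula hs u v)
    (f_equal2 (fun x y : R => x * y - Kmetric Ke u v ^+ 2 + 3 * Komega u v ^+ 2)
      (esym (Knorm_sqr hs u)) (esym (Knorm_sqr hs v))).
pose D (u v : TK s) := Kmetric (Ke : Ks s) u u * Kmetric Ke v v - Kmetric Ke u v ^+ 2.
(* The curvature is $1+3\omega^2/D$, so the two bounds amount to $0\le\omega^2\le D$, and the value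
   4 to $\omega^2=D$. *)
have secE (u v : TK s) : Ksec u v = (D u v + 3 * Komega u v ^+ 2) / D u v.
  have e1 := Kcurv_formula hs u v; have e2 := Knorm_sqr hs u; have e3 := Knorm_sqr hs v.
  rewrite /Ksec /D; move: e1 e2 e3.
  set k := Kmetric Ke (Kcurv Ke u v v) u; set a := Knorm Ke u; set b := Knorm Ke v.
  set x := Kmetric Ke u u; set y := Kmetric Ke v v; set z := Kmetric Ke u v.
  by move: k a b x y z => k a b x y z -> -> ->.
have D0 (u v : TK s) : lin_indep u v -> 0 < D u v.
  move=> uv.
  exact: (plane_gram_gt0 (@KmetricC R s) (Kmetric_lin hs) (Kmetric_ge0 hs)
    (Kmetric_definite hs) (Kmetric_KJ_norm hs u) (Kmetric_KJ_orthogonal hs u) uv).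
have sec4 (u v : TK s) : lin_indep u v -> Ksec u v = 4 <-> Kmetric Ke (KJ u) v ^+ 2 = D u v.
  move=> /D0 Dp; rewrite secE Kmetric_KJ//; split=> [/(canRL (divfK (lt0r_neq0 Dp)))|->].
    by move: (D u v) (Komega u v) => d o; lra.
  by move: (D u v) Dp => d dp; field; exact: lt0r_neq0.
split; [exact: formula|split; [|split]] => u v uv.
- have Dp := D0 _ _ uv; rewrite secE ler_pdivlMr// ler_pdivrMr//.
  have : Komega u v ^+ 2 <= D u v.
    rewrite -(Kmetric_KJ hs).
    exact: (plane_kahler_le (@KmetricC R s) (Kmetric_lin hs) (Kmetric_ge0 hs)
      (Kmetric_definite hs) (Kmetric_KJ_norm hs u) (Kmetric_KJ_orthogonal hs u) uv).
  have := sqr_ge0 (Komega u v).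
  by move: (Komega u v ^+ 2) (D u v) => o d; lra.
- move=> n0; rewrite (sec4 _ _ uv).
  exact: (plane_kahler_eq_orthogonal (@KmetricC R s) (Kmetric_lin hs) (Kmetric_ge0 hs)
    (Kmetric_definite hs) (Kmetric_KJ_norm hs u) (Kmetric_KJ_orthogonal hs u) uv n0).
- rewrite (sec4 _ _ uv).
  exact: (plane_kahler_eq (@KmetricC R s) (Kmetric_lin hs) (Kmetric_ge0 hs)
    (Kmetric_definite hs) (Kmetric_KJ_norm hs u) (Kmetric_KJ_orthogonal hs u) uv).
Qed.
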